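(* In the presence of the other axioms in the definition of ($N=1$ Neveu-Schwarz) vertex operator superalgebra over $\bigwedge_*$ with odd formal variables, the Jacobi identity follows from the rationality of products and iterates and supercommutativity and associativity. In particular, the Jacobi identity may be replaced by these properties. That is, let $(V,Y(\cdot,(x,\varphi)),\mathbf{1},\tau)$ be data satisfying all requirements of the definition except possibly the Jacobi identity (axiom (4)). If properties (P1)–(P4) below hold, then the Jacobi identity holds for all $u,v\in V$ of homogeneous sign; and in the definition the Jacobi identity may equivalently be replaced by (P1)–(P4). (P1) (rationality of products) For $u,v,w\in V$ with $u,v$ of homogeneous sign and $v'\in V'$, the formal series $\langle v',Y(u,(x_1,\varphi_1))Y(v,(x_2,\varphi_2))w\rangle$ involves only finitely many negative powers of $x_2$ and only finitely many positive powers of $x_1$ and equals $\iota_{12}f(x_1,\varphi_1,x_2,\varphi_2)$ for a (uniquely determined) $f\in\bigwedge_*[x_1,\varphi_1,x_2,\varphi_2]_{S'}$ of the form $f=\dfrac{g(x_1,\varphi_1,x_2,\varphi_2)}{x_1^rx_2^s(x_1-x_2-\varphi_1\varphi_2)^t}$ with $g\in\bigwedge_*[x_1,\varphi_1,x_2,\varphi_2]$ and $r,s,t\in\mathbb{Z}$. (P2) (rationality of iterates) For $u,v,w\in V$ and $v'\in V'$, the formal series $\langle v',Y(Y(u,(x_0,\varphi_1-\varphi_2))v,(x_2,\varphi_2))w\rangle$ involves only finitely many negative powers of $x_0$ and only finitely many positive powers of $x_2$ and equals $\iota_{20}h(x_0,\varphi_1-\varphi_2,x_2,\varphi_2)$ for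 a (uniquely determined) $h\in\bigwedge_*[x_0,\varphi_1,x_2,\varphi_2]_{S'}$ with $h(x_0,\varphi_1-\varphi_2,x_2,\varphi_2)=\dfrac{k(x_0,\varphi_1-\varphi_2,x_2,\varphi_2)}{x_0^rx_2^s(x_0+x_2-\varphi_1\varphi_2)^t}$, $k\in\bigwedge_*[x_0,\varphi_1,x_2,\varphi_2]$ and $r,s,t\in\mathbb{Z}$. (P3) (supercommutativity) For $u,v,w,v'$ as in (P1), $$\iota_{12}^{-1}\langle v',Y(u,(x_1,\varphi_1))Y(v,(x_2,\varphi_2))w\rangle=(-1)^{\eta(u)\eta(v)}\iota_{21}^{-1}\langle v',Y(v,(x_2,\varphi_2))Y(u,(x_1,\varphi_1))w\rangle.$$ (P4) (associativity) For $u,v,w\in V$ and $v'\in V'$, as rational functions, $$\iota_{12}^{-1}\langle v',Y(u,(x_1,\varphi_1))Y(v,(x_2,\varphi_2))w\rangle=\left.\left(\iota_{20}^{-1}\langle v',Y(Y(u,(x_0,\varphi_1-\varphi_2))v,(x_2,\varphi_2))w\rangle\right)\right|_{x_0=x_1-x_2-\varphi_1\varphi_2}.$$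
   Context: **Grassmann algebras and conventions.** $\bigwedge_*$ denotes either $\bigwedge_L$, the exterior algebra over $\mathbb{C}$ of an $L$-dimensional complex vector space $U_L$ ($L\in\mathbb{N}$, $U_L\subset U_{L+1}$), or the direct limit $\bigwedge_\infty$ of the $\bigwedge_L$; it is $\mathbb{Z}_2$-graded, $\bigwedge_*=\bigwedge_*^0\oplus\bigwedge_*^1$. For $a\in\bigwedge_*$, its body $a_B\in\mathbb{C}$ is its component of exterior degree $0$. For a $\mathbb{Z}_2$-graded space, $\eta(v)=i$ for $v$ homogeneous of sign $i\in\{0,1\}$. $[A,B]$ denotes the supercommutator $AB-(-1)^{\eta(A)\eta(B)}BA$ for homogeneous $A,B$. Even formal variables ($x,x_0,x_1,x_2$) commute with everything. Odd formal variables ($\varphi,\varphi_1,\varphi_2$) commute with even variables and with even elements of $\bigwedge_*$ and even operators, anticommute with each other and with odd elements of $\bigwedge_*$ and odd operators, and square to zero. $\delta(x)=\sum_{n\in\mathbb{Z}}x^n$. Expressions such as $(x_1-x_2)^n$, $n\in\mathbb{Z}$, inside delta functions are expanded in nonnegative powers of the second variable, and functions of even and odd variables are expanded about the even variables: $(x_1-x_2-\varphi_1\varphi_2)^n=(x_1-x_2)^n-n\varphi_1\varphi_2(x_1-x_2)^{n-1}$, so $\delta\left(\frac{x_1-x_2-\varphi_1\varphi_2}{x_0}\right)=\sum_{n\in\mathbb{Z}}(x_1-x_2-\varphi_1\varphi_2)^nx_0^{-n}$, and similarly for other such expressions. $Y$ is extended linearly to series with formal-variable coefficients. **Vertex operator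 superalgebra over $\bigwedge_*$ with odd formal variables.** This is a $\frac12\mathbb{Z}$-graded (by weight) $\bigwedge_*$-module, also $\mathbb{Z}_2$-graded (by sign), $V=\coprod_{n\in\frac12\mathbb{Z}}V_{(n)}=\coprod_{n}V^0_{(n)}\oplus\coprod_nV^1_{(n)}=V^0\oplus V^1$, with $\dim V_{(n)}<\infty$ for all $n\in\frac12\mathbb{Z}$ and $V_{(n)}=0$ for $n$ sufficiently small (positive energy), equipped with a linear map $V\otimes V\to V[[x,x^{-1}]][\varphi]$, equivalently $V\to(\mathrm{End}\,V)[[x,x^{-1}]][\varphi]$, $v\mapsto Y(v,(x,\varphi))=\sum_{n\in\mathbb{Z}}v_nx^{-n-1}+\varphi\sum_{n\in\mathbb{Z}}v_{n-\frac12}x^{-n-1}$, where $v_n\in(\mathrm{End}\,V)^{\eta(v)}$ and $v_{n-\frac12}\in(\mathrm{End}\,V)^{(\eta(v)+1)\bmod 2}$ for $v$ of homogeneous sign, and with distinguished vectors $\mathbf{1}\in V^0_{(0)}$ (vacuum) and $\tau\in V^1_{(3/2)}$ (Neveu-Schwarz element), such that for $u,v\in V$: (1) (truncation) $u_nv=0$ for $n\in\frac12\mathbb{Z}$ sufficiently large; (2) $Y(\mathbf{1},(x,\varphi))=1$; (3) (creation) $Y(v,(x,\varphi))\mathbf{1}\in V[[x]][\varphi]$ and $\lim_{(x,\varphi)\to0}Y(v,(x,\varphi))\mathbf{1}=v$; (4) (Jacobi identity) for $u,v$ of homogeneous sign, $$x_0^{-1}\delta\left(\tfrac{x_1-x_2-\varphi_1\varphi_2}{x_0}\right)Y(u,(x_1,\varphi_1))Y(v,(x_2,\varphi_2))-(-1)^{\eta(u)\eta(v)}x_0^{-1}\delta\left(\tfrac{x_2-x_1+\varphi_1\varphi_2}{-x_0}\right)Y(v,(x_2,\varphi_2))Y(u,(x_1,\varphi_1))$$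 $$=x_2^{-1}\delta\left(\tfrac{x_1-x_0-\varphi_1\varphi_2}{x_2}\right)Y(Y(u,(x_0,\varphi_1-\varphi_2))v,(x_2,\varphi_2));$$ (5) (Neveu-Schwarz relations) with $G(n+\frac12)=\tau_{n+1}$ and $2L(n)=\tau_{n+\frac12}$ for $n\in\mathbb{Z}$, one has for $m,n\in\mathbb{Z}$: $[L(m),L(n)]=(m-n)L(m+n)+\frac1{12}(m^3-m)\delta_{m+n,0}(\mathrm{rank}\,V)$, $[G(m+\frac12),L(n)]=(m-\frac{n-1}{2})G(m+n+\frac12)$, $[G(m+\frac12),G(n-\frac12)]=2L(m+n)+\frac13(m^2+m)\delta_{m+n,0}(\mathrm{rank}\,V)$, where $\mathrm{rank}\,V\in\mathbb{C}$; (6) $L(0)v=nv$ for $n\in\frac12\mathbb{Z}$ and $v\in V_{(n)}$; (7) ($G(-\frac12)$-derivative property) $\left(\frac{\partial}{\partial\varphi}+\varphi\frac{\partial}{\partial x}\right)Y(v,(x,\varphi))=Y(G(-\tfrac12)v,(x,\varphi))$. **Graded dual.** $V_{(n)}^*=\mathrm{Hom}_{\bigwedge_*}(V_{(n)},\bigwedge_* )$, $V'=\coprod_{n\in\frac12\mathbb{Z}}V_{(n)}^*$ is the graded dual, and $\langle\cdot,\cdot\rangle$ is the natural pairing of $V'$ with $\prod_nV_{(n)}$, applied coefficientwise to formal series (with the odd formal variables written to the left of the coefficients). **Rational superfunctions and expansion maps.** For even variables $x_i,x_j$, $\bigwedge_*[x_i,\varphi_1,x_j,\varphi_2]_{S'}$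 is the ring obtained from $\bigwedge_*[x_i,x_j][\varphi_1,\varphi_2]$ by inverting the set $S'$ of all $a_ix_i+a_jx_j+a\varphi_1\varphi_2$ with $a_i,a_j,a\in\bigwedge_*^0$ and $(a_i)_B,(a_j)_B$ not both zero. Expanding about the even variables, $\frac{1}{a_ix_i+a_jx_j+a\varphi_1\varphi_2}=\frac{1}{a_ix_i+a_jx_j}-\frac{a\varphi_1\varphi_2}{(a_ix_i+a_jx_j)^2}$. The map $\iota_{ij}$ sends an element of this ring to a formal series in $\bigwedge_*[[x_i,x_i^{-1},x_j,x_j^{-1}]][\varphi_1,\varphi_2]$ by first expanding in the odd variables as just described and then expanding each term as a series containing at most finitely many negative powers of $x_j$ (binomial expansion of negative powers of linear polynomials involving both variables); thus $\iota_{12}$ and $\iota_{21}$ are defined on the same ring but expand with finitely many negative powers of $x_2$, respectively $x_1$. $\iota_{ij}^{-1}$ denotes the inverse on the image. $h(x_0,\varphi_1-\varphi_2,x_2,\varphi_2)$ denotes the result of substituting $\varphi_1-\varphi_2$ for $\varphi_1$ in $h$.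
   Formalization: Over the infinite Grassmann algebra, ''dim V_(n) < ∞'' is taken to mean that V_(n) is a free module of finite rank; with finite dimension over ℂ or mere finite generation the graded dual V' can vanish and the claim fails. *)

(* Defs.v *)
From HB Require Import structures.
From mathcomp Require Import all_boot all_order all_algebra.
From mathcomp Require Import finmap monalg complex.
From mathcomp Require Import boolp classical_sets functions cardinality fsbigop reals.

Set Implicit Arguments.
Unset Strict Implicit.
Unset Printing Implicit Defensive.

Import Order.TTheory GRing.Theory Num.Theory.
Local Open Scope ring_scope.

(* The exterior algebra on the generators e_i, i < L (i in nat if L = None);
   its basis is given by the finite sets of generators, listed in increasing
   order. *)
Definition generator (L : option nat) : countType :=
  if L is Some n then 'I_n : countType else nat : countType.

Definition grassmann (F : fieldType) (L : option nat) : Type :=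
  {malg F[{fset generator L}]}.

Section GrassmannRing.
Context (F : fieldType) (L : option nat).
Local Notation I := (generator L).
Local Notation K := {fset I}.
Local Notation A := (grassmann F L).

HB.instance Definition _ := GRing.Lmodule.copy A {malg F[K]}.

Implicit Types (S T U : K) (a b : A).

Definition inversions S T : nat :=
  (\sum_(i <- S) \sum_(j <- T) (choice.pickle j < choice.pickle i))%N.

(* e_S e_T = wedge_sign S T e_(S U T) *)
Definition wedge_sign S T : F :=
  if [disjoint S & T]%fset then (-1) ^+ inversions S T else 0.

Definition gmul a b : A :=
  \sum_(S <- msupp a) \sum_(T <- msupp b)
    << a@_S * b@_T * wedge_sign S T *g S `|` T >>%fset.

Definition gone : A := << fset0 >>.

Lemma perm_fsetU S T : [disjoint S & T]%fset -> perm_eq (S `|` T)%fset (S ++ T).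
Proof.
move=> /fdisjointP dST; apply: uniq_perm; rewrite ?fset_uniq //.
  rewrite cat_uniq !fset_uniq /= andbT; apply/hasPn => x xT.
  by apply/negP => /dST; rewrite xT.
by move=> x; rewrite in_fsetE mem_cat.
Qed.

Lemma inversionsUl S T U : [disjoint S & T]%fset ->
  inversions (S `|` T)%fset U = (inversions S U + inversions T U)%N.
Proof. by move=> d; rewrite /inversions (perm_big _ (perm_fsetU d)) big_cat. Qed.

Lemma inversionsUr S T U : [disjoint T & U]%fset ->
  inversions S (T `|` U)%fset = (inversions S T + inversions S U)%N.
Proof.
move=> d; rewrite /inversions -big_split /=; apply: eq_bigr => i _.
by rewrite (perm_big _ (perm_fsetU d)) big_cat.
Qed.

Lemma wedge_signA S T U :
  wedge_sign T U * wedge_sign S (T `|` U)%fset =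
  wedge_sign S T * wedge_sign (S `|` T)%fset U.
Proof.
rewrite /wedge_sign !fdisjointXU !fdisjointUX.
case: (boolP [disjoint T & U]%fset) => dTU; last first.
  by rewrite mul0r andbF mulr0.
case: (boolP [disjoint S & T]%fset) => dST /=; last by rewrite mulr0 mul0r.
case: ifP => _; last by rewrite !mulr0.
rewrite -!exprD inversionsUl // inversionsUr //; congr (_ ^+ _).
by rewrite addnCA; congr addn; rewrite addnC.
Qed.

Lemma wedge_sign0l S : wedge_sign fset0 S = 1.
Proof. by rewrite /wedge_sign fdisjoint0X /inversions big_seq_fset0 expr0. Qed.

Lemma wedge_sign0r S : wedge_sign S fset0 = 1.
Proof.
rewrite /wedge_sign fdisjointX0 /inversions big1 ?expr0 // => i _.
by rewrite big_seq_fset0.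
Qed.

Lemma gmulw (d1 d2 : {fset K}) a b :
  (msupp a `<=` d1)%fset -> (msupp b `<=` d2)%fset ->
  gmul a b = \sum_(S <- d1) \sum_(T <- d2)
    << a@_S * b@_T * wedge_sign S T *g S `|` T >>%fset.
Proof.
move=> le_d1 le_d2; rewrite /gmul (big_fset_incl _ le_d1) /=.
  apply/eq_bigr=> k1 _; apply/big_fset_incl => // k _ /mcoeff_outdom ->.
  by rewrite mulr0 mul0r monalgU0.
move=> k _ /mcoeff_outdom g1k.
by rewrite big1 // => k' _; rewrite g1k !mul0r monalgU0.
Qed.

Lemma gmulDl : left_distributive gmul +%R.
Proof.
move=> a b c.
rewrite (gmulw (msuppD_le a b) (fsubset_refl _)).
rewrite (gmulw (fsubsetUl _ (msupp b)) (fsubset_refl _)).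
rewrite (gmulw (fsubsetUr (msupp a) _) (fsubset_refl _)).
rewrite -big_split /=; apply/eq_bigr=> k1 _.
rewrite -big_split /=; apply/eq_bigr=> k2 _.
by rewrite mcoeffD !mulrDl monalgUD.
Qed.

Lemma gmulDr : right_distributive gmul +%R.
Proof.
move=> a b c.
rewrite (gmulw (fsubset_refl _) (msuppD_le b c)).
rewrite (gmulw (fsubset_refl _) (fsubsetUl _ (msupp c))).
rewrite (gmulw (fsubset_refl _) (fsubsetUr (msupp b) _)).
rewrite -big_split /=; apply/eq_bigr=> k1 _.
rewrite -big_split /=; apply/eq_bigr=> k2 _.
by rewrite mcoeffD mulrDr mulrDl monalgUD.
Qed.

Lemma gmul0g : left_zero 0 gmul.
Proof. by move=> a; rewrite /gmul msupp0 big_seq_fset0. Qed.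

Lemma gmulg0 : right_zero 0 gmul.
Proof.
by move=> a; rewrite /gmul msupp0 big1 // => S _; rewrite big_seq_fset0.
Qed.

Lemma gmulUU x y S T :
  gmul << x *g S >> << y *g T >> = << x * y * wedge_sign S T *g S `|` T >>%fset.
Proof. by rewrite (gmulw msuppU_le msuppU_le) !big_seq_fset1 !mcoeffUU. Qed.

Lemma gmul_suml (J : Type) (r : seq J) (f : J -> A) b :
  gmul (\sum_(j <- r) f j) b = \sum_(j <- r) gmul (f j) b.
Proof. exact: (big_morph (gmul^~ b) (fun _ _ => gmulDl _ _ _) (gmul0g _)). Qed.

Lemma gmul_sumr (J : Type) (r : seq J) (f : J -> A) a :
  gmul a (\sum_(j <- r) f j) = \sum_(j <- r) gmul a (f j).
Proof. exact: (big_morph (gmul a) (fun _ _ => gmulDr _ _ _) (gmulg0 _)). Qed.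

Lemma gmulEl a b : gmul a b = \sum_(S <- msupp a) gmul << a@_S *g S >> b.
Proof. by rewrite {1}(monalgE a) gmul_suml. Qed.

Lemma gmulEr a b : gmul a b = \sum_(S <- msupp b) gmul a << b@_S *g S >>.
Proof. by rewrite {1}(monalgE b) gmul_sumr. Qed.

Lemma gmulA : associative gmul.
Proof.
move=> a b c; rewrite gmulEl (gmulEl a b) [RHS]gmul_suml.
apply: eq_bigr => S _; rewrite (gmulEl b c) (gmulEr _ b) gmul_sumr [RHS]gmul_suml.
apply: eq_bigr => T _; rewrite (gmulEr _ c) gmul_sumr [RHS]gmulEr.
apply: eq_bigr => U _; rewrite !gmulUU fsetUA; congr << _ *g _ >>.
rewrite -!mulrA; congr (_ * (_ * _)).
by rewrite wedge_signA mulrCA.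
Qed.

Lemma gmul1g : left_id gone gmul.
Proof.
move=> a; rewrite [in LHS](monalgE a) gmul_sumr [RHS]monalgE.
by apply: eq_bigr => S _; rewrite gmulUU wedge_sign0l mulr1 mul1r fset0U.
Qed.

Lemma gmulg1 : right_id gone gmul.
Proof.
move=> a; rewrite [in LHS](monalgE a) gmul_suml [RHS]monalgE.
by apply: eq_bigr => S _; rewrite gmulUU wedge_sign0r !mulr1 fsetU0.
Qed.

Lemma gone_neq0 : gone != 0.
Proof.
by apply/eqP/malgP=> /(_ fset0) /eqP; rewrite mcoeffUU mcoeff0 oner_eq0.
Qed.

HB.instance Definition _ := GRing.Zmodule_isNzRing.Build A
  gmulA gmul1g gmulg1 gmulDl gmulDr gone_neq0.

Lemma gscaleU x y S : x *: << y *g S >> = << x * y *g S >> :> A.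
Proof. by apply/malgP => T; rewrite mcoeffZ !mcoeffU mulrnAr. Qed.

Lemma gscaleAl x a b : x *: (a * b) = (x *: a) * b.
Proof.
rewrite {2}/GRing.mul /= (gmulw (msuppZ_le x a) (fsubset_refl _)).
rewrite {1}/GRing.mul /= /gmul scaler_sumr; apply: eq_bigr => S _.
rewrite scaler_sumr; apply: eq_bigr => T _.
by rewrite mcoeffZ gscaleU !mulrA.
Qed.

HB.instance Definition _ := GRing.Lmodule_isLalgebra.Build F A gscaleAl.

Lemma gscaleAr x a b : x *: (a * b) = a * (x *: b).
Proof.
rewrite {2}/GRing.mul /= (gmulw (fsubset_refl _) (msuppZ_le x b)).
rewrite {1}/GRing.mul /= /gmul scaler_sumr; apply: eq_bigr => S _.
rewrite scaler_sumr; apply: eq_bigr => T _.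
by rewrite mcoeffZ gscaleU !mulrA [x * _]mulrC.
Qed.

HB.instance Definition _ := GRing.Lalgebra_isAlgebra.Build F A gscaleAr.


Definition gparity a : A := \sum_(S <- msupp a) << (-1) ^+ #|` S| * a@_S *g S >>.

Lemma mcoeff_gparity a S : (gparity a)@_S = (-1) ^+ #|` S| * a@_S.
Proof.
rewrite /gparity raddf_sum /=; case: (msuppP a S) => [aS|naS].
  rewrite (big_fsetD1 S) //= mcoeffUU big1_fset ?addr0 // => T.
  by rewrite in_fsetD1 mcoeffU; case: eqP.
rewrite mulr0 big1_fset // => T aT _; rewrite mcoeffU; case: eqP aT => // ->.
by rewrite (negbTE naS).
Qed.

Lemma gparity_is_additive : additive gparity.
Proof.
move=> a b; apply/malgP => S; rewrite mcoeff_gparity.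
rewrite [RHS](mcoeffB S (gparity a) (gparity b)) !mcoeff_gparity -mulrBr.
by rewrite (mcoeffB S a b).
Qed.

HB.instance Definition _ := GRing.isZmodMorphism.Build A A gparity gparity_is_additive.

Lemma gparityU x S : gparity << x *g S >> = << (-1) ^+ #|` S| * x *g S >>.
Proof.
apply/malgP => T; rewrite mcoeff_gparity !mcoeffU.
by case: eqP => [->|_]; rewrite ?mulr1n ?mulr0n ?mulr0.
Qed.

Lemma gparity_is_multiplicative : monoid_morphism gparity.
Proof.
split; first by rewrite gparityU cardfs0 mulr1.
move=> a b; rewrite /GRing.mul /= {1}/gmul raddf_sum /=.
have le c : (msupp (gparity c) `<=` msupp c)%fset.
  apply/fsubsetP => S; rewrite -!mcoeff_neq0 mcoeff_gparity.
  by apply: contraNneq => ->; rewrite mulr0.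
rewrite (gmulw (le a) (le b)); apply: eq_bigr => S _.
rewrite raddf_sum; apply: eq_bigr => T _ /=.
rewrite gparityU !mcoeff_gparity; congr << _ *g _ >>.
rewrite /wedge_sign; case: (boolP [disjoint _ & _]%fset) => d; last by rewrite !mulr0.
have -> : #|` S `|` T|%fset = (#|` S| + #|` T|)%N.
  by rewrite cardfsU (disjoint_fsetI0 d) cardfs0 subn0.
by rewrite exprD -!mulrA; congr (_ * _); rewrite [RHS]mulrCA.
Qed.

HB.instance Definition _ :=
  GRing.isMonoidMorphism.Build A A gparity gparity_is_multiplicative.

(* homogeneous of sign i for the Z_2-grading *)
Definition ghom (i : bool) a : bool :=
  all (fun S : K => odd #|` S| == i) (msupp a).

Definition body a : F := a@_fset0.

(* Inverses exist e.g. for even elements of nonzero body; [unitRingType] is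
   only used to write them as a^-1. *)
Definition gunit : pred A := fun a => `[< exists b, b * a = 1 /\ a * b = 1 >].
Definition ginv a : A := xget a [set b | b * a = 1 /\ a * b = 1].

Lemma ginvP a : gunit a -> ginv a * a = 1 /\ a * ginv a = 1.
Proof.
move=> /asboolP[b ab].
by apply: (@xgetPex _ a [set b | b * a = 1 /\ a * b = 1]); exists b.
Qed.

Lemma gmulVr : {in gunit, left_inverse 1 ginv *%R}.
Proof. by move=> a /ginvP[]. Qed.

Lemma gdivrr : {in gunit, right_inverse 1 ginv *%R}.
Proof. by move=> a /ginvP[]. Qed.

Lemma gunitP a b : b * a = 1 /\ a * b = 1 -> gunit a.
Proof. by move=> ab; apply/asboolP; exists b. Qed.

Lemma ginv_out : {in [predC gunit], ginv =1 id}.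
Proof.
move=> a /negP na; apply: xgetPN => b ab; apply: na; apply/asboolP.
by exists b.
Qed.

HB.instance Definition _ :=
  GRing.NzRing_hasMulInverse.Build A gmulVr gdivrr gunitP ginv_out.

End GrassmannRing.

(* R[phi] for an odd variable phi: the pair (a0, a1) is a0 + phi a1, with
   phi^2 = 0 and a phi = phi s(a), where s is the parity automorphism of R. *)
Definition oddext (R : nzRingType) (s : {rmorphism R -> R}) : Type := (R * R)%type.

(* M[phi], as a left R[phi]-module *)
Definition oddmod (R : nzRingType) (s : {rmorphism R -> R}) (M : lmodType R) : Type :=
  (M * M)%type.

Section OddExtension.
Context (R : nzRingType) (s : {rmorphism R -> R}).
Local Notation Rs := (oddext s).

HB.instance Definition _ := GRing.Zmodule.copy Rs (R * R)%type.

Implicit Types (a b c : Rs).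

Definition oddmul a b : Rs := (a.1 * b.1, a.2 * b.1 + s a.1 * b.2).
Definition oddone : Rs := (1, 0).

Lemma oddmulA : associative oddmul.
Proof.
case=> [a0 a1] [b0 b1] [c0 c1]; rewrite /oddmul /= mulrA; congr pair.
by rewrite rmorphM mulrDl mulrDr !mulrA addrA.
Qed.

Lemma oddmul1l : left_id oddone oddmul.
Proof. by case=> [a0 a1]; rewrite /oddmul /= !mul1r mul0r add0r rmorph1 mul1r. Qed.

Lemma oddmul1r : right_id oddone oddmul.
Proof. by case=> [a0 a1]; rewrite /oddmul /= !mulr1 mulr0 addr0. Qed.

Lemma oddmulDl : left_distributive oddmul +%R.
Proof.
case=> [a0 a1] [b0 b1] [c0 c1]; congr pair; rewrite /= ?mulrDl //.
by rewrite rmorphD mulrDl addrACA.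
Qed.

Lemma oddmulDr : right_distributive oddmul +%R.
Proof.
case=> [a0 a1] [b0 b1] [c0 c1]; congr pair; rewrite /= ?mulrDr //.
by rewrite addrACA.
Qed.

Lemma oddone_neq0 : oddone != 0.
Proof. by apply/eqP => -[/eqP]; rewrite oner_eq0. Qed.

HB.instance Definition _ := GRing.Zmodule_isNzRing.Build Rs
  oddmulA oddmul1l oddmul1r oddmulDl oddmulDr oddone_neq0.

Definition odd_parity a : Rs := (s a.1, - s a.2).

Lemma odd_parity_is_additive : additive odd_parity.
Proof.
by case=> [a0 a1] [b0 b1]; congr pair; rewrite /= rmorphB // opprB opprK addrC.
Qed.

HB.instance Definition _ :=
  GRing.isZmodMorphism.Build Rs Rs odd_parity odd_parity_is_additive.

Lemma odd_parity_is_multiplicative : monoid_morphism odd_parity.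
Proof.
split; first by rewrite /odd_parity /= rmorph1 rmorph0 oppr0.
case=> [a0 a1] [b0 b1]; congr pair; rewrite /= ?rmorphM //.
by rewrite rmorphD !rmorphM /= opprD mulNr mulrN.
Qed.

HB.instance Definition _ :=
  GRing.isMonoidMorphism.Build Rs Rs odd_parity odd_parity_is_multiplicative.

Section Module.
Context (M : lmodType R).
Local Notation Ms := (oddmod s M).

HB.instance Definition _ := GRing.Zmodule.copy Ms (M * M)%type.

Definition oddscale (a : Rs) (v : Ms) : Ms :=
  (a.1 *: v.1, a.2 *: v.1 + s a.1 *: v.2).

Lemma oddscaleA a b (v : Ms) : oddscale a (oddscale b v) = oddscale (a * b) v.
Proof.
case: a b v => [a0 a1] [b0 b1] [v0 v1]; congr pair; rewrite /= ?scalerA //.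
by rewrite rmorphM scalerDr scalerDl !scalerA addrA.
Qed.

Lemma oddscale1 : left_id 1 oddscale.
Proof. by case=> [v0 v1]; rewrite /oddscale /= !rmorph1 !scale1r scale0r add0r. Qed.

Lemma oddscaleDr : right_distributive oddscale +%R.
Proof.
case=> [a0 a1] [v0 v1] [w0 w1]; congr pair; rewrite /= ?scalerDr //.
by rewrite addrACA.
Qed.

Lemma oddscaleDl (v : Ms) : {morph oddscale^~ v : a b / a + b}.
Proof.
case: v => [v0 v1] [a0 a1] [b0 b1]; congr pair; rewrite /= ?scalerDl //.
by rewrite rmorphD scalerDl addrACA.
Qed.

HB.instance Definition _ := GRing.Zmodule_isLmodule.Build Rs Ms
  oddscaleA oddscale1 oddscaleDr oddscaleDl.

End Module.
End OddExtension.

Section OddVariables.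
Context (R : nzRingType) (s : {rmorphism R -> R}).

(* R[phi1, phi2]; the pair of pairs ((c00, c01), (c10, c11)) is
   c00 + phi2 c01 + phi1 c10 + phi1 phi2 c11. *)
Definition oddext2 : nzRingType := oddext (@odd_parity R s).

Definition oddmod2 (M : lmodType R) : lmodType oddext2 :=
  oddmod (@odd_parity R s) (oddmod s M).

Definition mk_phi (T : Type) (c00 c01 c10 c11 : T) : (T * T) * (T * T) :=
  ((c00, c01), (c10, c11)).

Definition coef_phi (T : Type) (a b : bool) (x : (T * T) * (T * T)) : T :=
  let y := if a then x.2 else x.1 in if b then y.2 else y.1.

Definition const_phi (a : R) : oddext2 := mk_phi a 0 0 0.
Definition phi1 : oddext2 := mk_phi 0 0 1 0.
Definition phi2 : oddext2 := mk_phi 0 1 0 0.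

Definition const_oddmod (M : lmodType R) (v : M) : oddmod2 M := mk_phi v 0 0 0.

Lemma mk_phiM (a b c d x y z t : R) :
  (mk_phi a b c d : oddext2) * (mk_phi x y z t : oddext2) =
  mk_phi (a * x) (b * x + s a * y) (c * x + s a * z)
    (d * x + s c * y + (- s b * z + s (s a) * t)) :> oddext2.
Proof. by []. Qed.

Let simp := (rmorph0, rmorph1, oppr0, mulr0, mul0r, mulr1, mul1r, add0r, addr0).

Lemma phi1_sq : phi1 * phi1 = 0.
Proof. by rewrite [LHS]mk_phiM !simp. Qed.

Lemma phi2_sq : phi2 * phi2 = 0.
Proof. by rewrite [LHS]mk_phiM !simp. Qed.

Lemma phi1_phi2 : phi1 * phi2 = mk_phi 0 0 0 1.
Proof. by rewrite [LHS]mk_phiM !simp. Qed.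

Lemma phi2_phi1 : phi2 * phi1 = - (phi1 * phi2).
Proof.
rewrite phi1_phi2 [LHS]mk_phiM !simp.
by congr (_, _); congr (_, _); rewrite oppr0.
Qed.

Lemma const_phi1 (a : R) : const_phi a * phi1 = phi1 * const_phi (s a).
Proof. by rewrite [LHS]mk_phiM [RHS]mk_phiM !simp. Qed.

Lemma const_phi2 (a : R) : const_phi a * phi2 = phi2 * const_phi (s a).
Proof. by rewrite [LHS]mk_phiM [RHS]mk_phiM !simp. Qed.

End OddVariables.

Arguments phi1 {R s}.
Arguments phi2 {R s}.
Arguments const_phi {R s}.
Arguments const_oddmod {R} s {M}.

Definition grassmann_phi (F : fieldType) (L : option nat) : nzRingType :=
  oddext2 (@gparity F L).

Definition scalar_phi (F : fieldType) (L : option nat) (x : F) : grassmann_phi F L :=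
  const_phi x%:A.

Definition oddpoly (F : fieldType) (L : option nat) (V : lmodType (grassmann F L)) :
  lmodType (grassmann_phi F L) := oddmod2 (@gparity F L) V.

Definition const_oddpoly (F : fieldType) (L : option nat)
  (V : lmodType (grassmann F L)) (v : V) : oddpoly V := const_oddmod _ v.

Section FormalSeries.
Context (E : zmodType) (S : nzRingType) (M : lmodType S).

(* Product of formal series; the sum is meant for products whose coefficients
   are finite sums (otherwise [\sum_(_ \in _)] is 0 by convention). *)
Definition series_mul (f : E -> S) (g : E -> M) (e : E) : M :=
  \sum_(d \in setT) (f d *: g (e - d)).

End FormalSeries.

Section RationalSuperfunctions.
Context (F : fieldType) (L : option nat).
Local Notation A := (grassmann F L).
Local Notation B := (grassmann_phi F L).

(* A[x, y][phi1, phi2], the outer polynomial variable being x. *)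
Definition superpoly : nzRingType := {poly {poly B}}.

Definition const_poly (b : B) : superpoly := b%:P%:P.
Definition var_x : superpoly := 'X.
Definition var_y : superpoly := 'X%:P.

(* (a, b, c) stands for the element a x + b y + c phi1 phi2 of S'. *)
Definition is_superlinear (d : A * A * A) : bool :=
  let: (a, b, c) := d in
  [&& ghom false a, ghom false b, ghom false c & (body a != 0) || (body b != 0)].

Definition superlinear : Type := {d : A * A * A | is_superlinear d}.

Definition superlinear_poly (d : superlinear) : superpoly :=
  let: (a, b, c) := val d in
  const_poly (const_phi a) * var_x + const_poly (const_phi b) * var_y
  + const_poly (const_phi c * phi1 * phi2).

(* The elements of A[x, phi1, y, phi2]_{S'} are represented by fractions
   n / (d_1 ... d_k) with d_i in S'; their equality is [sfrac_eq]. The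
   denominators are even, hence central. *)
Definition sfrac : Type := (superpoly * seq superlinear)%type.

Definition den (ds : seq superlinear) : superpoly :=
  \prod_(d <- ds) superlinear_poly d.

Definition sfrac_eq (f g : sfrac) : Prop :=
  exists es : seq superlinear,
    (f.1 * den g.2 - g.1 * den f.2) * den es = 0.

Definition sfrac_sign (s : bool) (f : sfrac) : sfrac := ((-1) ^+ s * f.1, f.2).

Definition pos_part (r : int) : nat := if r is Posz n then n else 0%N.

(* g / (d_1 ^ r_1 ... d_k ^ r_k), with integer exponents r_i *)
Definition sfrac_over (g : superpoly) (drs : seq (superlinear * int)) : sfrac :=
  (g * \prod_(dr <- drs) superlinear_poly dr.1 ^+ pos_part (- dr.2),
   flatten [seq nseq (pos_part dr.2) dr.1 | dr <- drs]).

Lemma ghom1 : ghom false (1 : A).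
Proof.
by rewrite /ghom msuppU oner_eq0; apply/allP => S /fset1P ->; rewrite cardfs0.
Qed.

Lemma ghom0 i : ghom i (0 : A).
Proof. by rewrite /ghom msupp0. Qed.

Lemma ghomB i (a b : A) : ghom i a -> ghom i b -> ghom i (a - b).
Proof.
move=> /allP ha /allP hb; apply/allP => S /(fsubsetP (msuppB_le _ _)).
by rewrite in_fsetU => /orP[/ha|/hb].
Qed.

Lemma ghomN i (a : A) : ghom i a -> ghom i (- a).
Proof. by rewrite -sub0r; apply: ghomB; exact: ghom0. Qed.

Lemma bodyB (a b : A) : body (a - b) = body a - body b.
Proof. exact: mcoeffB. Qed.

Lemma body1 : body (1 : A) = 1.
Proof. exact: mcoeffUU. Qed.

Fact lin_x_subproof : is_superlinear (1, 0, 0).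
Proof. by rewrite /is_superlinear ghom1 !ghom0 body1 oner_eq0. Qed.
Definition lin_x : superlinear := exist is_superlinear _ lin_x_subproof.

Fact lin_y_subproof : is_superlinear (0, 1, 0).
Proof. by rewrite /is_superlinear ghom1 !ghom0 body1 oner_eq0 orbT. Qed.
Definition lin_y : superlinear := exist is_superlinear _ lin_y_subproof.

(* x - y - phi1 phi2 *)
Fact lin_sub_subproof : is_superlinear (1, -1, -1).
Proof. by rewrite /is_superlinear ghomN ghom1 // body1 oner_eq0. Qed.
Definition lin_sub : superlinear := exist is_superlinear _ lin_sub_subproof.

(* x + y - phi1 phi2 *)
Fact lin_add_subproof : is_superlinear (1, 1, -1).
Proof. by rewrite /is_superlinear ghomN ghom1 // body1 oner_eq0. Qed.
Definition lin_add : superlinear := exist is_superlinear _ lin_add_subproof.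

(* Coefficient of x^p y^q in the expansion of 1 / (a x + b y) with finitely
   many negative powers of y. If a has zero body, it is nilpotent and the
   expansion is a finite sum. *)
Definition geom (a b : A) (p q : int) : A :=
  if body a != 0 then
    if q is Posz n then
      if p == - 1 - q then (- b) ^+ n * a^-1 ^+ n.+1 else 0
    else 0
  else
    if p is Posz n then
      if q == - 1 - p then (- a) ^+ n * b^-1 ^+ n.+1 else 0
    else 0.

Inductive direction := finite_neg_y | finite_neg_x.

Definition inv_linear (dir : direction) (a b : A) (e : int * int) : A :=
  match dir with
  | finite_neg_y => geom a b e.1 e.2
  | finite_neg_x => geom b a e.2 e.1
  end.

(* 1 / (l + c phi1 phi2) = 1 / l - c phi1 phi2 / l^2 with l = a x + b y *)
Definition inv_superlinear (dir : direction) (d : superlinear) (e : int * int) : B :=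
  let: (a, b, c) := val d in
  let l1 := inv_linear dir a b in
  let l2 := series_mul l1 (l1 : int * int -> A^o) in
  const_phi (l1 e) - const_phi c * phi1 * phi2 * const_phi (l2 e).

Definition superpoly_series (g : superpoly) (e : int * int) : B :=
  if e is (Posz m, Posz n) then g`_m`_n else 0.

(* [iota finite_neg_y] is iota_{12} if (x, y) = (x_1, x_2);
   [iota finite_neg_x] is iota_{21} if (x, y) = (x_1, x_2)
   and iota_{20} if (x, y) = (x_0, x_2). *)
Definition iota_exp (dir : direction) (f : sfrac) : int * int -> B :=
  foldr (fun d (s : int * int -> B^o) => series_mul (inv_superlinear dir d) s)
    (superpoly_series f.1) f.2.

(* The substitution phi1 |-> phi1 - phi2; it fixes phi1 phi2, hence the
   denominators. *)
Definition shift_phi (b : B) : B :=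
  const_phi (coef_phi false false b)
  + (phi1 - phi2) * const_phi (coef_phi true false b)
  + phi2 * const_phi (coef_phi false true b)
  + (phi1 - phi2) * phi2 * const_phi (coef_phi true true b).

Definition superpoly_shift (g : superpoly) : superpoly :=
  map_poly (map_poly shift_phi) g.

Definition sfrac_shift (h : sfrac) : sfrac := (superpoly_shift h.1, h.2).

(* The substitution x |-> x - y - phi1 phi2 *)
Definition subst_superlinear (d : A * A * A) : A * A * A :=
  let: (a, b, c) := d in (a, b - a, c - a).

Fact subst_superlinear_subproof (d : superlinear) :
  is_superlinear (subst_superlinear (val d)).
Proof.
case: d => [[[a b] c] /= /and4P[ha hb hc hab]].
apply/and4P; split; rewrite ?ghomB //.
by rewrite bodyB; case: eqP hab => //= ->; rewrite subr0.
Qed.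

Definition sfrac_subst (h : sfrac) : sfrac :=
  (h.1 \Po (var_x - var_y - const_poly (phi1 * phi2)),
   [seq exist is_superlinear _ (subst_superlinear_subproof d) | d <- h.2]).

End RationalSuperfunctions.

Arguments lin_x {F L}.
Arguments lin_y {F L}.
Arguments lin_sub {F L}.
Arguments lin_add {F L}.

Section VertexOperatorSuperalgebras.
Context (R : realType) (L : option nat).
Local Notation C := R[i].
Local Notation A := (grassmann C L).
Local Notation B := (grassmann_phi C L).
Context (V : lmodType A).
Local Notation Vphi := (oddpoly V).

(* Half-integers are doubled: [weight_comp k] is the projection of V onto
   V_(k/2) and [mode v k] is the operator v_{k/2}. *)
Record vosa_data := VosaData {
  weight_comp : int -> V -> V;
  sign_comp : bool -> V -> V;
  mode : V -> int -> V -> V;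
  vacuum : V;
  tau : V
}.

Definition scaleC (x : C) (v : V) : V := x%:A *: v.

(* p is the family of projections of a direct sum decomposition of V *)
Record direct_sum (I : choiceType) (p : I -> V -> V) : Prop := {
  direct_sumD : forall i v w, p i (v + w) = p i v + p i w;
  direct_sumK : forall i j v, p i (p j v) = if i == j then p j v else 0;
  direct_sum_finite : forall v, finite_set [set i | p i v <> 0];
  direct_sumE : forall v, \sum_(i \in setT) p i v = v
}.

Section VosaStructure.
Variable D : vosa_data.
Implicit Types (u v w : V) (s t : bool) (k : int).

Definition has_weight k v : Prop := weight_comp D k v = v.
Definition has_sign s v : Prop := sign_comp D s v = v.

(* V_(k/2) is finite dimensional over C if A is. If A has infinitely many
   generators, it is itself infinite dimensional over C, and dim V_(k/2) is the
   rank of V_(k/2) as a free A-module. *)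
Definition finite_dim k : Prop :=
  exists n (b : 'I_n -> V), (forall i, has_weight k (b i)) /\
    if L is Some _ then
      forall v, has_weight k v ->
        exists c : 'I_n -> C, v = \sum_i scaleC (c i) (b i)
    else
      forall v, has_weight k v ->
        exists! c : {ffun 'I_n -> A}, v = \sum_i c i *: b i.

Record graded_module : Prop := {
  weight_decomposition : direct_sum (weight_comp D);
  sign_decomposition : direct_sum (sign_comp D);
  weight_sign_comp : forall k s v,
    weight_comp D k (sign_comp D s v) = sign_comp D s (weight_comp D k v);
  weight_compZ : forall k (a : A) v, weight_comp D k (a *: v) = a *: weight_comp D k v;
  sign_compZ : forall i s (a : A) v, ghom i a -> has_sign s v -> has_sign (i (+) s) (a *: v);
  weight_finite_dim : forall k, finite_dim k;
  positive_energy : exists N : int, forall k v, k < N -> has_weight k v -> v = 0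
}.

Definition mode_odd k : bool := odd `|k|%N.

(* A-linearity of V (x) V -> V[[x, 1/x]][phi], and v_n in (End V)^(eta v),
   v_{n - 1/2} in (End V)^(eta v + 1); the signs come from moving a in A past
   phi and past operators. *)
Record mode_linear : Prop := {
  modeDl : forall u v k w, mode D (u + v) k w = mode D u k w + mode D v k w;
  modeDr : forall u k v w, mode D u k (v + w) = mode D u k v + mode D u k w;
  modeZl : forall i (a : A) v k w, ghom i a ->
    mode D (a *: v) k w = (-1) ^+ (i && mode_odd k) *: (a *: mode D v k w);
  modeZr : forall i s (a : A) v k w, ghom i a -> has_sign s v ->
    mode D v k (a *: w) = (-1) ^+ (i && (s (+) mode_odd k)) *: (a *: mode D v k w);
  mode_sign : forall s t v k w, has_sign s v -> has_sign t w ->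
    has_sign (s (+) t (+) mode_odd k) (mode D v k w)
}.

(* Coefficient of phi^a x^i in Y(v, (x, phi)), that is, v_{- i - 1 - a/2} *)
Definition Ycoef v (a : bool) (i : int) : V -> V :=
  mode D v (- ((i + 1) * 2) - Posz a).

Definition L_ (n : int) (v : V) : V := scaleC 2^-1 (mode D (tau D) (n * 2 + 1) v).
(* G(n + 1/2) *)
Definition G_ (n : int) (v : V) : V := mode D (tau D) ((n + 1) * 2) v.

Definition supercomm s t (f g : V -> V) v : V :=
  f (g v) - (-1) ^+ (s && t) *: g (f v).

Definition neveu_schwarz (rank : C) : Prop :=
  forall (m n : int) v,
  [/\ supercomm false false (L_ m) (L_ n) v =
        scaleC (m - n)%:~R (L_ (m + n) v)
        + scaleC ((m ^+ 3 - m)%:~R / 12%:R * (m + n == 0)%:R * rank) v,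
      supercomm true false (G_ m) (L_ n) v =
        scaleC (m%:~R - (n - 1)%:~R / 2) (G_ (m + n) v) &
      supercomm true true (G_ m) (G_ (n - 1)) v =
        scaleC 2 (L_ (m + n) v)
        + scaleC ((m ^+ 2 + m)%:~R / 3%:R * (m + n == 0)%:R * rank) v].

(* (d/dphi + phi d/dx) on series in phi and x *)
Definition odd_derivative (f : bool -> int -> V) (a : bool) (i : int) : V :=
  if a then scaleC (i + 1)%:~R (f false (i + 1)) else f true i.

Record vosa_except_jacobi : Prop := {
  vosa_graded : graded_module;
  vosa_linear : mode_linear;
  vacuum_weight : has_weight 0 (vacuum D);
  vacuum_sign : has_sign false (vacuum D);
  tau_weight : has_weight 3 (tau D);
  tau_sign : has_sign true (tau D);
  truncation : forall u v, exists N : int, forall k, N <= k -> mode D u k v = 0;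
  vacuum_axiom : forall a i v,
    Ycoef (vacuum D) a i v = if ~~ a && (i == 0) then v else 0;
  creation_regular : forall v a i, i < 0 -> Ycoef v a i (vacuum D) = 0;
  creation_limit : forall v, Ycoef v false 0 (vacuum D) = v;
  neveu_schwarz_relations : exists rank : C, neveu_schwarz rank;
  L0_weight : forall k v, has_weight k v -> L_ 0 v = scaleC (k%:~R / 2) v;
  G_derivative : forall v a i w,
    odd_derivative (fun a i => Ycoef v a i w) a i = Ycoef (G_ (-1) v) a i w
}.

(* Extension to V[phi1, phi2] of an operator of sign p *)
Definition extend_op (p : bool) (f : V -> V) (X : Vphi) : Vphi :=
  mk_phi (f (coef_phi false false X))
         ((-1) ^+ p *: f (coef_phi false true X))
         ((-1) ^+ p *: f (coef_phi true false X))
         (f (coef_phi true true X)).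

(* Coefficient of x^i in Y(u, (x, psi)) X, for an odd psi (phi1, phi2 or
   phi1 - phi2) and X in V[phi1, phi2] *)
Definition Yapply (psi : B) u (i : int) (X : Vphi) : Vphi :=
  \sum_(s : bool)
    (extend_op s (Ycoef (sign_comp D s u) false i) X
     + psi *: extend_op (~~ s) (Ycoef (sign_comp D s u) true i) X).

(* The same for Y(X, (x, psi)) w, with Y(-, (x, psi)) extended linearly to
   V[phi1, phi2] *)
Definition Yextend (psi : B) (X : Vphi) (i : int) w : Vphi :=
  let Yw v := Yapply psi v i (const_oddpoly w) in
  Yw (coef_phi false false X) + phi1 *: Yw (coef_phi true false X)
  + phi2 *: Yw (coef_phi false true X) + phi1 *: (phi2 *: Yw (coef_phi true true X)).

(* Y(u, (x1, phi1)) Y(v, (x2, phi2)) w; the exponents are those of x1, x2 *)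
Definition Yprod12 u v w (e : int * int) : Vphi :=
  Yapply phi1 u e.1 (Yapply phi2 v e.2 (const_oddpoly w)).

(* Y(v, (x2, phi2)) Y(u, (x1, phi1)) w; the exponents are those of x1, x2 *)
Definition Yprod21 u v w (e : int * int) : Vphi :=
  Yapply phi2 v e.2 (Yapply phi1 u e.1 (const_oddpoly w)).

(* Y(Y(u, (x0, phi1 - phi2)) v, (x2, phi2)) w; the exponents are those of
   x0, x2 *)
Definition Yiter u v w (e : int * int) : Vphi :=
  Yextend phi2 (Yapply (phi1 - phi2) u e.1 (const_oddpoly v)) e.2 w.

Definition binom_coef (n : int) (k : nat) : C :=
  (\prod_(j < k) (n%:~R - j%:R)) / k`!%:R.

(* Coefficient of y^i z^j in (y - z)^n *)
Definition pow_sub (n i j : int) : C :=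
  if j is Posz k then
    if i + j == n then (-1) ^+ k * binom_coef n k else 0
  else 0.

(* Coefficient of y^i z^j in (y - z + c phi1 phi2)^n *)
Definition super_pow_sub (c : C) (n i j : int) : B :=
  scalar_phi L (pow_sub n i j)
  + scalar_phi L (c * n%:~R * pow_sub (n - 1) i j) * phi1 * phi2.

(* x0^-1 delta((x1 - x2 - phi1 phi2) / x0); e = (exponents of x0, x1, x2) *)
Definition delta_prod12 (e : int * int * int) : B :=
  let: (e0, e1, e2) := e in super_pow_sub (-1) (- e0 - 1) e1 e2.

(* x0^-1 delta((x2 - x1 + phi1 phi2) / - x0) *)
Definition delta_prod21 (e : int * int * int) : B :=
  let: (e0, e1, e2) := e in
  scalar_phi L ((-1) ^ (- e0 - 1)) * super_pow_sub 1 (- e0 - 1) e2 e1.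

(* x2^-1 delta((x1 - x0 - phi1 phi2) / x2) *)
Definition delta_iter (e : int * int * int) : B :=
  let: (e0, e1, e2) := e in super_pow_sub (-1) (- e2 - 1) e1 e0.

Definition in_x1x2 (f : int * int -> Vphi) (e : int * int * int) : Vphi :=
  let: (e0, e1, e2) := e in if e0 == 0 then f (e1, e2) else 0.

Definition in_x0x2 (f : int * int -> Vphi) (e : int * int * int) : Vphi :=
  let: (e0, e1, e2) := e in if e1 == 0 then f (e0, e2) else 0.

Definition jacobi_identity : Prop :=
  forall s t u v w (e : int * int * int), has_sign s u -> has_sign t v ->
  series_mul delta_prod12 (in_x1x2 (Yprod12 u v w)) e
  - (-1) ^+ (s && t) *: series_mul delta_prod21 (in_x1x2 (Yprod21 u v w)) e
  = series_mul delta_iter (in_x0x2 (Yiter u v w)) e.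

Definition is_vosa : Prop := vosa_except_jacobi /\ jacobi_identity.

(* Elements of V' = coprod_n Hom_A(V_(n), A), as linear forms on V *)
Definition in_graded_dual (v' : {linear V -> A^o}) : Prop :=
  finite_set [set k | exists v, has_weight k v /\ v' v <> 0].

Definition pairing (v' : V -> A) (f : int * int -> Vphi) (e : int * int) : B :=
  mk_phi (v' (coef_phi false false (f e))) (v' (coef_phi false true (f e)))
         (v' (coef_phi true false (f e))) (v' (coef_phi true true (f e))).

Definition finitely_many_negative (c : int * int -> int) (f : int * int -> B) : Prop :=
  exists N : int, forall e, c e < N -> f e = 0.

Definition finitely_many_positive (c : int * int -> int) (f : int * int -> B) : Prop :=
  exists N : int, forall e, N < c e -> f e = 0.

Definition rationality_products : Prop :=
  forall s t u v w (v' : {linear V -> A^o}),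
  has_sign s u -> has_sign t v -> in_graded_dual v' ->
  let S := pairing v' (Yprod12 u v w) in
  [/\ finitely_many_negative snd S,
      finitely_many_positive fst S &
      exists f : sfrac C L,
      [/\ S = iota_exp finite_neg_y f,
          exists (g : superpoly C L) (r1 r2 r3 : int),
            sfrac_eq f
              (sfrac_over g [:: (lin_x, r1); (lin_y, r2); (lin_sub, r3)]) &
          forall f', S = iota_exp finite_neg_y f' -> sfrac_eq f' f]].

Definition rationality_iterates : Prop :=
  forall u v w (v' : {linear V -> A^o}), in_graded_dual v' ->
  let S := pairing v' (Yiter u v w) in
  [/\ finitely_many_negative fst S,
      finitely_many_positive snd S &
      exists h : sfrac C L,
      [/\ S = iota_exp finite_neg_x (sfrac_shift h),
          exists (k : superpoly C L) (r1 r2 r3 : int),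
            sfrac_eq (sfrac_shift h)
              (sfrac_over (superpoly_shift k)
                 [:: (lin_x, r1); (lin_y, r2); (lin_add, r3)]) &
          forall h', S = iota_exp finite_neg_x (sfrac_shift h') -> sfrac_eq h' h]].

(* By uniqueness (the iota maps are injective), f and g are the inverse images
   of the two series. *)
Definition supercommutativity : Prop :=
  forall s t u v w (v' : {linear V -> A^o}),
  has_sign s u -> has_sign t v -> in_graded_dual v' ->
  exists f g : sfrac C L,
  [/\ pairing v' (Yprod12 u v w) = iota_exp finite_neg_y f,
      pairing v' (Yprod21 u v w) = iota_exp finite_neg_x g &
      sfrac_eq f (sfrac_sign (s && t) g)].

Definition associativity : Prop :=
  forall u v w (v' : {linear V -> A^o}), in_graded_dual v' ->
  exists f h : sfrac C L,
  [/\ pairing v' (Yprod12 u v w) = iota_exp finite_neg_y f,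
      pairing v' (Yiter u v w) = iota_exp finite_neg_x h &
      sfrac_eq f (sfrac_subst h)].

End VosaStructure.
End VertexOperatorSuperalgebras.

(* Main.v *)
From HB Require Import structures.
Require Import Defs.
From mathcomp Require Import all_boot all_order all_algebra.
From mathcomp Require Import finmap monalg complex.
From mathcomp Require Import boolp classical_sets functions cardinality fsbigop reals.
From mathcomp Require Import zify ring.

Set Implicit Arguments.
Unset Strict Implicit.
Unset Printing Implicit Defensive.

(** The Jacobi identity is an identity between series with coefficients in V. As
    linear forms in the graded dual separate the points of V
    ([graded_dual_separates]), it holds if and only if it holds after pairing
    with every such form. Over finitely many generators this uses that the
    exterior algebra is a Frobenius algebra, so that C-linear forms lift to
    algebra-valued ones; over infinitely many the weight spaces are free.

    A paired series is compared with a fraction by clearing denominators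
    ([represents]) rather than by expanding inverses. Linear denominators are
    injective on series that are bounded in one direction ([den_injective]), so
    this is the same as being the iota expansion of the fraction, and it only
    depends on the class of the fraction.

    The three delta functions satisfy x0^-1 delta((x1 - x2 - phi1 phi2) / x0)
    - x0^-1 delta((x2 - x1 + phi1 phi2) / - x0)
    = x2^-1 delta((x1 - x0 - phi1 phi2) / x2); this is an identity between
    binomial coefficients, together with its derivative in x1
    ([super_delta_identity]). On their supports x0 = x1 - x2 - phi1 phi2, that is,
    x1 = x0 + x2 + phi1 phi2, so the identity remains true after multiplication by
    a polynomial g(x1, x2), if g(x0 + x2 + phi1 phi2, x2) is used in the last term
    ([delta_identity_poly]).

    Suppose the four properties. Both products represent the same fraction
    g / (x1^a x2^b (x1 - x2 - phi1 phi2)^c), up to the sign, and the iterate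
    represents the fraction obtained by the substitution
    x1 = x0 + x2 + phi1 phi2. Multiplied by x1^a x2^b x0^c, the Jacobi identity
    becomes the identity above for g ([rational_jacobi3]).

    Conversely, assume the Jacobi identity. For tau and v it gives the commutator
    of 2 L(0) with the modes of v; as L(-1) = G(-1/2)^2 acts as d/dx, modes shift
    weights, and a form in the graded dual vanishes on all coefficients of high
    powers of the variable ([matrix_coefficients_upper]). Hence the paired series
    are bounded in one direction. The coefficients of large negative powers of x0
    in the Jacobi identity say that the two products agree up to sign after
    multiplication by a power of x1 - x2 - phi1 phi2; the result is bounded from
    all sides, hence a Laurent polynomial. So the products represent a common
    fraction, and comparison with the delta function identity shows that the
    iterate represents its image under the substitution, because the delta
    function of the iterate can be cancelled ([d20_injective],
    [jacobi3_rational]). All four properties follow. The denominator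
    x0 + x2 + phi1 phi2 of iterates is replaced by x0 + x2 - phi1 phi2 using
    (l + z) (l - 3 z) = (l - z)^2 for z = phi1 phi2 ([den20_trade]). *)

Import Order.TTheory GRing.Theory Num.Theory.
Local Open Scope ring_scope.


(** * Units, odd variables and even elements *)

Section Units.

Lemma nilp_unit (R : unitRingType) (s : R) n : s ^+ n = 0 -> 1 - s \is a GRing.unit.
Proof.
move=> hn; apply/unitrP; exists (\sum_(i < n) s ^+ i).
have h : (1 - s) * \sum_(i < n) s ^+ i = 1.
  rewrite (eq_bigr (fun i : 'I_n => 1 ^+ (n.-1 - i) * s ^+ i)) => [|i _]; last first.
    by rewrite expr1n mul1r.
  by rewrite -(subrXX_comm n (commr_sym (commr1 s))) hn expr1n subr0.
split=> //; rewrite -[RHS]h.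
apply: commr_sym; apply: commr_sum => i _; apply: commrX; apply: commr_sym.
apply: commrB; [exact: commr1 | exact: commr_refl].
Qed.

Lemma scale_unit (F : fieldType) (R : unitAlgType F) (x : F) (u : R) :
  x != 0 -> u \is a GRing.unit -> x *: u \is a GRing.unit.
Proof. by move=> x0 hu; rewrite scaler_unit ?unitfE. Qed.

End Units.

Section OddVariablesCentral.
Context (R : nzRingType) (s : {rmorphism R -> R}).

Let simp := (rmorph0, rmorph1, oppr0, mulr0, mul0r, mulr1, mul1r, add0r, addr0).

Lemma const_phi_comm (a : R) (b : oddext2 s) : s a = a -> (forall c, a * c = c * a) ->
  const_phi a * b = b * const_phi a.
Proof.
move=> sa ca; case: b => -[b00 b01] [b10 b11].
rewrite [LHS](mk_phiM s a 0 0 0 b00 b01 b10 b11) [RHS](mk_phiM s b00 b01 b10 b11 a 0 0 0).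
by rewrite !simp !sa -!ca.
Qed.

Lemma const_phiM (a b : R) : (const_phi a : oddext2 s) * const_phi b = const_phi (a * b).
Proof. by rewrite [LHS](mk_phiM s a 0 0 0 b 0 0 0) !simp. Qed.

Lemma const_phiD (a b : R) : (const_phi a : oddext2 s) + const_phi b = const_phi (a + b).
Proof. by congr pair; congr pair; rewrite /= addr0. Qed.

Lemma const_phiN (a : R) : - (const_phi a : oddext2 s) = const_phi (- a).
Proof. by congr pair; congr pair; rewrite /= oppr0. Qed.

Lemma const_phi_linear (a b u v : R) :
  (const_phi a : oddext2 s) * const_phi u + const_phi b * const_phi v =
  const_phi (a * u + b * v).
Proof. by rewrite !const_phiM const_phiD. Qed.

Lemma const_phiX (a : R) n : (const_phi a : oddext2 s) ^+ n = const_phi (a ^+ n).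
Proof. by elim: n => [|n IH]; rewrite ?expr0 // !exprS IH const_phiM. Qed.

Lemma phi12_mul (b : oddext2 s) : phi1 * phi2 * b = mk_phi 0 0 0 (coef_phi false false b).
Proof.
case: b => -[b00 b01] [b10 b11].
by rewrite phi1_phi2 [LHS](mk_phiM s 0 0 0 1 b00 b01 b10 b11) !simp.
Qed.

Lemma phi12_sq : (phi1 * phi2) * (phi1 * phi2) = 0 :> oddext2 s.
Proof. by rewrite phi12_mul phi1_phi2. Qed.

Lemma const_phi12 (a : R) : (const_phi a : oddext2 s) * phi1 * phi2 = mk_phi 0 0 0 (s (s a)).
Proof. by rewrite -mulrA phi1_phi2 [LHS](mk_phiM s a 0 0 0 0 0 0 1) !simp. Qed.

Lemma const_phi12_sq (a : R) :
  ((const_phi a : oddext2 s) * phi1 * phi2) * (const_phi a * phi1 * phi2) = 0.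
Proof. by rewrite const_phi12 [LHS](mk_phiM s 0 0 0 _ 0 0 0 _) !simp. Qed.

Lemma phi12_comm (b : oddext2 s) : (forall c, s (s c) = c) ->
  phi1 * phi2 * b = b * (phi1 * phi2).
Proof.
move=> ss; rewrite phi12_mul; case: b => -[b00 b01] [b10 b11].
by rewrite phi1_phi2 [RHS](mk_phiM s b00 b01 b10 b11 0 0 0 1) !simp ss.
Qed.

End OddVariablesCentral.

Section GrassmannFacts.
Context (F : fieldType) (L : option nat).
Local Notation I := (generator L).
Local Notation K := {fset I}.
Local Notation A := (grassmann F L).
Local Notation B := (grassmann_phi F L).
Implicit Types (S T U : K) (a b c : A).

Lemma gmulU (x y : F) S T :
  (<< x *g S >> : A) * << y *g T >> = << x * y * wedge_sign F S T *g (S `|` T)%fset >>.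
Proof. exact: gmulUU. Qed.

Lemma inversionsC S T : [disjoint S & T]%fset ->
  (inversions S T + inversions T S = #|` S| * #|` T|)%N.
Proof.
move=> dST; rewrite /inversions [X in (_ + X)%N]exchange_big -big_split /=.
under eq_big_seq => i iS.
  rewrite -big_split /=.
  under eq_big_seq => j jT.
    have -> : ((choice.pickle j < choice.pickle i) + (choice.pickle i < choice.pickle j))%N = 1%N.
      have : choice.pickle i != choice.pickle j :> nat.
        rewrite (inj_eq (pcan_inj choice.pickleK)); apply: contraTneq jT => <-.
        by move/fdisjointP: dST; apply.
      by case: ltngtP.
  over.
  rewrite big_const_seq count_predT iter_addn_0 mul1n.
over.
by rewrite big_const_seq count_predT iter_addn_0 mulnC.
Qed.

Lemma wedge_signC S T : ~~ odd #|` S| -> wedge_sign F S T = wedge_sign F T S.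
Proof.
move=> evS; rewrite /wedge_sign fdisjoint_sym; case: ifP => // dTS.
have := @inversionsC S T; rewrite fdisjoint_sym dTS => /(_ isT) h.
rewrite -signr_odd -[RHS]signr_odd; congr (_ ^+ _).
by move: (congr1 odd h); rewrite oddD oddM (negbTE evS) /=; do 2 case: odd.
Qed.

Lemma gmulU_comm (x y : F) S T : ~~ odd #|` S| ->
  (<< x *g S >> : A) * << y *g T >> = (<< y *g T >> : A) * << x *g S >>.
Proof.
move=> evS; rewrite (gmulU x y S T) (gmulU y x T S).
rewrite (wedge_signC T evS).
rewrite (fsetUC T S).
rewrite (mulrC x y).
reflexivity.
Qed.

(** Even elements commute with everything because moving a set past another one
    costs as many transpositions as the product of their sizes. *)
Lemma ghom_central a b : ghom false a -> a * b = b * a.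
Proof.
move=> /allP ha; rewrite [a]monalgE [b]monalgE.
rewrite mulr_suml mulr_sumr.
apply: eq_big_seq => S /ha /eqP evS; rewrite mulr_sumr mulr_suml.
apply: eq_bigr => T _.
apply: gmulU_comm.
by rewrite evS.
Qed.

Lemma gparity_even a : ghom false a -> gparity a = a.
Proof.
move=> /allP ha; apply/malgP => S; rewrite mcoeff_gparity.
case: (msuppP a S) => [/ha/eqP|]; last by rewrite mulr0.
by rewrite -signr_odd => ->; rewrite mul1r.
Qed.

Lemma mcoeff_gmul a b S : (a * b)@_S != 0 ->
  exists T U, [/\ T \in msupp a, U \in msupp b, [disjoint T & U]%fset & S = (T `|` U)%fset].
Proof.
apply: contra_neqP => /forallNP h; rewrite [a in LHS]monalgE mulr_suml raddf_sum big1_seq //.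
move=> T /andP[_ Ta]; rewrite [b]monalgE mulr_sumr raddf_sum big1_seq // => U /andP[_ Ub].
rewrite gmulU [LHS]mcoeffU; case: eqP => [eS|]; last by rewrite mulr0n.
case: (boolP [disjoint T & U]%fset) => d; last by rewrite /wedge_sign (negbTE d) mulr0 mul0rn.
by case: (h T); exists U; split.
Qed.

(** Only finitely many generators occur in an element, and every factor of zero
    body uses up at least one of them. *)
Lemma body0_nilpotent a : body a = 0 -> exists n, a ^+ n = 0.
Proof.
move=> ha; pose X := (\bigcup_(S <- msupp a) S)%fset.
have hX n S : (a ^+ n)@_S != 0 -> (S `<=` X)%fset /\ (n <= #|` S|)%N.
  elim: n S => [|n IH] S.
    have -> : (a ^+ 0)@_S = 1 *+ (fset0 == S) by exact: mcoeffU.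
    case: (fset0 =P S) => [<- _|_]; last by rewrite mulr0n eqxx.
    by rewrite fsub0set.
  rewrite exprS => /mcoeff_gmul[T [U [Ta Ub d ->]]].
  have [sU lU] := IH U (etrans (mcoeff_neq0 _ _) Ub).
  have sT : (T `<=` X)%fset by apply: (bigfcup_sup _ Ta).
  rewrite fsubUset sT sU; split=> //.
  have T0 : (0 < #|` T|)%N.
    rewrite cardfs_gt0; apply: contraTneq Ta => ->.
    by rewrite -mcoeff_eq0; apply/eqP.
  by rewrite cardfsU (disjoint_fsetI0 d) cardfs0 subn0; lia.
exists #|` X|.+1; apply/malgP => S; rewrite mcoeff0; apply/eqP; apply: contraT.
move=> /hX[/fsubset_leq_card sX]; lia.
Qed.

Lemma body_unit a : body a != 0 -> a \is a GRing.unit.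
Proof.
move=> a0; set x := body a.
have sE : body (1 - x^-1 *: a) = 0.
  rewrite /body (mcoeffB _ (1 : A)) (mcoeffZ x^-1 a) mcoeffUU.
  by rewrite mulVf // subrr.
have [n hn] := body0_nilpotent sE.
set s := 1 - _ in hn; have aE : a = x *: (1 - s).
  by rewrite /s opprB addrC subrK scalerA divff // scale1r.
by rewrite aE; apply: scale_unit; [exact: a0 | exact: nilp_unit hn].
Qed.

Lemma gparityK a : gparity (gparity a) = a.
Proof. by apply/malgP => S; rewrite !mcoeff_gparity mulrA -expr2 sqrr_sign mul1r. Qed.

Lemma central_const (a : A) (b : B) : ghom false a -> const_phi a * b = b * const_phi a.
Proof.
move=> ha; apply: const_phi_comm; first exact: gparity_even.
by move=> c; apply: ghom_central.
Qed.

Lemma central_phi12 (b : B) : phi1 * phi2 * b = b * (phi1 * phi2).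
Proof. by apply: phi12_comm => a; apply: gparityK. Qed.

End GrassmannFacts.

(** * Polynomials acting on series in one variable *)

(** Series in one variable, indexed by exponents; polynomials act on all of
    them, whatever their support, because only finitely many terms meet. *)
Definition ser (R : nzRingType) (M : lmodType R) : Type := int -> M.

Section SerModule.
Context (R : nzRingType) (M : lmodType R).
Local Notation S := (ser M).

HB.instance Definition _ := GRing.Zmodule.copy S (int -> M).

Implicit Types (p q : {poly R}) (s t : S).

Lemma serD s t n : (s + t) n = s n + t n. Proof. by []. Qed.

Definition ser_scale p s : S := fun n => \sum_(i < size p) p`_i *: s (n - i%:Z).

Lemma ser_scaleE m p s n : (size p <= m)%N ->
  ser_scale p s n = \sum_(i < m) p`_i *: s (n - i%:Z).
Proof.
move=> le_pm; rewrite /ser_scale (big_ord_widen m (fun i => p`_i *: s (n - i%:Z))) //.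
rewrite big_mkcond; apply: eq_bigr => i _; case: ltnP => // h.
by rewrite nth_default // scale0r.
Qed.

Lemma ser_scaleDl s : {morph ser_scale^~ s : p q / p + q}.
Proof.
move=> p q; apply/funext => n; rewrite serD.
have h := size_polyD p q; rewrite (ser_scaleE _ _ h).
rewrite (@ser_scaleE (maxn (size p) (size q)) p) ?leq_maxl //.
rewrite (@ser_scaleE (maxn (size p) (size q)) q) ?leq_maxr //.
by rewrite -big_split; apply: eq_bigr => i _; rewrite coefD scalerDl.
Qed.

Lemma ser_scaleDr : right_distributive ser_scale +%R.
Proof.
move=> p s t; apply/funext => n; rewrite serD /ser_scale -big_split.
by apply: eq_bigr => i _; rewrite serD scalerDr.
Qed.

Lemma ser_scaleC c s : ser_scale c%:P s = fun n => c *: s n.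
Proof.
apply/funext => n; rewrite (@ser_scaleE 1) ?size_polyC_leq1 //.
by rewrite big_ord1 coefC subr0.
Qed.

Lemma ser_scaleMX p s : ser_scale (p * 'X) s = ser_scale p (fun n => s (n - 1)).
Proof.
apply/funext => n; rewrite (@ser_scaleE (size p).+1); last first.
  by rewrite (leq_trans (size_polyMleq _ _)) // size_polyX addnC.
rewrite big_ord_recl coefMX /= scale0r add0r; apply: eq_bigr => i _.
by rewrite coefMX /=; congr (_ *: s _); rewrite /bump /=; lia.
Qed.

Lemma ser_scale0 s : ser_scale 0 s = 0.
Proof. by apply/funext => n; rewrite /ser_scale size_poly0 big_ord0. Qed.

Lemma ser_scaleCM c p s : ser_scale (c%:P * p) s = fun n => c *: ser_scale p s n.
Proof.
apply/funext => n; rewrite (@ser_scaleE (size p)); last by rewrite mul_polyC size_scale_leq.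
by rewrite scaler_sumr; apply: eq_bigr => i _; rewrite coefCM scalerA.
Qed.

Lemma ser_scaleA p q s : ser_scale p (ser_scale q s) = ser_scale (p * q) s.
Proof.
elim/poly_ind: p q s => [|p c IH] q s; first by rewrite mul0r !ser_scale0.
rewrite ser_scaleDl mulrDl ser_scaleDl ser_scaleC ser_scaleCM; congr (_ + _).
rewrite ser_scaleMX -mulrA -commr_polyX mulrA ser_scaleMX -IH; congr ser_scale.
by apply/funext => n; apply: eq_bigr => i _; congr (_ *: s _); ring.
Qed.

Lemma ser_scale1 : left_id 1 ser_scale.
Proof. by move=> s; rewrite ser_scaleC; apply/funext => n; rewrite scale1r. Qed.

HB.instance Definition _ := GRing.Zmodule_isLmodule.Build {poly R} S
  ser_scaleA ser_scale1 ser_scaleDr ser_scaleDl.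

Lemma serC c s n : (c%:P *: s) n = c *: s n.
Proof. by rewrite [LHS](congr1 (@^~ n) (ser_scaleC c s)). Qed.

Lemma serX s n : ('X *: s) n = s (n - 1).
Proof.
have := congr1 (@^~ n) (ser_scaleMX 1 s); rewrite mul1r => h.
by rewrite [LHS]h (ser_scale1 (fun n => s (n - 1))).
Qed.

End SerModule.

(** * Sums of finite support *)

Section FiniteSums.
Context (T : choiceType).

(** [\sum_(d \in setT)] is 0 by default on functions of infinite support, so that
    additivity needs finite supports. *)
Definition fsupp (M : zmodType) (f : T -> M) : Prop := finite_set [set d | f d <> 0].

Lemma fsuppS (M N : zmodType) (f : T -> M) (g : T -> N) :
  (forall d, f d = 0 -> g d = 0) -> fsupp f -> fsupp g.
Proof. by move=> fg; apply: sub_finite_set => d /= gd fd; apply: gd; apply: fg. Qed.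

Lemma fsum_seq (M : zmodType) (f : T -> M) (X : {fset T}) :
  (forall d, f d <> 0 -> d \in X) -> \sum_(d \in setT) f d = \sum_(d <- X) f d.
Proof.
move=> fX; apply: fsbigTE => d; case: (pselect (f d = 0)) => // /fX ->.
by [].
Qed.

Lemma fsupp_fset (M : zmodType) (f : T -> M) : fsupp f ->
  exists X : {fset T}, forall d, f d <> 0 -> d \in X.
Proof.
move=> ff; exists (fset_set [set d | f d <> 0]) => d fd.
by rewrite in_fset_set // mem_set.
Qed.

Lemma fsumD (M : zmodType) (f g : T -> M) : fsupp f -> fsupp g ->
  \sum_(d \in setT) (f d + g d) = \sum_(d \in setT) f d + \sum_(d \in setT) g d.
Proof.
move=> /fsupp_fset[X fX] /fsupp_fset[Y gY].
rewrite (@fsum_seq _ f (X `|` Y)%fset) => [|d /fX]; last by rewrite in_fsetE => ->.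
rewrite (@fsum_seq _ g (X `|` Y)%fset) => [|d /gY]; last by rewrite in_fsetE orbC => ->.
rewrite -big_split; apply: fsum_seq => d; case: (pselect (f d = 0)) => [->|/fX].
  by rewrite add0r in_fsetE orbC => /gY ->.
by rewrite in_fsetE => ->.
Qed.

Lemma fsum_additive (M N : zmodType) (phi : M -> N) (f : T -> M) :
  phi 0 = 0 -> (forall x y, phi (x + y) = phi x + phi y) -> fsupp f ->
  phi (\sum_(d \in setT) f d) = \sum_(d \in setT) phi (f d).
Proof.
move=> phi0 phiD /fsupp_fset[X fX]; rewrite (fsum_seq fX) (@fsum_seq _ _ X).
  by elim/big_rec2: _ => // d y x _ <-; rewrite phiD.
by move=> d h; apply: fX => fd; apply: h; rewrite fd.
Qed.

Lemma fsum_eq0 (M : zmodType) (f : T -> M) :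
  (forall d, f d = 0) -> \sum_(d \in setT) f d = 0.
Proof. by move=> f0; rewrite fsbig1. Qed.

Lemma fsum1 (M : zmodType) (f : T -> M) d0 :
  (forall d, d <> d0 -> f d = 0) -> \sum_(d \in setT) f d = f d0.
Proof.
move=> h; rewrite (@fsum_seq _ f [fset d0]%fset) ?big_seq_fset1 // => d.
by rewrite in_fset1; case: eqP => // /h.
Qed.

End FiniteSums.

Lemma fsumN (T : choiceType) (M : zmodType) (f : T -> M) :
  \sum_(d \in setT) - f d = - \sum_(d \in setT) f d.
Proof.
case: (pselect (fsupp f)) => ff; first by
  rewrite (fsum_additive (phi := -%R)) ?oppr0 // => x y; rewrite opprD.
rewrite !fsbig_dflt ?oppr0 // setTI.
  by move=> h; apply: ff; apply: sub_finite_set h => d /= fd.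
move=> h; apply: ff; apply: sub_finite_set h => d /= fd fd0; apply: fd.
by rewrite -[f d]opprK fd0 oppr0.
Qed.

Section Box.

Lemma finite_int_interval (a b : int) : finite_set [set i : int | a <= i <= b].
Proof.
have := @finite_image _ _ `I_(`|b - a|.+1)%N (fun n : nat => a + n%:Z) (finite_II _).
apply: sub_finite_set => i /= /andP[ai ib]; exists (`|i - a|)%N => /=; lia.
Qed.

Lemma finite_box (a b c d : int) (P : set (int * int)) :
  (forall e, P e -> a <= e.1 <= b /\ c <= e.2 <= d) -> finite_set P.
Proof.
move=> h; have := finite_setX (finite_int_interval a b) (finite_int_interval c d).
by apply: sub_finite_set => e /h[].
Qed.

End Box.

(** * Series bounded in one direction *)

Section Bounded.

(** An expansion with finitely many negative powers of one variable has finitely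
    many positive powers of the other one, because denominators are homogeneous
    up to nilpotents. Two series with this property in the same direction have a
    product, and linear denominators are injective on such series. *)
Definition outside (dir : direction) (N : int) (p q : int) : bool :=
  match dir with
  | finite_neg_y => (N < p) || (q < - N)
  | finite_neg_x => (p < - N) || (N < q)
  end.

Definition bounded (M : zmodType) (dir : direction) (f : int * int -> M) : Prop :=
  exists N : int, forall e, outside dir N e.1 e.2 -> f e = 0.

Lemma outsideW dir N N' p q : N <= N' -> outside dir N' p q -> outside dir N p q.
Proof. case: dir => /=; lia. Qed.

Lemma boundedS (M N : zmodType) dir (f : int * int -> M) (g : int * int -> N) :
  (forall e, f e = 0 -> g e = 0) -> bounded dir f -> bounded dir g.
Proof. by move=> fg [n fn]; exists n => e /fn /fg. Qed.

Lemma boundedU (M N K : zmodType) dir (f : int * int -> M) (g : int * int -> N)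
    (h : int * int -> K) :
  (forall e, f e = 0 -> g e = 0 -> h e = 0) ->
  bounded dir f -> bounded dir g -> bounded dir h.
Proof.
move=> fgh [n fn] [m gm]; exists (`|n| + `|m|)%:Z => e he.
by apply: fgh; [apply: fn | apply: gm]; apply: outsideW he; lia.
Qed.

Lemma bounded_shift (M : zmodType) dir (f : int * int -> M) k :
  bounded dir f -> bounded dir (fun e => f (e - k)).
Proof.
move=> [n fn]; exists (`|n| + `|k.1| + `|k.2|)%:Z => e he; apply: fn.
by move: he; case: dir => /=; lia.
Qed.

Context (S : nzRingType) (M : lmodType S).
Implicit Types (f : int * int -> S) (g : int * int -> M).

Lemma bounded_fsupp dir f g e : bounded dir f -> bounded dir g ->
  fsupp (fun d => f d *: g (e - d)).
Proof.
move=> [n fn] [m gm].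
pose N := (`|n| + `|m| + `|e.1| + `|e.2|)%:Z.
apply: (@finite_box (- N) N (- N) N) => d /= h.
have hf : ~~ outside dir n d.1 d.2.
  by apply/negP => o; apply: h; rewrite fn // scale0r.
have hg : ~~ outside dir m (e - d).1 (e - d).2.
  by apply/negP => o; apply: h; rewrite gm // scaler0.
by move: hf hg; rewrite /N; case: (dir) => /=; lia.
Qed.

Lemma bounded_series_mul dir f g : bounded dir f -> bounded dir g ->
  bounded dir (series_mul f g).
Proof.
move=> [n fn] [m gm]; exists (n + m) => e he; apply: fsum_eq0 => d.
have [o|no] := boolP (outside dir n d.1 d.2); first by rewrite fn // scale0r.
rewrite gm ?scaler0 //; move: he no; case: (dir) => /=; lia.
Qed.

Lemma series_mul_shift k f g e :
  series_mul f g (e - k) = series_mul (fun d => f (d - k)) g e.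
Proof.
rewrite /series_mul [RHS](reindex_fsbigT (fun d => d + k)).
  by apply: eq_fsbigr => d _; rewrite addrK opprD addrA addrAC.
by exists (fun d => d - k) => d; rewrite ?addrK ?subrK.
Qed.

Lemma series_mulDl f f' g e : fsupp (fun d => f d *: g (e - d)) ->
  fsupp (fun d => f' d *: g (e - d)) ->
  series_mul (fun d => f d + f' d) g e = series_mul f g e + series_mul f' g e.
Proof.
move=> h h'; rewrite /series_mul -fsumD //.
by apply: eq_fsbigr => d _; rewrite scalerDl.
Qed.

Lemma series_mulZl (c : S) f g e : fsupp (fun d => f d *: g (e - d)) ->
  series_mul (fun d => c * f d) g e = c *: series_mul f g e.
Proof.
move=> h; rewrite /series_mul (fsum_additive (phi := fun x => c *: x)) ?scaler0 //.
  by apply: eq_fsbigr => d _; rewrite scalerA.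
by move=> x y; rewrite scalerDr.
Qed.

Lemma series_mul1 g e : series_mul (fun d => (d == 0)%:R : S) g e = g e.
Proof.
rewrite /series_mul (@fsum1 _ _ _ 0) ?eqxx ?subr0 ?scale1r // => d /eqP/negbTE ->.
by rewrite scale0r.
Qed.

End Bounded.

(** * Superpolynomials acting on series in two variables *)

Lemma sub10 (p q : int) : (p, q) - (1, 0) = (p - 1, q).
Proof. by congr pair; rewrite /= ?subr0. Qed.

Lemma sub01 (p q : int) : (p, q) - (0, 1) = (p, q - 1).
Proof. by congr pair; rewrite /= ?subr0. Qed.

Section SuperpolyAction.
Context (F : fieldType) (L : option nat).
Local Notation A := (grassmann F L).
Local Notation B := (grassmann_phi F L).
Local Notation P := (superpoly F L).

(** Polynomials in x and y act on arbitrary two-variable series, without any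
    condition of convergence. *)
Definition act (M : lmodType B) (g : P) (f : int * int -> M) (e : int * int) : M :=
  ((g : {poly {poly B}}) *: ((fun p q => f (p, q)) : ser (ser M))) e.1 e.2.

Section Action.
Context (M : lmodType B).
Implicit Types (f : int * int -> M) (g h : P) (e : int * int).

Lemma actM g h f : act (g * h) f = act g (act h f).
Proof. by apply/funext => e; rewrite /act -scalerA. Qed.

Lemma act1 f : act 1 f = f.
Proof. by apply/funext => -[p q]; rewrite /act scale1r. Qed.

Lemma actDl g h f e : act (g + h) f e = act g f e + act h f e.
Proof. by rewrite /act scalerDl. Qed.

Lemma act0l f e : act 0 f e = 0.
Proof. by rewrite /act scale0r. Qed.

Lemma actDr g f f' e : act g (fun e => f e + f' e) e = act g f e + act g f' e.
Proof.
rewrite /act (_ : (fun p q => _) = (fun p q => f (p, q) : M) + (fun p q => f' (p, q) : M) :> ser (ser M)) //.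
by rewrite scalerDr.
Qed.

Lemma actNr g f e : act g (fun e => - f e) e = - act g f e.
Proof.
rewrite /act (_ : (fun p q => _) = - (fun p q => f (p, q) : M) :> ser (ser M)) //.
by rewrite scalerN.
Qed.

Lemma act_x f e : act (var_x F L) f e = f (e - (1, 0)).
Proof.
case: e => p q; pose s : ser (ser M) := fun p q => f (p, q).
rewrite sub10; exact: (congr1 (fun t : ser M => t q) (serX s p)).
Qed.

Lemma act_y f e : act (var_y F L) f e = f (e - (0, 1)).
Proof.
case: e => p q; pose s : ser (ser M) := fun p q => f (p, q).
rewrite sub01; have h := congr1 (fun t : ser M => t q) (serC 'X s p).
exact: (etrans h (serX (s p) q)).
Qed.

Lemma act_const (b : B) f e : act (const_poly b) f e = b *: f e.
Proof.
case: e => p q; pose s : ser (ser M) := fun p q => f (p, q).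
have h := congr1 (fun t : ser M => t q) (serC b%:P s p).
exact: (etrans h (serC b (s p) q)).
Qed.

#[local] Opaque act const_poly var_x var_y.

Lemma act_linear (d : superlinear F L) f e :
  act (superlinear_poly d) f e =
  const_phi (val d).1.1 *: f (e - (1, 0)) + const_phi (val d).1.2 *: f (e - (0, 1))
  + (const_phi (val d).2 * phi1 * phi2) *: f e.
Proof.
case: d => -[[a b] c] h; rewrite /superlinear_poly [in LHS]/=.
rewrite actDl actDl (act_const (const_phi c * phi1 * phi2)).
rewrite (actM (const_poly (const_phi a))) (actM (const_poly (const_phi b))).
rewrite -> (act_const (const_phi a) _ e), (act_const (const_phi b) _ e).
by rewrite -> act_x, act_y.
Qed.

End Action.

(** * Central elements *)

Definition central (R : nzRingType) (a : R) := forall b, a * b = b * a.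

Lemma centralM (R : nzRingType) (a b : R) : central a -> central b -> central (a * b).
Proof. by move=> ha hb c; rewrite -mulrA hb mulrA ha mulrA. Qed.

Lemma centralD (R : nzRingType) (a b : R) : central a -> central b -> central (a + b).
Proof. by move=> ha hb c; rewrite mulrDl mulrDr ha hb. Qed.

Lemma central1 (R : nzRingType) : central (1 : R).
Proof. by move=> c; rewrite mul1r mulr1. Qed.

Lemma centralN (R : nzRingType) (a : R) : central a -> central (- a).
Proof. by move=> ha c; rewrite mulNr mulrN ha. Qed.

Lemma centralX (R : nzRingType) (a : R) n : central a -> central (a ^+ n).
Proof.
by move=> ha; elim: n => [|n IH]; rewrite ?expr0 ?exprS; [exact: central1 | exact: centralM].
Qed.

Lemma central_polyC (R : nzRingType) (a : R) : central a -> central a%:P.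
Proof.
by move=> ha p; apply/polyP => i; rewrite coefCM coefMC ha.
Qed.

Lemma central_polyX (R : nzRingType) : central ('X : {poly R}).
Proof. by move=> p; rewrite commr_polyX. Qed.

Lemma central_const_phi (a : A) : ghom false a -> central (const_phi a : B).
Proof. by move=> ha b; apply: central_const. Qed.

Lemma central_phi1phi2 : central (phi1 * phi2 : B).
Proof. by move=> b; apply: central_phi12. Qed.

#[local] Transparent act const_poly var_x var_y.

Lemma central_x : central (var_x F L). Proof. exact: central_polyX. Qed.
Lemma central_y : central (var_y F L).
Proof. by apply: central_polyC; apply: central_polyX. Qed.
Lemma central_const_poly (b : B) : central b -> central (const_poly b).
Proof. by move=> hb; do 2 apply: central_polyC. Qed.

#[local] Opaque act const_poly var_x var_y.

Lemma central_superlinear d : central (superlinear_poly (d : superlinear F L)).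
Proof.
case: d => -[[a b] c] /= h; have /and4P[ha hb hc _] := h; rewrite /superlinear_poly /=.
apply: centralD; first apply: centralD.
- by apply: centralM central_x; apply: central_const_poly; apply: central_const_phi.
- by apply: centralM central_y; apply: central_const_poly; apply: central_const_phi.
- apply: central_const_poly; rewrite -mulrA; apply: centralM central_phi1phi2.
  exact: central_const_phi.
Qed.

#[local] Opaque superlinear_poly.

Lemma central_den ds : central (den (ds : seq (superlinear F L))).
Proof.
rewrite /den; elim/big_ind: _ => [|p q|d _]; [exact: central1 | exact: centralM |].
exact: central_superlinear.
Qed.

(** * Injectivity of linear denominators *)

Section Injectivity.
Context (R : nzRingType) (M : lmodType R).
Implicit Types (s : int * int -> M).

(** On the support q - p is bounded below, and where it is smallest the term of
    [a] has nothing to cancel against. *)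
Lemma leading_injective s (a a' b c : R) (N : int) : a' * a = 1 ->
  (forall p q : int, (N < p) || (q < - N) -> s (p, q) = 0) ->
  (forall p q : int, a *: s (p - 1, q) + b *: s (p, q - 1) + c *: s (p, q) = 0) ->
  forall p q, s (p, q) = 0.
Proof.
move=> a'a sN rel p q; have [k] := ubnP (absz (q - p + 2 * N)).
have [|le_k] := ltP (q - p + 2 * N) 0.
  by move=> h _; apply: sN; lia.
elim: k p q le_k => [|k IH] p q //= le_k lt_k.
have small p' q' : q' - p' < q - p -> s (p', q') = 0.
  move=> h; have [|h'] := ltP (q' - p' + 2 * N) 0; first by move=> h'; apply: sN; lia.
  by apply: IH => //; lia.
have := rel (p + 1) q; rewrite addrK (small (p + 1) (q - 1)); last by lia.
rewrite (small (p + 1) q); last by lia.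
rewrite !scaler0 !addr0 => /(congr1 (fun x => a' *: x)).
by rewrite scalerA a'a scale1r scaler0.
Qed.

(** Descending induction on the power of [a] that kills [s]. The multiple t of
    [s] by the previous power satisfies b t(p, q - 1) = - c t(p, q); as c^2 = 0
    and [b] is invertible, c t = 0, and hence t = 0. *)
Lemma nilpotent_injective s (a b b' c : R) n :
  central a -> central b -> central c -> a ^+ n = 0 -> b' * b = 1 -> c * c = 0 ->
  (forall p q : int, a *: s (p - 1, q) + b *: s (p, q - 1) + c *: s (p, q) = 0) ->
  forall p q, s (p, q) = 0.
Proof.
move=> ca cb cc an b'b c2 rel.
have cancel_b x : b *: x = 0 :> M -> x = 0.
  by move=> h; rewrite -[x]scale1r -b'b -scalerA h scaler0.
have descend k : (forall p q, a ^+ k.+1 *: s (p, q) = 0) -> forall p q, a ^+ k *: s (p, q) = 0.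
  move=> hk.
  have rel' p q : b *: (a ^+ k *: s (p, q - 1)) = - (c *: (a ^+ k *: s (p, q))).
    have := congr1 (fun x => a ^+ k *: x) (rel p q).
    rewrite scaler0 !scalerDr !scalerA -exprSr hk add0r.
    rewrite -(cb (a ^+ k)) -(cc (a ^+ k)) -!scalerA => /eqP.
    by rewrite addr_eq0 => /eqP.
  have relc p q : c *: (a ^+ k *: s (p, q)) = 0.
    apply: cancel_b; have := rel' p (q + 1); rewrite addrK => r.
    by rewrite scalerA cb -scalerA r scalerN (scalerA c c) c2 scale0r oppr0.
  move=> p q; apply: cancel_b; rewrite -[q](addrK 1) rel' relc oppr0 //.
suff all0 k : (k <= n)%N -> forall p q, a ^+ (n - k) *: s (p, q) = 0.
  by move=> p q; have := all0 n (leqnn n) p q; rewrite subnn expr0 scale1r.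
elim: k => [|k IH] hk p q; first by rewrite subn0 an scale0r.
by apply: descend => p' q'; rewrite subnSK //; apply: IH; exact: ltnW.
Qed.

End Injectivity.

Lemma const_phi_unit (a : A) : body a != 0 -> (const_phi a^-1 : B) * const_phi a = 1.
Proof. by move=> /body_unit ua; rewrite const_phiM mulVr. Qed.

Lemma const_phi_nilp (a : A) : body a = 0 -> exists n, (const_phi a : B) ^+ n = 0.
Proof. by move=> /body0_nilpotent[n hn]; exists n; rewrite const_phiX hn. Qed.

(** Two cases, according to the bodies of the two coefficients: if both are
    nonzero, the direction of boundedness selects the coefficient that leads;
    otherwise the coefficient of zero body is nilpotent. *)
Lemma superlinear_injective (M : lmodType B) dir (d : superlinear F L) (s : int * int -> M) :
  bounded dir s -> (forall e, act (superlinear_poly d) s e = 0) -> forall e, s e = 0.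
Proof.
case: d => -[[a b] c] /= hd [N sN] h0.
have rel p q : const_phi a *: s (p - 1, q) + const_phi b *: s (p, q - 1)
    + (const_phi c * phi1 * phi2) *: s (p, q) = 0.
  by have := h0 (p, q); rewrite act_linear sub10 sub01.
have rel' q p : const_phi b *: s (p, q - 1) + const_phi a *: s (p - 1, q)
    + (const_phi c * phi1 * phi2) *: s (p, q) = 0.
  by rewrite [X in X + _]addrC rel.
have /and4P[ha hb hc hab] := hd.
have ca := central_const_phi ha; have cb := central_const_phi hb.
have cc : central (const_phi c * phi1 * phi2 : B).
  by rewrite -mulrA; apply: centralM central_phi1phi2; apply: central_const_phi.
pose s' (e : int * int) := s (e.2, e.1).
case=> p q.
have [a0|a0] := eqVneq (body a) 0; have [b0|b0] := eqVneq (body b) 0.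
- by rewrite a0 b0 eqxx in hab.
- have [n an] := const_phi_nilp a0.
  exact: (nilpotent_injective ca cb cc an (const_phi_unit b0) (const_phi12_sq _ c) rel).
- have [n bn] := const_phi_nilp b0.
  exact: (nilpotent_injective (s := s') cb ca cc bn (const_phi_unit a0) (const_phi12_sq _ c) rel').
- case: (dir) sN => sN.
    exact: (leading_injective (N := N) (const_phi_unit a0) (fun p q => sN (p, q)) rel).
  apply: (leading_injective (s := s') (N := N) (const_phi_unit b0) _ rel').
  by move=> p' q' h; apply: (sN (q', p')); rewrite /= orbC.
Qed.

Lemma bounded_act_linear (M : lmodType B) dir d (s : int * int -> M) :
  bounded dir s -> bounded dir (act (superlinear_poly d) s).
Proof.
move=> bs.
apply: (@boundedU _ _ _ _ (fun e => (s (e - (1, 0)), s (e - (0, 1)))) s).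
- by move=> e [h1 h2] h3; rewrite act_linear h1 h2 h3 !scaler0 !addr0.
- apply: (boundedU _ (bounded_shift (1, 0) bs) (bounded_shift (0, 1) bs)).
  by move=> e -> ->.
- by [].
Qed.

Lemma den_injective (M : lmodType B) dir (ds : seq (superlinear F L)) (s : int * int -> M) :
  bounded dir s -> (forall e, act (den ds) s e = 0) -> forall e, s e = 0.
Proof.
elim: ds s => [|d ds IH] s bs; first by rewrite /den big_nil act1.
rewrite /den big_cons central_superlinear actM => h.
apply: (superlinear_injective (d := d) bs); apply: IH => //.
exact: bounded_act_linear.
Qed.

End SuperpolyAction.

(** * Inverses of linear denominators *)

Section SeriesMulLinear.
Context (S : nzRingType) (M : lmodType S).

Lemma eq_series_mul (f f' : int * int -> S) (g : int * int -> M) e :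
  f =1 f' -> series_mul f g e = series_mul f' g e.
Proof. by move=> /funext ->. Qed.

Lemma series_mul_linear dir (a b c : S) (f : int * int -> S) (g : int * int -> M) k l e :
  bounded dir f -> bounded dir g ->
  a *: series_mul f g (e - k) + b *: series_mul f g (e - l) + c *: series_mul f g e =
  series_mul (fun d => a * f (d - k) + b * f (d - l) + c * f d) g e.
Proof.
move=> bf bg.
have bZ (x : S) h : bounded dir h -> bounded dir (fun d => x * h d).
  by apply: boundedS => d ->; rewrite mulr0.
have bD (h h' : int * int -> S) : bounded dir h -> bounded dir h' ->
    bounded dir (fun d => h d + h' d).
  by apply: boundedU => d -> ->; rewrite addr0.
have [bk bl] := (bounded_shift k bf, bounded_shift l bf).
have [zk zl] := (bZ a _ bk, bZ b _ bl).
rewrite !series_mul_shift -!series_mulZl; try exact: (bounded_fsupp (dir := dir)).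
rewrite -!series_mulDl //; apply: (bounded_fsupp (dir := dir)) => //.
- exact: bD.
- exact: bZ.
Qed.

Lemma series_mul_inverse dir (a b : S) (f : int * int -> S) (g : int * int -> M) k l e :
  (forall d, a * f (d - k) + b * f (d - l) = (d == 0)%:R) ->
  bounded dir f -> bounded dir g ->
  a *: series_mul f g (e - k) + b *: series_mul f g (e - l) = g e.
Proof.
move=> fP bf bg; have := series_mul_linear a b 0 k l e bf bg.
rewrite scale0r addr0 => ->; rewrite -[RHS](series_mul1 g e).
by apply: eq_series_mul => j; rewrite mul0r addr0 fP.
Qed.

End SeriesMulLinear.

Lemma geom_cancel (R : unitRingType) (a b : R) n : a \is a GRing.unit -> central a ->
  a * ((- b) ^+ n.+1 * a^-1 ^+ n.+2) + b * ((- b) ^+ n * a^-1 ^+ n.+1) = 0.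
Proof.
move=> ua ca; rewrite mulrA ca -mulrA (exprS a^-1 n.+1) (mulrA a) divrr // mul1r.
by rewrite (exprS (- b)) !mulNr mulrA addNr.
Qed.

Section Geometric.
Context (F : fieldType) (L : option nat).
Local Notation A := (grassmann F L).

(** The expansion of 1 / (a x + b y) in nonnegative powers of y; [geom] selects
    which of the two coefficients is inverted. *)
Definition geom0 (a b : A) (p q : int) : A :=
  if q is Posz n then if p == - 1 - q then (- b) ^+ n * a^-1 ^+ n.+1 else 0 else 0.

Lemma geom0P (a b : A) (p q : int) : a \is a GRing.unit -> central a ->
  a * geom0 a b (p - 1) q + b * geom0 a b p (q - 1) = ((p == 0) && (q == 0))%:R.
Proof.
move=> ua ca; case: q => [[|n]|n].
- have -> : Posz 0 - 1 = Negz 0 by [].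
  rewrite /geom0 subr0 eqxx andbT (_ : (p - 1 == -1) = (p == 0)); last by lia.
  rewrite mulr0 addr0; case: eqP => _; last by rewrite mulr0.
  by rewrite expr0 mul1r expr1 divrr.
- have -> : Posz n.+1 - 1 = Posz n by lia.
  rewrite /geom0 (_ : (p - 1 == -1 - Posz n.+1) = (p == -1 - Posz n)); last by lia.
  rewrite andbF; case: eqP => _; last by rewrite !mulr0 addr0.
  exact: geom_cancel.
- have -> : Negz n - 1 = Negz n.+1 by lia.
  by rewrite /= !mulr0 addr0 andbF.
Qed.

Lemma geomE (a b : A) p q :
  geom a b p q = if body a != 0 then geom0 a b p q else geom0 b a q p.
Proof. rewrite /geom /geom0; case: ifP => _; reflexivity. Qed.

Lemma geom0_support (a b : A) p q : geom0 a b p q != 0 -> (0 <= q) && (p == - 1 - q).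
Proof.
case: q => n; rewrite /geom0; last by rewrite eqxx.
by case: ifP => [h _|_]; rewrite ?eqxx //; lia.
Qed.

Lemma geom0_nilp (a b : A) : body b = 0 ->
  exists N : nat, forall p q, geom0 a b p q != 0 -> q < N%:Z.
Proof.
move=> /body0_nilpotent[N hN]; exists N => p [n|n]; rewrite /geom0; last by rewrite eqxx.
case: ifP => _; last by rewrite eqxx.
apply: contraR; rewrite -leNgt lez_nat => hn.
by rewrite exprNn -(subnK hn) [b ^+ _]exprD hN !(mulr0, mul0r).
Qed.

Section InvLinear.
Context (dir : direction) (a b : A).
Hypothesis (ha : ghom false a) (hb : ghom false b) (hab : (body a != 0) || (body b != 0)).

Lemma inv_linearP e :
  a * inv_linear dir a b (e - (1, 0)) + b * inv_linear dir a b (e - (0, 1)) = (e == 0)%:R.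
Proof.
case: e => p q; rewrite sub10 sub01 xpair_eqE.
have ca' : central a by move=> x; exact: ghom_central.
have cb' : central b by move=> x; apply: ghom_central.
case: (dir); rewrite /inv_linear !geomE /=.
- case: ifPn => a0; first by rewrite geom0P ?body_unit.
  move: hab; rewrite (negbTE a0) /= => b0.
  by rewrite addrC andbC geom0P ?body_unit.
- case: ifPn => b0; first by rewrite addrC andbC geom0P ?body_unit.
  move: hab; rewrite (negbTE b0) orbF => a0.
  by rewrite geom0P ?body_unit.
Qed.

End InvLinear.

(** The expansion that inverts the coefficient against the direction only occurs
    when the other coefficient is nilpotent, and then it is a finite sum. *)
Lemma inv_linear_bounded dir (a b : A) : bounded dir (inv_linear dir a b).
Proof.
have main x y : exists N : nat, forall p q,
    (if body x != 0 then geom0 x y p q else geom0 y x q p) != 0 -> (- N%:Z <= q) && (p < N%:Z).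
  have [x0|x0] := eqVneq (body x) 0.
    have [N hN] := geom0_nilp y x0; exists N.+1 => p q h.
    by have := hN _ _ h; have /andP[] := geom0_support h; lia.
  by exists 1%N => p q /geom0_support; lia.
case: (dir); [have [N hN] := main a b | have [N hN] := main b a]; exists N%:Z => -[p q] /= o;
  apply/eqP; apply: contraLR o => /hN; lia.
Qed.

End Geometric.

(** The computation 1 / (l + z) = 1 / l - z / l^2 for z^2 = 0, on the two
    coefficients of l: [u], [v] are coefficients of 1 / l, and [u'], [v'], [y] of
    1 / l^2. *)
Lemma nilpotent_cancel (R : nzRingType) (a b z u u' v v' w y x : R) :
  central z -> z * z = 0 -> a * u + b * v = x -> a * u' + b * v' = w ->
  a * (u - z * u') + b * (v - z * v') + z * (w - z * y) = x.
Proof.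
move=> cz z2 <- <-.
have za r t : r * (z * t) = z * (r * t) by rewrite mulrA -cz mulrA.
rewrite !mulrBr (mulrA z z) z2 mul0r subr0 mulrDr (za a) (za b).
by rewrite addrACA !subrK.
Qed.

Section IotaInverse.
Context (F : fieldType) (L : option nat).
Local Notation A := (grassmann F L).
Local Notation B := (grassmann_phi F L).
Local Notation P := (superpoly F L).

Lemma series_const_bounded dir (f : int * int -> A) :
  bounded dir f -> bounded dir (fun e => const_phi (f e) : B).
Proof. by apply: boundedS => e ->. Qed.

Lemma inv_superlinear_bounded dir d : bounded dir (inv_superlinear dir (d : superlinear F L)).
Proof.
case: d => -[[a b] c] /= h; have /and4P[ha hb hc hab] := h.
have b1 := inv_linear_bounded dir a b.
have b2 := bounded_series_mul b1 (b1 : bounded dir (inv_linear dir a b : int * int -> A^o)).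
apply: (boundedU _ (series_const_bounded b1) (series_const_bounded b2)) => e.
by rewrite /inv_superlinear /= => -> ->; rewrite mulr0 subr0.
Qed.

Lemma act_linear_reg (d : superlinear F L) (f : int * int -> B) e :
  act (superlinear_poly d) (f : int * int -> B^o) e =
  const_phi (val d).1.1 * f (e - (1, 0)) + const_phi (val d).1.2 * f (e - (0, 1))
  + (const_phi (val d).2 * phi1 * phi2) * f e.
Proof. exact: act_linear. Qed.

Lemma inv_superlinearP dir d e :
  act (superlinear_poly d) (inv_superlinear dir d : int * int -> B^o) e = (e == 0)%:R.
Proof.
rewrite act_linear_reg; case: d => -[[a b] c] /= h; have /and4P[ha hb hc hab] := h.
rewrite /inv_superlinear /=; set l1 := inv_linear dir a b.
set l2 := series_mul l1 _.
have l1P k : a * l1 (k - (1, 0)) + b * l1 (k - (0, 1)) = (k == 0)%:R.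
  exact: inv_linearP.
have l2P k : a * l2 (k - (1, 0)) + b * l2 (k - (0, 1)) = l1 k.
  have b1 : bounded dir l1 by exact: inv_linear_bounded.
  exact: (@series_mul_inverse A A^o dir a b l1 l1 (1, 0) (0, 1) k l1P b1 b1).
pose K (x : A) : B := const_phi x.
have KL u v : K a * K u + K b * K v = K (a * u + b * v) by exact: const_phi_linear.
have cz : central (K c * phi1 * phi2).
  have -> : K c * phi1 * phi2 = K c * (phi1 * phi2) by exact: esym (mulrA _ _ _).
  by apply: centralM; [exact: central_const_phi | exact: central_phi1phi2].
have E1 := etrans (KL _ _) (congr1 K (l1P e)).
have E2 := etrans (KL _ _) (congr1 K (l2P e)).
rewrite -[RHS]/((e == 0)%:R : B).
have <- : K ((e == 0)%:R) = (e == 0)%:R by case: (e == 0).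
exact: (nilpotent_cancel _ cz (const_phi12_sq _ c) E1 E2).
Qed.

Lemma act_series_mul (M : lmodType B) dir d (f : int * int -> B) (g : int * int -> M) :
  bounded dir f -> bounded dir g ->
  act (superlinear_poly d) (series_mul f g) =
  series_mul (act (superlinear_poly d) (f : int * int -> B^o)) g.
Proof.
move=> bf bg; apply/funext => e; rewrite act_linear (series_mul_linear _ _ _ _ _ _ bf bg).
by apply: eq_series_mul => k; rewrite act_linear_reg.
Qed.

Lemma act_inv_superlinear (M : lmodType B) dir d (g : int * int -> M) : bounded dir g ->
  act (superlinear_poly d) (series_mul (inv_superlinear dir d) g) = g.
Proof.
move=> bg; rewrite (act_series_mul _ (inv_superlinear_bounded dir d) bg).
apply/funext => e; rewrite -[RHS](series_mul1 g e).
by apply: eq_series_mul => k; rewrite inv_superlinearP.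
Qed.

Lemma superpoly_series_bounded dir (g : P) : bounded dir (superpoly_series g).
Proof.
have [n [m [hn hm]]] : exists n m : nat,
    (forall i, (n <= i)%N -> (g : {poly {poly B}})`_i = 0) /\
    (forall i j, (i < n)%N -> (m <= j)%N -> (g : {poly {poly B}})`_i`_j = 0).
  exists (size (g : {poly {poly B}})), (\max_(i < size (g : {poly {poly B}})) size ((g : {poly {poly B}})`_i)%R)%N.
  split=> [i h|i j h le_m]; first by rewrite nth_default.
  rewrite nth_default //; apply: leq_trans le_m.
  exact: (leq_bigmax (F := fun i => size ((g : {poly {poly B}})`_(val i))%R) (Ordinal h)).
exists (n + m)%N%:Z => -[[p|p] [q|q]] // o; rewrite /superpoly_series.
have [lt_p|le_p] := ltnP p n; last by rewrite hn // coef0.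
by apply: hm => //; move: o; case: (dir) => /=; lia.
Qed.

Lemma iota_bounded dir f : bounded dir (iota_exp dir (f : sfrac F L)).
Proof.
case: f => g; elim=> [|d ds IH] /=; first exact: superpoly_series_bounded.
exact: (@bounded_series_mul B B^o dir _ _ (inv_superlinear_bounded dir d) IH).
Qed.

Lemma act_den_iota dir (f : sfrac F L) :
  act (den f.2) (iota_exp dir f : int * int -> B^o) = superpoly_series f.1.
Proof.
case: f => g; elim=> [|d ds IH]; first by rewrite /den big_nil act1.
rewrite /den /= big_cons central_superlinear actM act_inv_superlinear //.
exact: (iota_bounded dir (g, ds)).
Qed.

End IotaInverse.

(** * Series represented by fractions *)

Section Represents.
Context (F : fieldType) (L : option nat).
Local Notation B := (grassmann_phi F L).
Local Notation P := (superpoly F L).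
Local Notation SF := (sfrac F L).
Implicit Types (g h : P) (f : SF) (S : int * int -> B).

Lemma superpoly_ind (Q : P -> Prop) :
  Q 0 -> (forall b, Q (const_poly b)) ->
  (forall g h, Q g -> Q h -> Q (g + h)) ->
  (forall g, Q g -> Q (g * var_x F L)) -> (forall g, Q g -> Q (g * var_y F L)) ->
  forall g, Q g.
Proof.
move=> Q0 QC QD Qx Qy; elim/poly_ind => [|g c Qg]; first exact: Q0.
apply: (QD); first exact: Qx.
elim/poly_ind: c => [|c b Qc]; first by rewrite polyC0; exact: Q0.
rewrite polyCD polyCM; apply: QD; [exact: Qy | exact: QC].
Qed.

Lemma superpoly_seriesD g h e :
  superpoly_series (g + h) e = superpoly_series g e + superpoly_series h e.
Proof.
case: e => -[p|p] [q|q] /=; rewrite ?addr0 //.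
by rewrite (coefD (g : {poly {poly B}})) coefD.
Qed.

Lemma superpoly_seriesN g e : superpoly_series (- g) e = - superpoly_series g e.
Proof.
case: e => -[p|p] [q|q] /=; rewrite ?oppr0 //.
by rewrite (coefN (g : {poly {poly B}})) coefN.
Qed.

Lemma superpoly_series0 e : superpoly_series (0 : P) e = 0.
Proof. by case: e => -[p|p] [q|q] //=; rewrite !coef0. Qed.

Lemma superpoly_series_x g e :
  superpoly_series (var_x F L * g) e = superpoly_series g (e - (1, 0)).
Proof.
case: e => p q; rewrite sub10; case: q => q; last by case: p => p //=; case: (_ - _).
case: p => [[|p]|p].
- rewrite (_ : Posz 0 - 1 = Negz 0) //= /var_x.
  by rewrite -(commr_polyX (g : {poly {poly B}})) coefMX /= coef0.
- rewrite (_ : Posz p.+1 - 1 = Posz p) /=; last by lia.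
  by rewrite /var_x -(commr_polyX (g : {poly {poly B}})) coefMX.
- by rewrite (_ : Negz p - 1 = Negz p.+1) //; lia.
Qed.

Lemma superpoly_series_y g e :
  superpoly_series (var_y F L * g) e = superpoly_series g (e - (0, 1)).
Proof.
case: e => p q; rewrite sub01; case: p => p; last first.
  by case: q => q //=; case: (_ - _).
case: q => [[|q]|q].
- rewrite (_ : Posz 0 - 1 = Negz 0) //= /var_y.
  by rewrite (coefCM 'X (g : {poly {poly B}})) coefXM.
- rewrite (_ : Posz q.+1 - 1 = Posz q) /=; last by lia.
  by rewrite /var_y (coefCM 'X (g : {poly {poly B}})) coefXM.
- by rewrite (_ : Negz q - 1 = Negz q.+1) //; lia.
Qed.

Lemma superpoly_series_const (b : B) g e :
  superpoly_series (const_poly b * g) e = b * superpoly_series g e.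
Proof.
case: e => -[p|p] [q|q] //=; rewrite ?mulr0 //.
by rewrite /const_poly (coefCM b%:P (g : {poly {poly B}})) coefCM.
Qed.

Lemma act_superpoly_series g h e :
  act g (superpoly_series h : int * int -> B^o) e = superpoly_series (g * h) e.
Proof.
elim/superpoly_ind: g h e => [h e|b h e|g g' IH IH' h e|g IH h e|g IH h e].
- by rewrite act0l mul0r superpoly_series0.
- by rewrite act_const superpoly_series_const.
- by rewrite actDl IH IH' mulrDl superpoly_seriesD.
- rewrite actM -mulrA -IH; congr act; apply/funext => e'.
  by rewrite act_x superpoly_series_x.
- rewrite actM -mulrA -IH; congr act; apply/funext => e'.
  by rewrite act_y superpoly_series_y.
Qed.

Lemma superpoly_series_inj g h : superpoly_series g =1 superpoly_series h -> g = h.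
Proof. by move=> gh; apply/polyP => i; apply/polyP => j; exact: (gh (Posz i, Posz j)). Qed.

(** [S] is the expansion of the fraction [f]. Stating this without inverses
    allows fractions to be compared and substituted in by multiplication only;
    it determines [S] because denominators are injective on bounded series. *)
Definition represents (dir : direction) (S : int * int -> B) f : Prop :=
  bounded dir S /\
  forall e, act (den f.2) (S : int * int -> B^o) e = superpoly_series f.1 e.

Lemma represents_iota dir f : represents dir (iota_exp dir f) f.
Proof. by split=> [|e]; [exact: iota_bounded | rewrite act_den_iota]. Qed.

Lemma represents_inj dir S S' f : represents dir S f -> represents dir S' f -> S = S'.
Proof.
move=> [bS hS] [bS' hS']; apply/funext => e; apply/eqP; rewrite -subr_eq0; apply/eqP.
apply: (@den_injective _ _ B^o dir f.2 (fun e => S e - S' e)).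
  by apply: boundedU bS bS' => k -> ->; rewrite subr0.
move=> k; rewrite (actDr _ (S : int * int -> B^o) (fun e => - S' e)) actNr.
by rewrite hS hS' subrr.
Qed.

Lemma represents_iotaE dir S f : represents dir S f -> S = iota_exp dir f.
Proof. by move=> h; apply: represents_inj h (represents_iota _ _). Qed.

Lemma den_cat (ds es : seq (superlinear F L)) : den (ds ++ es) = den ds * den es.
Proof. by rewrite /den big_cat. Qed.

Lemma bounded_act_den (M : lmodType B) dir ds (T : int * int -> M) :
  bounded dir T -> bounded dir (act (den (ds : seq (superlinear F L))) T).
Proof.
move=> bT; elim: ds => [|d ds IH]; first by rewrite /den big_nil act1.
by rewrite /den big_cons actM; apply: bounded_act_linear.
Qed.

(** Fractions are equal up to a further common denominator, and this denominator
    is cancelled by injectivity. *)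
Lemma represents_eq dir S f f' : represents dir S f -> sfrac_eq f f' -> represents dir S f'.
Proof.
move=> [bS hS] [es h]; split=> // e; apply/eqP; rewrite -subr_eq0; apply/eqP.
have hSf : act (den f.2) (S : int * int -> B^o) = superpoly_series f.1 by apply/funext.
pose T e := act (den f'.2) (S : int * int -> B^o) e - superpoly_series f'.1 e.
apply: (@den_injective _ _ B^o dir (es ++ f.2) T).
  apply: (boundedU _ (bounded_act_den f'.2 (bS : bounded dir (S : int * int -> B^o)))
    (superpoly_series_bounded dir f'.1)).
  by rewrite /T => k -> ->; rewrite subr0.
move=> k; rewrite /T.
rewrite (actDr _ (act (den f'.2) (S : int * int -> B^o)) (fun e => - superpoly_series f'.1 e)) actNr.
rewrite act_superpoly_series -actM den_cat -mulrA (central_den f.2) mulrA actM hSf.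
rewrite act_superpoly_series -superpoly_seriesN -superpoly_seriesD.
rewrite -[RHS](superpoly_series0 k) -h; congr (superpoly_series _ k).
by rewrite -(central_den es) mulrBr -!mulrA (central_den f.2) (central_den f'.2).
Qed.

Lemma represents_uniq dir S f f' : represents dir S f -> represents dir S f' -> sfrac_eq f f'.
Proof.
move=> [bS /funext hS] [bS' /funext hS']; exists [::]; rewrite /den big_nil mulr1 -!/(den _).
apply/eqP; rewrite subr_eq0; apply/eqP; apply: superpoly_series_inj => e.
rewrite -(central_den f'.2) -(central_den f.2) -!act_superpoly_series -hS -hS' -!actM.
by rewrite (central_den f.2).
Qed.

Lemma sfrac_eq_sym f f' : sfrac_eq f f' -> sfrac_eq f' f.
Proof. by move=> [es h]; exists es; rewrite -opprB mulNr h oppr0. Qed.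

Lemma sfrac_eq_refl f : sfrac_eq f f.
Proof. by exists [::]; rewrite subrr mul0r. Qed.

Lemma sfrac_eq_trans f f' f'' : sfrac_eq f f' -> sfrac_eq f' f'' -> sfrac_eq f f''.
Proof.
move=> h h'; apply: (@represents_uniq finite_neg_y (iota_exp finite_neg_y f)).
  exact: represents_iota.
exact: represents_eq (represents_eq (represents_iota _ _) h) h'.
Qed.

End Represents.

(** * Binomial coefficients and the delta function identity *)

Section Binomials.
Context (R : realType).
Local Notation C := R[i].
Local Notation binom := (@binom_coef R).
Local Notation pow := (@pow_sub R).

Let ff (n : int) (k : nat) : C := \prod_(j < k) (n%:~R - j%:R).

Let ffSl n k : ff n k.+1 = n%:~R * ff (n - 1) k.
Proof.
rewrite /ff big_ord_recl subr0; congr (_ * _); apply: eq_bigr => i _.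
by rewrite rmorphB /= /bump /= natrD opprD addrA.
Qed.

Let ffSr n k : ff n k.+1 = ff n k * (n%:~R - k%:R).
Proof. by rewrite /ff big_ord_recr. Qed.

Let fact_neq0 k : (k`!%:R : C) != 0.
Proof. by rewrite pnatr_eq0 -lt0n fact_gt0. Qed.

Let succ_neq0 k : (k.+1%:R : C) != 0.
Proof. by rewrite pnatr_eq0. Qed.

Lemma binom0 n : binom n 0 = 1.
Proof. by rewrite /binom_coef big_ord0 divr1. Qed.

Lemma binom_pascal n k : binom (n + 1) k.+1 = binom n k.+1 + binom n k.
Proof.
rewrite /binom_coef -!/(ff _ _) ffSl addrK ffSr factS natrM.
rewrite rmorphD /= -natr1; field.
rewrite natr1; apply/andP; split; [exact: fact_neq0 | exact: succ_neq0].
Qed.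

Lemma binom_derive n k : (n - k%:Z)%:~R * binom n k = n%:~R * binom (n - 1) k.
Proof.
rewrite /binom_coef -!/(ff _ _) mulrA [X in X / _]mulrC rmorphB /= -ffSr ffSl.
by rewrite mulrA.
Qed.

Lemma binom_nat n k : binom n%:Z k = 'C(n, k)%:R.
Proof.
elim: n k => [|n IH] [|k]; rewrite ?binom0 ?bin0 //.
  by rewrite /binom_coef -/(ff _ _) ffSl !mul0r.
by rewrite -[in LHS]addn1 PoszD binom_pascal !IH -natrD.
Qed.

Lemma binom_neg n k : binom (- (n.+1)%:Z) k = (-1) ^+ k * 'C(n + k, k)%:R.
Proof.
have [m] := ubnP (n + k)%N; elim: m n k => // m IH n [|k] lt_m.
  by rewrite binom0 addn0 bin0 mulr1.
have -> : binom (- n.+1%:Z) k.+1 = binom (- n.+1%:Z + 1) k.+1 - binom (- n.+1%:Z) k.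
  by rewrite binom_pascal addrK.
rewrite [X in _ - X]IH; last by lia.
case: n lt_m => [|n] lt_m.
  rewrite (_ : - 1%:Z + 1 = 0%:Z) // binom_nat bin0n sub0r !add0n !binn.
  by rewrite exprS mulN1r mulNr.
rewrite (_ : - (n.+2)%:Z + 1 = - (n.+1)%:Z); last by lia.
rewrite IH; last by lia.
have -> : 'C(n.+1 + k.+1, k.+1) = ('C(n.+1 + k, k.+1) + 'C(n.+1 + k, k))%N.
  by rewrite -binS; congr ('C(_, _)); lia.
have -> : (n + k.+1 = n.+1 + k)%N by lia.
by rewrite exprS natrD; ring.
Qed.

Lemma powE n i (k : nat) :
  pow n i k%:Z = if i + k%:Z == n then (-1) ^+ k * binom n k else 0.
Proof. by []. Qed.

Lemma pow_negz n i k : pow n i (Negz k) = 0.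
Proof. by []. Qed.

Lemma pow_pascal n i j : pow (n + 1) i j = pow n (i - 1) j - pow n i (j - 1).
Proof.
case: j => [[|j]|j].
- rewrite (_ : Posz 0 - 1 = Negz 0) // pow_negz subr0 !powE !binom0.
  by rewrite (_ : (i + 0%:Z == n + 1) = (i - 1 + 0%:Z == n)) //; lia.
- rewrite (_ : Posz j.+1 - 1 = Posz j); last by lia.
  rewrite !powE (_ : (i - 1 + j.+1%:Z == n) = (i + j.+1%:Z == n + 1)); last by lia.
  rewrite (_ : (i + j%:Z == n) = (i + j.+1%:Z == n + 1)); last by lia.
  by case: ifP => _; rewrite ?subr0 // binom_pascal exprS; ring.
- by rewrite (_ : Negz j - 1 = Negz j.+1) ?pow_negz ?subr0 //; lia.
Qed.

(** The two partial derivatives of (y - z)^n. *)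
Lemma pow_derive1 n i j : n%:~R * pow (n - 1) i j = (i + 1)%:~R * pow n (i + 1) j.
Proof.
case: j => [j|j] /=; last by rewrite !mulr0.
rewrite (_ : (i + j%:Z == n - 1) = (i + 1 + j%:Z == n)); last by lia.
case: eqP => [<-|_]; last by rewrite !mulr0.
by rewrite mulrCA -binom_derive addrK mulrCA.
Qed.

Lemma pow_derive2 n i j : n%:~R * pow (n - 1) i j = - ((j + 1)%:~R * pow n i (j + 1)).
Proof.
case: j => [j|[|j]].
- rewrite (_ : Posz j + 1 = Posz j.+1) /=; last by lia.
  rewrite (_ : (i + j%:Z == n - 1) = (i + j.+1%:Z == n)); last by lia.
  case: eqP => [e|_]; last by rewrite !mulr0 oppr0.
  rewrite /binom_coef -!/(ff _ _) ffSl factS natrM exprS.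
  by field; rewrite fact_neq0 nat1r succ_neq0.
- by rewrite /= mul0r mulr0 oppr0.
- rewrite (_ : Negz j.+1 + 1 = Negz j) /= ?mulr0 ?oppr0 //; lia.
Qed.

Lemma pow0 i j : pow 0 i j = ((i, j) == 0)%:R.
Proof.
rewrite xpair_eqE; case: j => [[|j]|j] /=; last by rewrite andbF.
  by rewrite addr0 andbT binom0 expr0 mulr1; case: eqP.
rewrite andbF; case: eqP => // _.
by rewrite (binom_nat 0) bin0n mulr0.
Qed.

Lemma pow_degree n i j : pow n i j != 0 -> (0 <= j) && (i + j == n).
Proof.
by case: j => j; rewrite ?pow_negz ?eqxx // powE; case: ifP => h; rewrite ?eqxx //; lia.
Qed.

Lemma pow_sub_eq0 n i j : ~~ ((0 <= j) && (i + j == n)) -> pow n i j = 0.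
Proof. by move=> h; apply/eqP; apply: contraR h => /pow_degree. Qed.

Lemma pow_nat_sym n i j : (0 <= i) -> i + j = n%:Z ->
  pow n%:Z i j = (-1) ^ n%:Z * pow n%:Z j i.
Proof.
case: i => // i _; case: j => [j|j] h.
  have -> : n = (i + j)%N by lia.
  have e1 : i%:Z + j%:Z == (i + j)%N%:Z by lia.
  rewrite !powE (addrC j%:Z) e1 !binom_nat -exprnP exprD.
  have -> : 'C(i + j, i) = 'C(i + j, j) by rewrite -(bin_sub (leq_addl i j)) addnK.
  have -> (x a b : C) : a * b * (a * x) = (a * a) * (b * x) by ring.
  by rewrite -expr2 sqrr_sign mul1r.
rewrite pow_negz powE; case: ifP => _; rewrite ?mulr0 // binom_nat bin_small ?mulr0 //; lia.
Qed.

(** All terms vanish unless the exponents add up to - 1. If e0 < 0, the two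
    expansions on the left are those of one polynomial. If e0 >= 0, the signs of
    e1 and e2 make at least one of the three terms vanish, and the other two are
    the same binomial coefficient up to sign. *)
Lemma delta_identity e0 e1 e2 :
  pow (- e0 - 1) e1 e2 - (-1) ^ (- e0 - 1) * pow (- e0 - 1) e2 e1 = pow (- e2 - 1) e1 e0.
Proof.
have [e_sum|ne_sum] := eqVneq (e0 + e1 + e2) (-1); last first.
  by rewrite !pow_sub_eq0 ?mulr0 ?subr0 //; lia.
have neg_pow (b c : nat) (a : int) : a + b%:Z + c%:Z = -1 -> pow (- b%:Z - 1) a c%:Z = 'C(b + c, c)%:R.
  move=> h; rewrite /pow_sub (_ : a + c%:Z == - b%:Z - 1); last by lia.
  rewrite (_ : - b%:Z - 1 = - (b.+1)%:Z); last by lia.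
  by rewrite binom_neg mulrA -expr2 sqrr_sign mul1r.
case: e0 e_sum => [b|b] e_sum; last first.
  rewrite [RHS]pow_sub_eq0 // (_ : - Negz b - 1 = b%:Z); last by lia.
  have [h1|h1] := leP 0 e1; first by rewrite (@pow_nat_sym b e1 e2) ?subrr //; lia.
  rewrite (@pow_nat_sym b e2 e1); [|lia..].
  by rewrite mulrA -exprnP -expr2 sqrr_sign mul1r subrr.
case: e1 e_sum => [c|c] e_sum; last case: e2 e_sum => [d|d] e_sum.
- have -> : - e2 - 1 = (b + c)%N%:Z by lia.
  rewrite (@pow_sub_eq0 _ c%:Z e2); last by lia.
  rewrite neg_pow; last by lia.
  rewrite /pow_sub (_ : c%:Z + b%:Z == (b + c)%N%:Z) ?binom_nat; last by lia.
  rewrite (_ : - b%:Z - 1 = - (b.+1)%:Z); last by lia.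
  rewrite -exprz_inv invrN1 -exprnP exprS sub0r mulN1r mulNr opprK.
  by rewrite -(bin_sub (leq_addl b c)) addnK.
- rewrite (@pow_sub_eq0 _ d%:Z (Negz c)) // mulr0 subr0 !neg_pow; [|lia..].
  by rewrite -(bin_sub (leq_addl b d)) addnK addnC.
- rewrite !(@pow_sub_eq0 (- b%:Z - 1)) ?mulr0 ?subr0; [|lia..].
  rewrite (_ : - Negz d - 1 = d%:Z); last by lia.
  by rewrite /pow_sub binom_nat bin_small ?mulr0 ?if_same //; lia.
Qed.

End Binomials.

(** * The super delta functions *)

Section SeriesMulLinearRight.
Context (S : nzRingType) (M : lmodType S).

Lemma series_mul_linear_r dir (a b c : S) (f : int * int -> S) (g : int * int -> M) k l e :
  central a -> central b -> central c -> bounded dir f -> bounded dir g ->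
  a *: series_mul f g (e - k) + b *: series_mul f g (e - l) + c *: series_mul f g e =
  series_mul f (fun d => a *: g (d - k) + b *: g (d - l) + c *: g d) e.
Proof.
move=> ca cb cc bf bg.
have bZ (x : S) h : bounded dir h -> bounded dir (fun d => x *: h d : M).
  by apply: boundedS => d ->; rewrite scaler0.
have bD (h h' : int * int -> M) : bounded dir h -> bounded dir h' ->
    bounded dir (fun d => h d + h' d).
  by apply: boundedU => d -> ->; rewrite addr0.
have [bk bl] := (bounded_shift k bg, bounded_shift l bg).
have fin h : bounded dir h -> fsupp (fun d => f d *: (h (e - d) : M)).
  by move=> bh; exact: (bounded_fsupp e bf bh).
have shift j : series_mul f g (e - j) = series_mul f (fun d => g (d - j)) e.
  by apply: eq_fsbigr => d _; rewrite addrAC.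
have scale x h : central x -> bounded dir h ->
    x *: series_mul f h e = series_mul f (fun d => x *: h d : M) e.
  move=> cx bh; rewrite /series_mul (fsum_additive (phi := fun y => x *: y)) ?scaler0 //.
  - by apply: eq_fsbigr => d _; rewrite !scalerA cx.
  - by move=> y z; rewrite scalerDr.
  - exact: fin.
have add h h' : bounded dir h -> bounded dir h' ->
    series_mul f h e + series_mul f h' e = series_mul f (fun d => h d + h' d : M) e.
  move=> bh bh'; rewrite /series_mul -fsumD; try exact: fin.
  by apply: eq_fsbigr => d _; rewrite scalerDr.
by rewrite !shift !scale // !add //; do ?[apply: bD | apply: bZ].
Qed.

End SeriesMulLinearRight.

Section ActRight.
Context (F : fieldType) (L : option nat).
Local Notation A := (grassmann F L).
Local Notation B := (grassmann_phi F L).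

Lemma central_superlinear_coef (d : superlinear F L) :
  [/\ central (const_phi (val d).1.1 : B), central (const_phi (val d).1.2 : B)
    & central (const_phi (val d).2 * phi1 * phi2 : B)].
Proof.
case: d => -[[a b] c] /= h; have /and4P[ha hb hc _] := h.
split; [exact: central_const_phi | exact: central_const_phi |].
by rewrite -mulrA; apply: centralM (@central_phi1phi2 F L); exact: central_const_phi.
Qed.

Lemma act_series_mul_r (M : lmodType B) dir d (f : int * int -> B) (g : int * int -> M) :
  bounded dir f -> bounded dir g ->
  act (superlinear_poly (d : superlinear F L)) (series_mul f g) =
  series_mul f (act (superlinear_poly d) g).
Proof.
have [ca cb cc] := central_superlinear_coef d.
move=> bf bg; apply/funext => e.
rewrite act_linear (series_mul_linear_r _ _ _ ca cb cc bf bg).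
by congr (series_mul f _ e); apply/funext => k; rewrite act_linear.
Qed.

Lemma act_den_series_mul_r (M : lmodType B) dir ds (f : int * int -> B) (g : int * int -> M) :
  bounded dir f -> bounded dir g ->
  act (den (ds : seq (superlinear F L))) (series_mul f g) =
  series_mul f (act (den ds) g).
Proof.
move=> bf bg; elim: ds => [|d ds IH]; first by rewrite /den big_nil !act1.
rewrite /den big_cons !actM [act _ (series_mul f g)]IH (act_series_mul_r d bf) //.
exact: bounded_act_den.
Qed.

Fact lin_plus_subproof : is_superlinear (1 : A, 1 : A, 1 : A).
Proof. by rewrite /is_superlinear ghom1 body1 oner_eq0. Qed.
(** The element x + y + phi1 phi2. *)
Definition lin_plus : superlinear F L := exist (@is_superlinear F L) _ lin_plus_subproof.

End ActRight.

Arguments lin_plus {F L}.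

Section OddScalars.
Context (R : nzRingType) (s : {rmorphism R -> R}).
Hypothesis sK : forall a, s (s a) = a.

(** The element a + phi1 phi2 b. *)
Definition dual_phi (a b : R) : oddext2 s := mk_phi a 0 0 b.

Let simp := (rmorph0, rmorph1, oppr0, mulr0, mul0r, mulr1, mul1r, add0r, addr0).

Lemma dual_phiE (a b : R) : const_phi a + const_phi b * phi1 * phi2 = dual_phi a b.
Proof.
rewrite const_phi12 sK; congr pair; congr pair; by rewrite /= ?addr0 ?add0r.
Qed.

Lemma dual_phiD a b a' b' : dual_phi a b + dual_phi a' b' = dual_phi (a + a') (b + b').
Proof. by congr pair; congr pair; rewrite /= addr0. Qed.

Lemma dual_phiN a b : - dual_phi a b = dual_phi (- a) (- b).
Proof. by congr pair; congr pair; rewrite /= oppr0. Qed.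

Lemma const_dual_phi c a b : const_phi c * dual_phi a b = dual_phi (c * a) (c * b).
Proof. by rewrite [LHS](mk_phiM s c 0 0 0 a 0 0 b) !simp sK. Qed.

Lemma phi12_dual_phi c a b :
  (const_phi c * phi1 * phi2) * dual_phi a b = dual_phi 0 (c * a).
Proof. by rewrite const_phi12 sK [LHS](mk_phiM s 0 0 0 c a 0 0 b) !simp. Qed.

Lemma const1_dual_phi a b : const_phi 1 * dual_phi a b = dual_phi a b.
Proof. by rewrite const_dual_phi !mul1r. Qed.

Lemma constN1_dual_phi a b : const_phi (-1) * dual_phi a b = - dual_phi a b.
Proof. by rewrite const_dual_phi dual_phiN !mulN1r. Qed.

Lemma phi12_dual_phi1 a b : (const_phi 1 * phi1 * phi2) * dual_phi a b = dual_phi 0 a.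
Proof. by rewrite phi12_dual_phi mul1r. Qed.

Lemma phi12_dual_phiN a b : (const_phi (-1) * phi1 * phi2) * dual_phi a b = dual_phi 0 (- a).
Proof. by rewrite phi12_dual_phi mulN1r. Qed.

End OddScalars.

Lemma signz_succ (F : fieldType) (n : int) : (-1) ^ (n + 1) = - (-1) ^ n :> F.
Proof. by rewrite expfzDr ?oppr_eq0 ?oner_eq0 // expr1z mulrN1. Qed.

Lemma alg_mul (F : fieldType) (R : algType F) (x y : F) : x%:A * y%:A = (x * y)%:A :> R.
Proof. by rewrite mulr_algl scalerA. Qed.

Section Deltas.
Context (R : realType) (L : option nat).
Local Notation C := R[i].
Local Notation A := (grassmann C L).
Local Notation B := (grassmann_phi C L).
Local Notation pow := (@pow_sub R).

(** The coefficients of the delta functions involve the odd variables only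
    through phi1 phi2: [scal2 x y] is x + y phi1 phi2. *)
Definition scal2 (x y : C) : B := @dual_phi A (@gparity C L) x%:A y%:A.

Lemma scal2D x y x' y' : scal2 x y + scal2 x' y' = scal2 (x + x') (y + y').
Proof. by rewrite /scal2 dual_phiD !scalerDl. Qed.

Lemma scal2N x y : - scal2 x y = scal2 (- x) (- y).
Proof. by rewrite /scal2 dual_phiN !scaleNr. Qed.

Lemma scal20 : scal2 0 0 = 0.
Proof. by rewrite /scal2 scale0r. Qed.

Lemma scal21 : scal2 1 0 = 1.
Proof. by rewrite /scal2 scale0r scale1r. Qed.

Lemma scalar_scal2 t x y : scalar_phi L t * scal2 x y = scal2 (t * x) (t * y).
Proof.
rewrite /scalar_phi /scal2 const_dual_phi; last exact: gparityK.
exact: (congr2 _ (alg_mul _ _ _) (alg_mul _ _ _)).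
Qed.

Lemma super_powE (c : C) n i j :
  super_pow_sub L c n i j = scal2 (pow n i j) (c * n%:~R * pow (n - 1) i j).
Proof. by apply: dual_phiE; exact: gparityK. Qed.

Lemma const1_scal2 x y : const_phi 1 * scal2 x y = scal2 x y.
Proof. apply: const1_dual_phi; exact: gparityK. Qed.

Lemma constN1_scal2 x y : const_phi (-1) * scal2 x y = - scal2 x y.
Proof. apply: constN1_dual_phi; exact: gparityK. Qed.

Lemma phi12_scal2 x y : (const_phi 1 * phi1 * phi2) * scal2 x y = scal2 0 x.
Proof. by rewrite /scal2 scale0r; apply: phi12_dual_phi1; exact: gparityK. Qed.

Lemma phi12N_scal2 x y : (const_phi (-1) * phi1 * phi2) * scal2 x y = scal2 0 (- x).
Proof. by rewrite /scal2 scale0r scaleNr; apply: phi12_dual_phiN; exact: gparityK. Qed.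

(** The three delta functions at a fixed exponent of the variable which does not
    occur in the series that they multiply: x0 for the two products, x1 for the
    iterate. *)
Definition d12 (e0 : int) (d : int * int) : B := delta_prod12 R L (e0, d.1, d.2).
Definition d21 (e0 : int) (d : int * int) : B := delta_prod21 R L (e0, d.1, d.2).
Definition d20 (e1 : int) (d : int * int) : B := delta_iter R L (d.1, e1, d.2).

Local Notation sgn n := ((-1) ^ n : C).

Lemma d12E e0 d : d12 e0 d =
  scal2 (pow (- e0 - 1) d.1 d.2) (- ((d.1 + 1)%:~R * pow (- e0 - 1) (d.1 + 1) d.2)).
Proof. by rewrite /d12 /delta_prod12 super_powE mulN1r mulNr pow_derive1. Qed.

Lemma d21E e0 d : d21 e0 d =
  scal2 (sgn (- e0 - 1) * pow (- e0 - 1) d.2 d.1)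
    (- ((d.1 + 1)%:~R * (sgn (- e0 - 1) * pow (- e0 - 1) d.2 (d.1 + 1)))).
Proof.
rewrite /d21 /delta_prod21 super_powE scalar_scal2 mul1r pow_derive2.
by rewrite mulrN mulrCA.
Qed.

Lemma d20E e1 d : d20 e1 d =
  scal2 (pow (- d.2 - 1) e1 d.1) (- ((e1 + 1)%:~R * pow (- d.2 - 1) (e1 + 1) d.1)).
Proof. by rewrite /d20 /delta_iter super_powE mulN1r mulNr pow_derive1. Qed.

(** Since x1 - x2 - phi1 phi2 is the Taylor shift of x1 - x2 in x1, the super
    identity is the ordinary one together with its derivative in x1. *)
Lemma super_delta_identity e0 e1 e2 :
  d12 e0 (e1, e2) - d21 e0 (e1, e2) = d20 e1 (e0, e2).
Proof.
rewrite d12E d21E d20E scal2N scal2D /= delta_identity; congr scal2.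
by rewrite -(delta_identity R e0) mulrBr opprD.
Qed.

Lemma lin_sub_scal2 (u v : int * int -> C) p q :
  act (superlinear_poly lin_sub) ((fun d => scal2 (u d) (v d)) : int * int -> B^o) (p, q) =
  scal2 (u (p - 1, q) - u (p, q - 1)) (v (p - 1, q) - v (p, q - 1) - u (p, q)).
Proof.
apply: (etrans (act_linear_reg _ _ _)); rewrite sub10 sub01.
apply: (etrans (congr2 +%R (congr2 +%R (const1_scal2 _ _) (constN1_scal2 _ _)) (phi12N_scal2 _ _))).
by rewrite scal2N !scal2D addr0.
Qed.

Lemma lin_plus_scal2 (u v : int * int -> C) p q :
  act (superlinear_poly lin_plus) ((fun d => scal2 (u d) (v d)) : int * int -> B^o) (p, q) =
  scal2 (u (p - 1, q) + u (p, q - 1)) (v (p - 1, q) + v (p, q - 1) + u (p, q)).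
Proof.
apply: (etrans (act_linear_reg _ _ _)); rewrite sub10 sub01.
apply: (etrans (congr2 +%R (congr2 +%R (const1_scal2 _ _) (const1_scal2 _ _)) (phi12_scal2 _ _))).
by rewrite !scal2D addr0.
Qed.

Lemma d12_powE e0 : d12 e0 = fun d => scal2 (pow (- e0 - 1) d.1 d.2)
  (- ((- e0 - 1)%:~R * pow (- e0 - 1 - 1) d.1 d.2)).
Proof. by apply/funext => d; rewrite d12E pow_derive1. Qed.

Lemma d21_powE e0 : d21 e0 = fun d => scal2 (sgn (- e0 - 1) * pow (- e0 - 1) d.2 d.1)
  (sgn (- e0 - 1) * ((- e0 - 1)%:~R * pow (- e0 - 1 - 1) d.2 d.1)).
Proof. by apply/funext => d; rewrite d21E pow_derive2 mulrN mulrCA. Qed.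

Lemma d20_powE e1 : d20 e1 = fun d => scal2 (pow (- d.2 - 1) e1 d.1)
  (- ((- d.2 - 1)%:~R * pow (- d.2 - 1 - 1) e1 d.1)).
Proof. by apply/funext => d; rewrite d20E pow_derive1. Qed.

(** The next three recursions express that, on the support of the delta
    functions, x0 = x1 - x2 - phi1 phi2. *)
Lemma d12_rec e0 : act (superlinear_poly lin_sub) (d12 e0 : int * int -> B^o) = d12 (e0 - 1).
Proof.
apply/funext => -[p q]; rewrite !d12_powE lin_sub_scal2 /=.
rewrite (_ : - (e0 - 1) - 1 = (- e0 - 1) + 1); last by lia.
move: (- e0 - 1) => n; rewrite addrK pow_pascal.
have h := @pow_pascal R (n - 1) p q; rewrite subrK in h; rewrite h rmorphD /=.
by congr scal2; ring.
Qed.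

Let d21_aux1 (t a b : C) : t * a - t * b = - t * (b - a).
Proof. by rewrite mulNr mulrBr opprB. Qed.

Let d21_aux2 (t m a b : C) :
  t * (m * a) - t * (m * b) - t * (b - a) = - t * ((m + 1) * (b - a)).
Proof. by ring. Qed.

Lemma d21_rec e0 : act (superlinear_poly lin_sub) (d21 e0 : int * int -> B^o) = d21 (e0 - 1).
Proof.
apply/funext => -[p q]; rewrite !d21_powE lin_sub_scal2 /=.
rewrite (_ : - (e0 - 1) - 1 = (- e0 - 1) + 1); last by lia.
move: (- e0 - 1) => n; rewrite addrK pow_pascal signz_succ.
have h := @pow_pascal R (n - 1) q p; rewrite subrK in h; rewrite h rmorphD /=.
exact: (congr2 _ (d21_aux1 _ _ _) (d21_aux2 _ _ _ _)).
Qed.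

Let d20_aux1 (a b : C) : a + (b - a) = b.
Proof. by rewrite addrC subrK. Qed.

Let d20_aux2 (m a b : C) : - (m * b) - (m + 1) * (a - b) + (a - b) = - (m * a).
Proof. by ring. Qed.

Lemma d20_rec e1 : act (superlinear_poly lin_plus) (d20 e1 : int * int -> B^o) = d20 (e1 - 1).
Proof.
apply/funext => -[p q]; rewrite !d20_powE lin_plus_scal2 /=.
rewrite (_ : - (q - 1) - 1 = (- q - 1) + 1); last by lia.
move: (- q - 1) => n; rewrite addrK pow_pascal.
have h := @pow_pascal R (n - 1) e1 p; rewrite subrK in h; rewrite h rmorphD /=.
exact: (congr2 _ (d20_aux1 _ _) (d20_aux2 _ _ _)).
Qed.

Lemma scal2_bounded dir (u v : int * int -> C) : bounded dir u -> bounded dir v ->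
  bounded dir (fun d => scal2 (u d) (v d)).
Proof. by apply: boundedU => e -> ->; rewrite scal20. Qed.

Lemma d12_bounded e0 : bounded finite_neg_y (d12 e0).
Proof.
rewrite d12_powE; apply: scal2_bounded; exists (`|e0|%N + 2)%N%:Z => -[p q] /= o;
  rewrite pow_sub_eq0 ?mulr0 ?oppr0 //; lia.
Qed.

Lemma d21_bounded e0 : bounded finite_neg_x (d21 e0).
Proof.
rewrite d21_powE; apply: scal2_bounded; exists (`|e0|%N + 2)%N%:Z => -[p q] /= o;
  rewrite pow_sub_eq0 ?mulr0 ?oppr0 //; lia.
Qed.

Lemma d20_bounded e1 : bounded finite_neg_x (d20 e1).
Proof.
rewrite d20_powE; apply: scal2_bounded; exists (`|e1|%N + 2)%N%:Z => -[p q] /= o;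
  rewrite pow_sub_eq0 ?mulr0 ?oppr0 //; lia.
Qed.

(** The coefficient of 1 / x0 is the power with exponent 0. *)
Lemma d12_N1 d : d12 (-1) d = (d == 0)%:R.
Proof.
case: d => p q; rewrite d12_powE /= opprK subrr pow0 mul0r oppr0.
by case: (_ == 0); [exact: scal21 | exact: scal20].
Qed.

Lemma d21_N1 d : d21 (-1) d = (d == 0)%:R.
Proof.
case: d => p q; rewrite d21_powE /= opprK subrr pow0 mul0r mulr0 expr0z mul1r.
rewrite !xpair_eqE andbC; case: (_ && _); [exact: scal21 | exact: scal20].
Qed.

End Deltas.

(** * Substitution in fractions *)

Lemma polyC2_mul (T : nzRingType) (c x y : T) :
  (c * x * y)%:P%:P = c%:P%:P * (x * y)%:P%:P.
Proof. by rewrite -mulrA !polyCM. Qed.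

Lemma shift_linear_add (R : nzRingType) (u v w x y z : R) :
  u * (x + y + z) + v * y + w * z = u * x + (v + u) * y + (w + u) * z.
Proof.
rewrite !mulrDr !mulrDl -!addrA; congr (_ + _); rewrite addrA addrACA.
by rewrite (addrC (u * y)) (addrC (u * z)) -addrA.
Qed.

Lemma shift_linear_sub (R : nzRingType) (u v w x y z : R) :
  u * (x - y - z) + v * y + w * z = u * x + (v - u) * y + (w - u) * z.
Proof.
rewrite !mulrBr !mulrBl -!addrA; congr (_ + _); rewrite addrA addrACA.
by rewrite (addrC (- (u * y))) (addrC (- (u * z))) -addrA.
Qed.

Section Substitution.
Context (F : fieldType) (L : option nat).
Local Notation A := (grassmann F L).
Local Notation B := (grassmann_phi F L).
Local Notation P := (superpoly F L).
Implicit Types (g h q : P) (d : superlinear F L) (ds : seq (superlinear F L)).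

Definition subst_x q g : P := (g : {poly {poly B}}) \Po (q : {poly {poly B}}).

Lemma subst_xD q g h : subst_x q (g + h) = subst_x q g + subst_x q h.
Proof. exact: comp_polyD. Qed.

Lemma subst_xB q g h : subst_x q (g - h) = subst_x q g - subst_x q h.
Proof. exact: comp_polyB. Qed.

Lemma subst_x0 q : subst_x q 0 = 0.
Proof. exact: comp_poly0. Qed.

Lemma subst_xC q (c : {poly B}) : subst_x q (c%:P : {poly {poly B}}) = (c%:P : {poly {poly B}}).
Proof. exact: comp_polyC. Qed.

Lemma subst_xX q : subst_x q (var_x F L) = q.
Proof. exact: comp_polyX. Qed.

Lemma subst_xM q g h : central q -> subst_x q (g * h) = subst_x q g * subst_x q h.
Proof.
move=> cq; rewrite /subst_x /comp_poly rmorphM; apply: hornerM_comm.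
by rewrite /comm_poly; exact: cq.
Qed.

Lemma subst_x1 q : subst_x q 1 = 1.
Proof. exact: (subst_xC q 1). Qed.

Lemma subst_xK q q' : central q -> central q' -> subst_x q' q = var_x F L ->
  forall g, subst_x q' (subst_x q g) = g.
Proof.
move=> cq cq' qq'; elim/superpoly_ind => [|b|g h IHg IHh|g IH|g IH].
- by rewrite !subst_x0.
- by rewrite (subst_xC q b%:P) (subst_xC q' b%:P).
- by rewrite !subst_xD IHg IHh.
- by rewrite (subst_xM _ _ cq) (subst_xM _ _ cq') IH subst_xX qq'.
- by rewrite (subst_xM _ _ cq) (subst_xM _ _ cq') IH !(subst_xC _ 'X).
Qed.

Definition x_sub : P := var_x F L - var_y F L - const_poly (phi1 * phi2).
Definition x_add : P := var_x F L + var_y F L + const_poly (phi1 * phi2).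

Lemma central_phi12_poly : central (const_poly (phi1 * phi2) : P).
Proof. apply: central_const_poly; exact: central_phi1phi2. Qed.

Lemma central_x_sub : central x_sub.
Proof.
apply: centralD (centralN central_phi12_poly).
apply: centralD (centralN (@central_y F L)); exact: central_x.
Qed.

Lemma central_x_add : central x_add.
Proof.
apply: centralD central_phi12_poly; apply: centralD (@central_y F L); exact: central_x.
Qed.

Lemma subst_x_sub_add : subst_x x_add x_sub = var_x F L.
Proof.
rewrite /x_sub !subst_xB subst_xX (subst_xC _ 'X) (subst_xC _ (phi1 * phi2)%:P).
by rewrite /x_add -[_%:P]/(var_y F L) -[(_%:P)%:P]/(const_poly (phi1 * phi2)) addrAC addrK addrK.
Qed.

Lemma superlinear_polyE d :
  superlinear_poly d = const_poly (const_phi (val d).1.1) * var_x F L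
    + const_poly (const_phi (val d).1.2) * var_y F L
    + const_poly (const_phi (val d).2) * const_poly (phi1 * phi2).
Proof.
case: d => -[[a b] c] h; rewrite /superlinear_poly /=; congr (_ + _).
exact: polyC2_mul.
Qed.

Lemma const_poly1_mul (g : P) : const_poly (const_phi 1) * g = g.
Proof.
have e1 : const_phi 1 = 1 :> B by [].
have e2 : const_poly (const_phi 1) = 1 :> P.
  exact: (etrans (congr1 (fun b : B => b%:P%:P) e1) (congr1 polyC (polyC1 _))).
exact: (etrans (congr1 ( *%R^~ g) e2) (mul1r g)).
Qed.

Lemma const_poly_phiD (a b : A) :
  const_poly (const_phi (a + b)) = const_poly (const_phi a) + const_poly (const_phi b) :> P.
Proof. by rewrite /const_poly -const_phiD !polyCD. Qed.

Lemma const_poly_phiN (a : A) :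
  const_poly (const_phi (- a)) = - const_poly (const_phi a) :> P.
Proof. by rewrite /const_poly -const_phiN !polyCN. Qed.

Fact add_superlinear_subproof d :
  is_superlinear ((val d).1.1, (val d).1.2 + (val d).1.1, (val d).2 + (val d).1.1).
Proof.
case: d => -[[a b] c] h /=; have /and4P[ha hb hc hab] := h.
have hD x y : ghom false x -> ghom false y -> ghom false (x + y : A).
  by move=> hx hy; rewrite -[y]opprK ghomB // ghomN.
rewrite !hD // ha /=; have -> : body (b + a) = body b + body a by exact: mcoeffD.
by case: eqP hab => //= ->; rewrite addr0.
Qed.

Definition add_superlinear d : superlinear F L :=
  exist (@is_superlinear F L) _ (add_superlinear_subproof d).

Definition sub_superlinear d : superlinear F L :=
  exist (@is_superlinear F L) _ (subst_superlinear_subproof d).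

Let subst_x_linear q (u v w y z : P) : central q ->
  subst_x q u = u -> subst_x q v = v -> subst_x q w = w -> subst_x q y = y ->
  subst_x q z = z ->
  subst_x q (u * var_x F L + v * y + w * z) = u * q + v * y + w * z.
Proof.
move=> cq hu hv hw hy hz; rewrite !subst_xD !(subst_xM _ _ cq) subst_xX.
by rewrite hu hv hw hy hz.
Qed.

Let subst_x_superlinear q d : central q ->
  subst_x q (superlinear_poly d) = const_poly (const_phi (val d).1.1) * q
    + const_poly (const_phi (val d).1.2) * var_y F L
    + const_poly (const_phi (val d).2) * const_poly (phi1 * phi2).
Proof.
move=> cq; rewrite superlinear_polyE; apply: (subst_x_linear cq); exact: subst_xC.
Qed.

Lemma subst_x_add_superlinear d :
  subst_x x_add (superlinear_poly d) = superlinear_poly (add_superlinear d).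
Proof.
rewrite (subst_x_superlinear d central_x_add).
by rewrite superlinear_polyE /= !const_poly_phiD; exact: shift_linear_add.
Qed.

Lemma subst_x_sub_superlinear d :
  subst_x x_sub (superlinear_poly d) = superlinear_poly (sub_superlinear d).
Proof.
rewrite (subst_x_superlinear d central_x_sub).
rewrite superlinear_polyE; case: d => -[[a b] c] h /=.
rewrite !const_poly_phiD !const_poly_phiN; exact: shift_linear_sub.
Qed.

Lemma subst_x_den_add ds : subst_x x_add (den ds) = den (map add_superlinear ds).
Proof.
rewrite /den; elim: ds => [|d ds IH]; first by rewrite !big_nil subst_x1.
by rewrite !big_cons (subst_xM _ _ central_x_add) IH subst_x_add_superlinear.
Qed.

Lemma subst_x_den_sub ds : subst_x x_sub (den ds) = den (map sub_superlinear ds).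
Proof.
rewrite /den; elim: ds => [|d ds IH]; first by rewrite !big_nil subst_x1.
by rewrite !big_cons (subst_xM _ _ central_x_sub) IH subst_x_sub_superlinear.
Qed.

Lemma sub_superlinearK ds :
  den (map add_superlinear (map sub_superlinear ds)) = den ds.
Proof.
rewrite -subst_x_den_add -subst_x_den_sub.
exact: (subst_xK central_x_sub central_x_add subst_x_sub_add).
Qed.

(** The substitution of x - y - phi1 phi2 for x is undone by that of
    x + y + phi1 phi2, on numerators and denominators alike. *)
Lemma sfrac_subst_eq (h f : sfrac F L) : sfrac_eq f (sfrac_subst h) ->
  sfrac_eq h (subst_x x_add f.1, map add_superlinear f.2).
Proof.
case: h f => h1 h2 [f1 f2] [es /= hes]; exists (map add_superlinear es).
move/(congr1 (subst_x x_add)): hes; rewrite subst_x0.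
rewrite (subst_xM _ _ central_x_add) subst_xB !(subst_xM _ _ central_x_add).
rewrite -/(subst_x x_sub h1) (subst_xK central_x_sub central_x_add subst_x_sub_add).
rewrite !subst_x_den_add sub_superlinearK /= => hes.
by rewrite -opprB mulNr hes oppr0.
Qed.

Lemma sfrac_subst_add (g : P) ds :
  sfrac_eq (g, ds) (sfrac_subst (subst_x x_add g, map add_superlinear ds)).
Proof.
exists [::]; rewrite /= -/(subst_x x_sub (subst_x x_add g)).
have subst_x_add_sub : subst_x x_sub x_add = var_x F L.
  rewrite /x_add !subst_xD subst_xX (subst_xC _ 'X) (subst_xC _ (phi1 * phi2)%:P).
  by rewrite /x_sub -[_%:P]/(var_y F L) -[(_%:P)%:P]/(const_poly (phi1 * phi2)) addrAC addrNK addrNK.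
rewrite (subst_xK central_x_add central_x_sub subst_x_add_sub).
rewrite -[X in _ * X - _]subst_x_den_sub -subst_x_den_add.
by rewrite (subst_xK central_x_add central_x_sub subst_x_add_sub) subrr mul0r.
Qed.

End Substitution.

(** * Clearing denominators under the delta functions *)

Lemma sub_eq_transfer (V : zmodType) (a a' b b' c c' : V) :
  a = a' -> b = b' -> c = c' -> a' - b' = c' -> a - b = c.
Proof. by move=> -> -> ->. Qed.

Lemma sub_eqD (V : zmodType) (a b c a' b' c' : V) :
  a - b = c -> a' - b' = c' -> (a + a') - (b + b') = c + c'.
Proof. by move=> <- <-; rewrite opprD addrACA. Qed.

Section Clearing.
Context (F : fieldType) (L : option nat).
Local Notation B := (grassmann_phi F L).
Context (M : lmodType B).
Implicit Types (S : int * int -> M).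

Lemma act_lin_x S e : act (superlinear_poly lin_x) S e = S (e - (1, 0)).
Proof.
rewrite act_linear /= (_ : const_phi 0 = 0) // !mul0r !scale0r !addr0.
exact: scale1r.
Qed.

Lemma act_lin_y S e : act (superlinear_poly lin_y) S e = S (e - (0, 1)).
Proof.
rewrite act_linear /= (_ : const_phi 0 = 0) // !mul0r !scale0r !addr0 add0r.
exact: scale1r.
Qed.

Lemma act_nseq_x n S e : act (den (nseq n lin_x)) S e = S (e - (n%:Z, 0)).
Proof.
elim: n S e => [|n IH] S [p q]; first by rewrite /den big_nil act1 subr0.
rewrite /den big_cons actM act_lin_x sub10 -/(den _) IH; congr S.
by congr pair; rewrite /= ?subr0 //; lia.
Qed.

Lemma act_nseq_y n S e : act (den (nseq n lin_y)) S e = S (e - (0, n%:Z)).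
Proof.
elim: n S e => [|n IH] S [p q]; first by rewrite /den big_nil act1 subr0.
rewrite /den big_cons actM act_lin_y sub01 -/(den _) IH; congr S.
by congr pair; rewrite /= ?subr0 //; lia.
Qed.

End Clearing.

Section DeltaClearing.
Context (R : realType) (L : option nat).
Local Notation C := R[i].
Local Notation B := (grassmann_phi C L).
Local Notation P := (superpoly C L).
Local Notation d12 := (@d12 R L).
Local Notation d21 := (@d21 R L).
Local Notation d20 := (@d20 R L).
Implicit Types (S : int * int -> B^o) (g h : P).

(** x^a y^b (x - y - phi1 phi2)^c *)
Definition den12 (a b c : nat) : seq (superlinear C L) :=
  nseq a lin_x ++ nseq b lin_y ++ nseq c lin_sub.

(** x^c y^b (x + y + phi1 phi2)^a, the image of [den12 a b c] under the
    substitution of x + y + phi1 phi2 for x. *)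
Definition den20 (a b c : nat) : seq (superlinear C L) :=
  nseq a lin_plus ++ nseq b lin_y ++ nseq c lin_x.

Lemma act_den12 a b c S p q :
  act (den (den12 a b c)) S (p, q) = act (den (nseq c lin_sub)) S (p - a%:Z, q - b%:Z).
Proof.
rewrite /den12 !den_cat !actM act_nseq_x act_nseq_y; congr act.
by congr pair; rewrite /= !subr0.
Qed.

Lemma act_den20 a b c S p q :
  act (den (den20 a b c)) S (p, q) = act (den (nseq a lin_plus)) S (p - c%:Z, q - b%:Z).
Proof.
rewrite /den20 !den_cat [_ * (_ * _)]central_den !actM act_nseq_y act_nseq_x; congr act.
by congr pair; rewrite /= !subr0.
Qed.

(** A factor x1 - x2 - phi1 phi2 moves from the series to the delta function, on
    which it acts as x0. *)
Lemma d12_act_sub S e0 n : bounded finite_neg_y S ->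
  series_mul (d12 e0) (act (den (nseq n lin_sub)) S) = series_mul (d12 (e0 - n%:Z)) S.
Proof.
move=> bS; elim: n e0 => [|n IH] e0; first by rewrite /den big_nil act1 subr0.
rewrite /den big_cons -/(den _) actM.
have b1 := d12_bounded R L e0; have bn := bounded_act_den (nseq n lin_sub) bS.
have E := etrans (esym (act_series_mul_r lin_sub b1 bn)) (act_series_mul lin_sub b1 bn).
have IH1 := IH (e0 - 1); rewrite (_ : e0 - 1 - n%:Z = e0 - (n.+1)%:Z) in IH1; last by lia.
by apply: (etrans E); rewrite d12_rec.
Qed.

Lemma d21_act_sub S e0 n : bounded finite_neg_x S ->
  series_mul (d21 e0) (act (den (nseq n lin_sub)) S) = series_mul (d21 (e0 - n%:Z)) S.
Proof.
move=> bS; elim: n e0 => [|n IH] e0; first by rewrite /den big_nil act1 subr0.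
rewrite /den big_cons -/(den _) actM.
have b1 := d21_bounded R L e0; have bn := bounded_act_den (nseq n lin_sub) bS.
have E := etrans (esym (act_series_mul_r lin_sub b1 bn)) (act_series_mul lin_sub b1 bn).
have IH1 := IH (e0 - 1); rewrite (_ : e0 - 1 - n%:Z = e0 - (n.+1)%:Z) in IH1; last by lia.
by apply: (etrans E); rewrite d21_rec.
Qed.

Lemma d20_act_plus S e1 n : bounded finite_neg_x S ->
  series_mul (d20 e1) (act (den (nseq n lin_plus)) S) = series_mul (d20 (e1 - n%:Z)) S.
Proof.
move=> bS; elim: n e1 => [|n IH] e1; first by rewrite /den big_nil act1 subr0.
rewrite /den big_cons -/(den _) actM.
have b1 := d20_bounded R L e1; have bn := bounded_act_den (nseq n lin_plus) bS.
have E := etrans (esym (act_series_mul_r lin_plus b1 bn)) (act_series_mul lin_plus b1 bn).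
have IH1 := IH (e1 - 1); rewrite (_ : e1 - 1 - n%:Z = e1 - (n.+1)%:Z) in IH1; last by lia.
by apply: (etrans E); rewrite d20_rec.
Qed.

(** The other two denominators are monomials; hence clearing all of them only
    shifts the exponents. *)
Lemma d12_clear S e0 e1 e2 a b c : bounded finite_neg_y S ->
  series_mul (d12 e0) (act (den (den12 a b c)) S) (e1, e2) =
  series_mul (d12 (e0 - c%:Z)) S (e1 - a%:Z, e2 - b%:Z).
Proof.
move=> bS; have b1 := d12_bounded R L e0.
have E := act_den_series_mul_r (den12 a b c) b1 bS.
apply: (etrans (esym (congr1 (fun T => T (e1, e2)) E))).
apply: (etrans (act_den12 _ _ _ _ _ _)).
have E' := etrans (act_den_series_mul_r (nseq c lin_sub) b1 bS) (d12_act_sub e0 c bS).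
exact: (congr1 (fun T => T (e1 - a%:Z, e2 - b%:Z)) E').
Qed.

Lemma d21_clear S e0 e1 e2 a b c : bounded finite_neg_x S ->
  series_mul (d21 e0) (act (den (den12 a b c)) S) (e1, e2) =
  series_mul (d21 (e0 - c%:Z)) S (e1 - a%:Z, e2 - b%:Z).
Proof.
move=> bS; have b1 := d21_bounded R L e0.
have E := act_den_series_mul_r (den12 a b c) b1 bS.
apply: (etrans (esym (congr1 (fun T => T (e1, e2)) E))).
apply: (etrans (act_den12 _ _ _ _ _ _)).
have E' := etrans (act_den_series_mul_r (nseq c lin_sub) b1 bS) (d21_act_sub e0 c bS).
exact: (congr1 (fun T => T (e1 - a%:Z, e2 - b%:Z)) E').
Qed.

Lemma d20_clear S e0 e1 e2 a b c : bounded finite_neg_x S ->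
  series_mul (d20 e1) (act (den (den20 a b c)) S) (e0, e2) =
  series_mul (d20 (e1 - a%:Z)) S (e0 - c%:Z, e2 - b%:Z).
Proof.
move=> bS; have b1 := d20_bounded R L e1.
have E := act_den_series_mul_r (den20 a b c) b1 bS.
apply: (etrans (esym (congr1 (fun T => T (e0, e2)) E))).
apply: (etrans (act_den20 _ _ _ _ _ _)).
have E' := etrans (act_den_series_mul_r (nseq a lin_plus) b1 bS) (d20_act_plus e1 a bS).
exact: (congr1 (fun T => T (e0 - c%:Z, e2 - b%:Z)) E').
Qed.

Lemma lin_xE : superlinear_poly (lin_x : superlinear C L) = var_x C L.
Proof.
apply: superpoly_series_inj => e; rewrite -[superlinear_poly _]mulr1 -[var_x _ _]mulr1.
by rewrite -!act_superpoly_series act_lin_x act_x.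
Qed.

Lemma lin_yE : superlinear_poly (lin_y : superlinear C L) = var_y C L.
Proof.
apply: superpoly_series_inj => e; rewrite -[superlinear_poly _]mulr1 -[var_y _ _]mulr1.
by rewrite -!act_superpoly_series act_lin_y act_y.
Qed.

Lemma lin_plusE : superlinear_poly (lin_plus : superlinear C L) = x_add C L.
Proof.
apply: (etrans (superlinear_polyE _)).
exact: (congr2 +%R (congr2 +%R (const_poly1_mul _) (const_poly1_mul _)) (const_poly1_mul _)).
Qed.

Local Notation ss g := (superpoly_series g : int * int -> B^o).

Lemma series_mul_ssD dir (f : int * int -> B) g h e : bounded dir f ->
  series_mul f (ss (g + h)) e = series_mul f (ss g) e + series_mul f (ss h) e.
Proof.
move=> bf; rewrite /series_mul -fsumD.
- by apply: eq_fsbigr => d _; rewrite superpoly_seriesD scalerDr.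
- exact: (bounded_fsupp (M := B^o) e bf (superpoly_series_bounded dir g)).
- exact: (bounded_fsupp (M := B^o) e bf (superpoly_series_bounded dir h)).
Qed.

Lemma series_mul_ss0 (f : int * int -> B) e : series_mul f (ss 0) e = 0.
Proof. by apply: fsum_eq0 => d; rewrite superpoly_series0 scaler0. Qed.

Lemma superpoly_series_poly (b : B) e :
  superpoly_series (const_poly b : P) e = if e == 0 then b else 0.
Proof.
rewrite -[const_poly b]mulr1 superpoly_series_const.
case: e => p q; rewrite xpair_eqE; case: p q => [[|p]|p] [[|q]|q] //=;
  rewrite ?mulr0 // -[1%:P`__]/((1%:P : {poly {poly B}})`__) ?coefC ?coef1 ?coef0 /= ?mulr1 ?mulr0 //.
Qed.

Lemma series_mul_const (f : int * int -> B) (b : B) e :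
  series_mul f (ss (const_poly b)) e = f e * b.
Proof.
rewrite /series_mul (fsum1 (d0 := e)) => [|d de].
  by rewrite subrr superpoly_series_poly eqxx.
rewrite superpoly_series_poly subr_eq0; case: eqP => [ed|_]; last by rewrite scaler0.
by case: de.
Qed.

Lemma superpoly_seriesMx g : superpoly_series (g * var_x C L) = act (superlinear_poly lin_x) (ss g).
Proof. by apply/funext => e; rewrite act_superpoly_series lin_xE central_x. Qed.

Lemma superpoly_seriesMy g : superpoly_series (g * var_y C L) = act (superlinear_poly lin_y) (ss g).
Proof. by apply/funext => e; rewrite act_superpoly_series lin_yE central_y. Qed.

Lemma superpoly_seriesM_add g :
  superpoly_series (g * x_add C L) = act (superlinear_poly lin_plus) (ss g).
Proof. by apply/funext => e; rewrite act_superpoly_series lin_plusE central_x_add. Qed.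

(** On the right the variable x1 of [g] may be replaced by x0 + x2 + phi1 phi2,
    which equals x1 on the support of the delta function. *)
Lemma delta_identity_poly g e0 e1 e2 :
  series_mul (d12 e0) (ss g) (e1, e2) - series_mul (d21 e0) (ss g) (e1, e2) =
  series_mul (d20 e1) (ss (subst_x (x_add C L) g)) (e0, e2).
Proof.
have [[b12 b21] b20] := (d12_bounded R L, d21_bounded R L, d20_bounded R L).
have bs dir (h : P) : bounded dir (ss h) by exact: superpoly_series_bounded.
pose Q g := forall e0 e1 e2,
  series_mul (d12 e0) (ss g) (e1, e2) - series_mul (d21 e0) (ss g) (e1, e2) =
  series_mul (d20 e1) (ss (subst_x (x_add C L) g)) (e0, e2).
suff: Q g by apply.
apply: (@superpoly_ind _ _ Q) =>
  [e0' e1' e2'|b e0' e1' e2'|{}g h IHg IHh {}e0 {}e1 {}e2|{}g IH {}e0 {}e1 {}e2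
  |{}g IH {}e0 {}e1 {}e2].
- have z f e : series_mul f (ss 0) e = 0 by exact: series_mul_ss0.
  rewrite subst_x0; exact: (sub_eq_transfer (z _ _) (z _ _) (z _ _) (subr0 0)).
- have cb f e : series_mul f (ss (const_poly b)) e = f e * b by exact: series_mul_const.
  rewrite (subst_xC _ b%:P); apply: (sub_eq_transfer (cb _ _) (cb _ _) (cb _ _)).
  by rewrite -mulrBl super_delta_identity.
- rewrite subst_xD; apply: (sub_eq_transfer (series_mul_ssD _ _ _ (b12 _))
    (series_mul_ssD _ _ _ (b21 _)) (series_mul_ssD _ _ _ (b20 _))).
  exact: (sub_eqD (IHg _ _ _) (IHh _ _ _)).
- rewrite (subst_xM _ _ (@central_x_add _ _)) subst_xX superpoly_seriesM_add.
  rewrite (superpoly_seriesMx g).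
  have E12 := congr1 (fun T => T (e1, e2)) (act_series_mul_r lin_x (b12 e0) (bs _ g)).
  have E21 := congr1 (fun T => T (e1, e2)) (act_series_mul_r lin_x (b21 e0) (bs _ g)).
  have E20 := congr1 (fun T => T (e0, e2)) (d20_act_plus e1 1 (bs _ (subst_x (x_add C L) g))).
  rewrite /den big_seq1 in E20.
  apply: (sub_eq_transfer (etrans (esym E12) (act_lin_x _ _)) (etrans (esym E21) (act_lin_x _ _)) E20).
  by rewrite sub10; exact: IH.
- rewrite (subst_xM _ _ (@central_x_add _ _)) (subst_xC _ 'X) -/(var_y C L) !superpoly_seriesMy.
  have E12 := congr1 (fun T => T (e1, e2)) (act_series_mul_r lin_y (b12 e0) (bs _ g)).
  have E21 := congr1 (fun T => T (e1, e2)) (act_series_mul_r lin_y (b21 e0) (bs _ g)).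
  have E20 := congr1 (fun T => T (e0, e2))
    (act_series_mul_r lin_y (b20 e1) (bs _ (subst_x (x_add C L) g))).
  apply: (sub_eq_transfer (etrans (esym E12) (act_lin_y _ _)) (etrans (esym E21) (act_lin_y _ _))
    (etrans (esym E20) (act_lin_y _ _))).
  by rewrite !sub01; exact: IH.
Qed.

End DeltaClearing.

(** * The Jacobi identity and rational functions *)

Section JacobiTriple.
Context (R : realType) (L : option nat).
Local Notation C := R[i].
Local Notation B := (grassmann_phi C L).
Local Notation P := (superpoly C L).
Local Notation d12 := (@d12 R L).
Local Notation d21 := (@d21 R L).
Local Notation d20 := (@d20 R L).
Local Notation ss g := (superpoly_series g : int * int -> B^o).
Implicit Types (S : int * int -> B^o) (g h : P).

(** The coefficientwise Jacobi identity for three arbitrary series; the sign of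
    the second product is absorbed in [S21]. *)
Definition jacobi3 (M : lmodType B) (S12 S21 S20 : int * int -> M) : Prop :=
  forall e0 e1 e2 : int,
    series_mul (d12 e0) S12 (e1, e2) - series_mul (d21 e0) S21 (e1, e2) =
    series_mul (d20 e1) S20 (e0, e2).

(** After multiplication by x1^a x2^b x0^c the three terms are products of the
    delta functions with a single polynomial, to which the delta function
    identity applies; the multiplication only shifts coefficients, so it can be
    undone. *)
Lemma rational_jacobi3 S12 S21 S20 g a b c :
  represents finite_neg_y S12 (g, den12 R L a b c) ->
  represents finite_neg_x S21 (g, den12 R L a b c) ->
  represents finite_neg_x S20 (subst_x (x_add C L) g, den20 R L a b c) ->
  jacobi3 S12 S21 S20.
Proof.
move=> [b12 /funext /= h12] [b21 /funext /= h21] [b20 /funext /= h20] e0 e1 e2.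
have E12 := @d12_clear R L S12 (e0 + c%:Z) (e1 + a%:Z) (e2 + b%:Z) a b c b12.
have E21 := @d21_clear R L S21 (e0 + c%:Z) (e1 + a%:Z) (e2 + b%:Z) a b c b21.
have E20 := @d20_clear R L S20 (e0 + c%:Z) (e1 + a%:Z) (e2 + b%:Z) a b c b20.
rewrite h12 !addrK in E12; rewrite h21 !addrK in E21; rewrite h20 !addrK in E20.
apply: (sub_eq_transfer (esym E12) (esym E21) (esym E20)).
exact: delta_identity_poly.
Qed.

Lemma d20_eq0 (e1 : int) (d : int * int) : d.1 < 0 -> d20 e1 d = 0.
Proof.
move=> h; rewrite d20E pow_sub_eq0; last by lia.
by rewrite pow_sub_eq0 ?mulr0 ?oppr0 ?scal20 //; lia.
Qed.

Lemma d20_N1 (q : int) : d20 (-1) (0, q) = (q == 0)%:R.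
Proof.
rewrite d20E [fst _]/= [snd _]/= addNr mul0r oppr0 (@powE R (- q - 1) (-1) 0) expr0 mul1r binom0 addr0.
rewrite (_ : (-1 == - q - 1) = (q == 0)); last by lia.
by case: (q == 0); [exact: scal21 | exact: scal20].
Qed.

(** The lowest power of x0 in [S] survives in the coefficient of 1 / x1. *)
Lemma d20_injective S : bounded finite_neg_x S ->
  (forall e0 e1 e2 : int, series_mul (d20 e1) S (e0, e2) = 0) -> forall e, S e = 0.
Proof.
move=> [N SN] h [p q]; have [k] := ubnP (absz (p + N)).
have [lt_p|] := ltP (p + N) 0; first by move=> _; apply: SN => /=; lia.
elim: k p q => [|k IH] p q //= le_p lt_k.
have low p' q' : p' < p -> S (p', q') = 0.
  move=> lt_p; have [lt0|le0] := ltP (p' + N) 0; first by apply: SN => /=; lia.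
  by apply: IH => //; lia.
have := h p (-1) q; rewrite /series_mul (fsum1 (d0 := 0)) => [|[d e] de].
  by rewrite subr0 (d20_N1 0) eqxx => <-; rewrite scale1r.
have [d0|d0|d0] := ltgtP d 0.
- by rewrite (@d20_eq0 (-1) (d, e)) // scale0r.
- have -> : (p, q) - (d, e) = (p - d, q - e) by [].
  by rewrite low ?scaler0 //; lia.
- rewrite d0 (d20_N1 e); case: eqP => [e0|_]; last by rewrite scale0r.
  by case: de; rewrite d0 e0.
Qed.

Lemma series_mul_N1 S : series_mul (d12 (-1)) S = S /\ series_mul (d21 (-1)) S = S.
Proof.
split; apply/funext => e; rewrite -[RHS](series_mul1 S e); apply: eq_series_mul => d.
  exact: d12_N1.
exact: d21_N1.
Qed.

(** The two directions together bound both exponents from both sides, so only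
    finitely many coefficients remain. *)
Lemma bounded_laurent S : bounded finite_neg_y S -> bounded finite_neg_x S ->
  exists (N : nat) (g : P), forall p q, S (p - N%:Z, q - N%:Z) = superpoly_series g (p, q).
Proof.
move=> [N1 h1] [N2 h2]; pose N := (absz N1 + absz N2)%N; exists N.
exists (\poly_(i < N.*2.+1) \poly_(j < N.*2.+1) (S (i%:Z - N%:Z, j%:Z - N%:Z) : B)).
move=> p q; rewrite /superpoly_series.
have out p' q' : ~~ ((0 <= p') && (p' <= N.*2%:Z) && (0 <= q') && (q' <= N.*2%:Z)) ->
    S (p' - N%:Z, q' - N%:Z) = 0.
  move=> h; have [o|no] := boolP (outside finite_neg_y N1 (p' - N%:Z) (q' - N%:Z)).
    by apply: h1.
  by apply: h2; move: h no; rewrite /= /N; lia.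
case: p => p; last by rewrite out.
case: q => q; last by rewrite out // andbF.
rewrite coef_poly; case: ltnP => hp; last by rewrite coef0 out //; lia.
by rewrite coef_poly; case: ltnP => hq //; rewrite out //; lia.
Qed.

Lemma den12_shift S a b c g :
  (forall p q, act (den (nseq c lin_sub)) S (p - a%:Z, q - b%:Z) = superpoly_series g (p, q)) ->
  forall e, act (den (den12 R L a b c)) S e = superpoly_series g e.
Proof. by move=> h [p q]; rewrite act_den12 h. Qed.

(** For [c] large, the coefficient of x0^(-1-c) of the iterate vanishes, and the
    Jacobi identity says that (x1 - x2 - phi1 phi2)^c S12 = (x1 - x2 - phi1
    phi2)^c S21. This series inherits one direction of boundedness from each
    side, hence is a Laurent polynomial, which gives the numerator. With the
    delta function identity, the Jacobi identity then says that the product of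
    the iterate delta function with the difference between the cleared iterate
    and that numerator is zero. *)
Lemma jacobi3_rational S12 S21 S20 :
  bounded finite_neg_y S12 -> bounded finite_neg_x S21 -> bounded finite_neg_x S20 ->
  jacobi3 S12 S21 S20 ->
  exists g a b c,
  [/\ represents finite_neg_y S12 (g, den12 R L a b c),
      represents finite_neg_x S21 (g, den12 R L a b c) &
      represents finite_neg_x S20 (subst_x (x_add C L) g, den20 R L a b c)].
Proof.
move=> b12 b21 b20 J; have [N hN] := b20; pose c := (absz N).+1.
pose z := den (nseq c lin_sub : seq (superlinear C L)).
have commute : act z S12 = act z S21.
  have [E12 _] := series_mul_N1 (act z S12); have [_ E21] := series_mul_N1 (act z S21).
  have D12 := @d12_act_sub R L S12 (-1) c b12; have D21 := @d21_act_sub R L S21 (-1) c b21.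
  rewrite -E12 -E21 D12 D21; apply/funext => -[e1 e2]; apply/eqP; rewrite -subr_eq0.
  rewrite J; apply/eqP; apply: fsum_eq0 => -[d e].
  have [d0|d0] := ltP d 0.
    exact: (etrans (congr1 (fun x => x *: _) (@d20_eq0 e1 (d, e) d0)) (scale0r _)).
  have -> : S20 ((-1 - c%:Z, e2) - (d, e)) = 0 by apply: hN => /=; lia.
  exact: scaler0.
have bz : bounded finite_neg_y (act z S12) by exact: bounded_act_den.
have bz' : bounded finite_neg_x (act z S12) by rewrite commute; exact: bounded_act_den.
have [a [g hg]] := bounded_laurent bz bz'.
have r12 : represents finite_neg_y S12 (g, den12 R L a a c).
  by split; [exact: b12 | exact: den12_shift].
have r21 : represents finite_neg_x S21 (g, den12 R L a a c).
  by split; [exact: b21 | apply: den12_shift => p q; rewrite -hg commute].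
exists g, a, a, c; split; [exact: r12 | exact: r21 |].
split; [exact: b20 | move=> e].
pose T := act (den (den20 R L a a c)) S20.
pose T' := ss (subst_x (x_add C L) g).
have bT : bounded finite_neg_x T by exact: bounded_act_den.
have bT' : bounded finite_neg_x T' by exact: superpoly_series_bounded.
suff h0 : forall e, T e - T' e = 0.
  by apply/eqP; rewrite -subr_eq0; apply/eqP; exact: h0.
apply: d20_injective; first by apply: boundedU bT bT' => k -> ->; rewrite subr0.
move=> e0 e1 e2; have bd := d20_bounded R L e1.
have subr_mul : series_mul (d20 e1) (fun k => T k - T' k) (e0, e2) =
    series_mul (d20 e1) T (e0, e2) - series_mul (d20 e1) T' (e0, e2).
  rewrite /series_mul -fsumN -fsumD.
  - by apply: eq_fsbigr => k _; rewrite scalerBr.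
  - exact: (bounded_fsupp (e0, e2) bd bT).
  - by apply: fsuppS (bounded_fsupp (e0, e2) bd bT') => k ->; rewrite oppr0.
apply: (etrans subr_mul); apply/eqP; rewrite subr_eq0; apply/eqP.
have E20 := @d20_clear R L S20 e0 e1 e2 a a c b20.
have E12 := @d12_clear R L S12 e0 e1 e2 a a c b12.
have E21 := @d21_clear R L S21 e0 e1 e2 a a c b21.
apply: (etrans E20); apply: (etrans (esym (J _ _ _))).
have [_ /funext /= H12] := r12; have [_ /funext /= H21] := r21.
rewrite H12 in E12; rewrite H21 in E21.
exact: (sub_eq_transfer (esym E12) (esym E21) (erefl _) (delta_identity_poly g e0 e1 e2)).
Qed.

End JacobiTriple.

(** * The graded dual separates points *)

Lemma exists_linear (R : nzRingType) (V W : lmodType R) (f : V -> W) :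
  (forall a u v, f (a *: u + v) = a *: f u + f v) ->
  exists f' : {linear V -> W}, forall v, f' v = f v.
Proof.
move=> h.
by exists (HB.pack_for {linear V -> W} f (GRing.isLinear.Build R V W *:%R f h)).
Qed.

(** A module over the exterior algebra of a finite-dimensional space has enough
    linear forms: that algebra is a Frobenius algebra, so every scalar-valued
    linear form lifts to an algebra-valued one. *)
Section Frobenius.
Context (F : fieldType) (m : nat).
Local Notation A := (grassmann F (Some m)).
Local Notation K := {fset generator (Some m)}.
Implicit Types (S T U : K) (w : A).
Local Notation sg := (wedge_sign F).

Definition all_gens : K := [fset i | i in 'I_m]%fset.

Lemma in_all_gens i : i \in all_gens.
Proof. by apply/imfsetP; exists i. Qed.

Lemma all_gensP S : (S `<=` all_gens)%fset.
Proof. by apply/fsubsetP => i _; exact: in_all_gens. Qed.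

Local Notation "~~: S" := (all_gens `\` S)%fset (at level 35).

Lemma fdisjoint_compl T U : [disjoint T & U `\` T]%fset.
Proof. by apply/fdisjointP => i iT; rewrite in_fsetD iT. Qed.

Lemma fsetU_compl T U : (T `<=` U)%fset -> (T `|` U `\` T)%fset = U.
Proof.
move=> /fsubsetP sTU; apply/fsetP => i; rewrite !in_fsetE.
by case: (boolP (i \in T)) => //= /sTU ->.
Qed.

Lemma mcoeff_basisM x T w U :
  ((<< x *g T >> : A) * w)@_U =
  if (T `<=` U)%fset then x * w@_(U `\` T)%fset * sg T (U `\` T)%fset else 0.
Proof.
pose ph (w : A) := if (T `<=` U)%fset then x * w@_(U `\` T)%fset * sg T (U `\` T)%fset else 0.
rewrite -[RHS]/(ph w) [w]monalgE mulr_sumr raddf_sum /=.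
have phD : {morph ph : u v / u + v >-> u + v}.
  move=> u v; rewrite /ph; case: ifP => _; last by rewrite addr0.
  by rewrite (mcoeffD _ u v) mulrDr mulrDl.
have ph0 : ph 0 = 0 by rewrite /ph mcoeff0 mulr0 mul0r if_same.
rewrite (big_morph ph phD ph0); apply: eq_bigr => S _.
rewrite gmulU [LHS]mcoeffU /ph mcoeffU.
have [dTS|ndTS] := boolP [disjoint T & S]%fset; last first.
  rewrite {1}/wedge_sign (negbTE ndTS) mulr0 mul0rn; case: ifP => // sTU.
  case: eqP => [eS|_]; last by rewrite mulr0 mul0r.
  by case/negP: ndTS; rewrite eS; exact: fdisjoint_compl.
case: ifP => [sTU|nsTU].
  have -> : ((T `|` S)%fset == U) = (S == U `\` T)%fset.
    apply/eqP/eqP => [<-|->]; last exact: fsetU_compl.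
    apply/fsetP => i; rewrite !in_fsetE; case: (boolP (i \in T)) => //= iT.
    by apply/negP => iS; move/fdisjointP: dTS => /(_ _ iT); rewrite iS.
  by case: eqP => [->|_]; rewrite ?mulr1n ?mulr0n ?mulr0 ?mul0r.
case: eqP => [eU|_]; last by rewrite mulr0n.
by rewrite -eU fsubsetUl in nsTU.
Qed.

Lemma wedge_sign_sq S T : [disjoint S & T]%fset -> sg S T * sg S T = 1.
Proof. by move=> d; rewrite /wedge_sign d -expr2 sqrr_sign. Qed.

Context (V : lmodType A) (lam : V -> F).
Hypothesis lamD : forall u v, lam (u + v) = lam u + lam v.
Hypothesis lamZ : forall x v, lam (x%:A *: v) = x * lam v.

(** The coefficient of e_S in w is, up to a sign, the coefficient of the product
    of all generators in e_T w, where T is the complement of S. Here [lam] takes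
    the place of that last coefficient. *)
Definition lift_form (v : V) : A :=
  [malg S in fpowerset all_gens => sg (~~: S) S * lam ((<< ~~: S >> : A) *: v)].

Lemma mcoeff_lift_form v S :
  (lift_form v)@_S = sg (~~: S) S * lam ((<< ~~: S >> : A) *: v).
Proof. by rewrite mcoeffE fpowersetE all_gensP. Qed.

Lemma lift_formD u v : lift_form (u + v) = lift_form u + lift_form v.
Proof.
apply/malgP => S; rewrite [RHS](mcoeffD S (lift_form u)) !mcoeff_lift_form.
by rewrite scalerDr lamD mulrDr.
Qed.

Lemma lam_basis x S v : lam ((<< x *g S >> : A) *: v) = x * lam ((<< S >> : A) *: v).
Proof.
rewrite -lamZ scalerA; congr (lam (_ *: _)).
by rewrite mulr_algl gscaleU mulr1.
Qed.

Lemma lift_form_basis x T v :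
  lift_form ((<< x *g T >> : A) *: v) = (<< x *g T >> : A) * lift_form v.
Proof.
apply/malgP => U; rewrite mcoeff_basisM !mcoeff_lift_form scalerA gmulU lam_basis mul1r.
case: ifP => [sTU|/negbT nsTU]; last first.
  rewrite {2}/wedge_sign ifF ?mulr0 ?mul0r ?mulr0 //; apply: contraNF nsTU => /fdisjointP d.
  apply/fsubsetP => i iT; apply: contraT => niU.
  have : i \notin T by apply: d; rewrite in_fsetD niU in_all_gens.
  by rewrite iT.
set S := (U `\` T)%fset; have UE : U = (T `|` S)%fset by rewrite fsetU_compl.
have SE : (~~: S = ~~: U `|` T)%fset.
  apply/fsetP => i; rewrite in_fsetU !in_fsetD !in_all_gens !andbT negb_and negbK.
  by case: (boolP (i \in T)) => [/(fsubsetP sTU)->|]; rewrite ?orbT ?orbF.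
have dTS : [disjoint T & S]%fset by exact: fdisjoint_compl.
have dUT : [disjoint ~~: U & T]%fset.
  by apply/fdisjointP => i; rewrite in_fsetD => /andP[niU _]; apply: contra niU; apply/fsubsetP.
have dUU : [disjoint ~~: U & U]%fset by apply/fdisjointP => i; rewrite in_fsetD => /andP[].
have dSS : [disjoint ~~: S & S]%fset by apply/fdisjointP => i; rewrite in_fsetD => /andP[].
have := wedge_signA F (~~: U) T S; rewrite -UE -SE.
have := wedge_sign_sq dTS; have := wedge_sign_sq dUT.
have := wedge_sign_sq dUU; have := wedge_sign_sq dSS.
move: (lam _) (sg _ _) (sg _ _) (sg _ _) (sg _ _) => l a b c d ha hb hc hd h.
have e : c * b = d * a.
  rewrite -[LHS]mul1r -hd (_ : a * a * (c * b) = (a * c) * (a * b)); last by ring.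
  by rewrite h (_ : b * d * (a * b) = (b * b) * (d * a)); [rewrite hc mul1r | ring].
by rewrite (_ : c * (x * b * l) = x * l * (c * b)); [rewrite e; ring | ring].
Qed.

Lemma lift_formZ w v : lift_form (w *: v) = w * lift_form v.
Proof.
rewrite [w in LHS]monalgE [w in RHS]monalgE scaler_suml mulr_suml.
have l0 : lift_form 0 = 0.
  by apply: (addrI (lift_form 0)); rewrite -lift_formD !addr0.
by rewrite (big_morph lift_form lift_formD l0); apply: eq_bigr => S _; exact: lift_form_basis.
Qed.

(** The coefficient of the product of all generators in [lift_form v] is [lam v]. *)
Lemma lift_form_eq0 v : lift_form v = 0 -> lam v = 0.
Proof.
move=> /(congr1 (fun w : A => w@_all_gens)); rewrite mcoeff_lift_form mcoeff0 fsetDv.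
have e1 : (<< fset0 >> : A) = 1 by [].
by rewrite wedge_sign0l mul1r e1 scale1r.
Qed.

End Frobenius.

Section ScaleC.
Context (R : realType) (L : option nat) (V : lmodType (grassmann R[i] L)).
Implicit Types (x y : R[i]) (v : V).

Lemma scaleCA x y v : scaleC x (scaleC y v) = scaleC (x * y) v.
Proof. exact: (etrans (scalerA _ _ _) (congr1 (fun a => a *: v) (alg_mul _ _ _))). Qed.

Lemma scaleCD x y v : scaleC (x + y) v = scaleC x v + scaleC y v.
Proof. by rewrite /scaleC !scalerDl. Qed.

Lemma scaleCN x v : scaleC (- x) v = - scaleC x v.
Proof. by rewrite /scaleC !scaleNr. Qed.

Lemma scaleC0 v : scaleC 0 v = 0.
Proof. by rewrite /scaleC !scale0r. Qed.

Lemma scaleC0r x : scaleC x (0 : V) = 0.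
Proof. exact: scaler0. Qed.

Lemma scaleC1 v : scaleC 1 v = v.
Proof. by rewrite /scaleC !scale1r. Qed.

Lemma scaleCDr x u v : scaleC x (u + v) = scaleC x u + scaleC x v.
Proof. exact: scalerDr. Qed.

End ScaleC.

Section GradedDual.
Context (R : realType) (L : option nat).
Local Notation C := R[i].
Local Notation A := (grassmann C L).
Context (V : lmodType A) (D : vosa_data V).
Hypothesis gD : graded_module D.
Implicit Types (u v : V).

Let wD := weight_decomposition gD.

Lemma weight_comp0 k : weight_comp D k 0 = 0.
Proof. by apply: (addrI (weight_comp D k 0)); rewrite -(direct_sumD wD) !addr0. Qed.

Lemma has_weight_comp k v : has_weight D k (weight_comp D k v).
Proof. by rewrite /has_weight (direct_sumK wD) eqxx. Qed.

Lemma weight_comp_neq k j v : k != j -> has_weight D j v -> weight_comp D k v = 0.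
Proof. by move=> kj <-; rewrite (direct_sumK wD) (negbTE kj). Qed.

Lemma weight_comp_eq0 v : (forall k, weight_comp D k v = 0) -> v = 0.
Proof. by move=> h; rewrite -(direct_sumE wD v) fsbig1. Qed.

(** Extension by zero to the other weight spaces. *)
Lemma graded_dual_of_form k (f : V -> A) :
  (forall a u v, f (a *: u + v) = a * f u + f v) ->
  exists v' : {linear V -> A^o}, in_graded_dual D v' /\ forall v, v' v = f (weight_comp D k v).
Proof.
move=> lf.
have [v' hv'] := @exists_linear A V A^o (fun v => f (weight_comp D k v))
  (fun a u v => etrans (congr1 f (etrans (direct_sumD wD k _ _)
    (congr1 (fun x => x + _) (weight_compZ gD k a u)))) (lf a _ _)).
exists v'; split=> //; apply: (@sub_finite_set _ _ [set k]); last exact: finite_set1.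
move=> j /= [v [jv]]; rewrite hv'; case: (eqVneq j k) => // jk; case.
have kj : k != j by rewrite eq_sym.
rewrite (weight_comp_neq kj jv).
have e := lf 1 0 0; rewrite scaler0 addr0 mul1r in e.
by apply: (addrI (f 0)); rewrite -e addr0.
Qed.

(** A spanning family of minimal size is linearly independent over C. *)
Lemma weight_basis k :
  (exists n (b : 'I_n -> V), (forall i, has_weight D k (b i)) /\
     forall v, has_weight D k v -> exists c : 'I_n -> C, v = \sum_i scaleC (c i) (b i)) ->
  exists n (b : 'I_n -> V),
    (forall v, has_weight D k v -> exists c : 'I_n -> C, v = \sum_i scaleC (c i) (b i)) /\
    (forall c : 'I_n -> C, \sum_i scaleC (c i) (b i) = 0 -> forall i, c i = 0).
Proof.
case=> n [b [bk span]].
have exP : exists n, `[< exists b : 'I_n -> V, (forall i, has_weight D k (b i)) /\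
    forall v, has_weight D k v -> exists c : 'I_n -> C, v = \sum_i scaleC (c i) (b i) >].
  by exists n; apply/asboolP; exists b.
case: (ex_minnP exP) => {b bk span n exP} n /asboolP[b [bk span]] minn.
exists n, b; split=> // c c0 i; apply/eqP; apply: contraT => ci0.
case: n i b bk span minn c c0 ci0 => [[]//|n] i b bk span minn c c0 ci0.
suff /asboolP/minn : exists b' : 'I_n -> V, (forall j, has_weight D k (b' j)) /\
    forall v, has_weight D k v -> exists c : 'I_n -> C, v = \sum_j scaleC (c j) (b' j).
  by rewrite ltnn.
exists (fun j => b (lift i j)); split=> [j|v /span[d ->]]; first exact: bk.
exists (fun j => d (lift i j) - d i * (c i)^-1 * c (lift i j)).
rewrite (bigD1_ord i) //= in c0; rewrite (bigD1_ord i) //=.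
have -> : scaleC (d i) (b i) = scaleC (d i * (c i)^-1) (scaleC (c i) (b i)).
  by rewrite scaleCA mulfVK.
move/eqP: c0; rewrite addr_eq0 => /eqP ->.
have -> : scaleC (d i / c i) (- (\sum_(j < n) scaleC (c (lift i j)) (b (lift i j)))) =
    \sum_(j < n) scaleC (- (d i / c i * c (lift i j))) (b (lift i j)).
  rewrite {1}/scaleC scalerN scaler_sumr -sumrN; apply: eq_bigr => j _.
  by rewrite -/(scaleC _ _) scaleCA scaleCN.
by rewrite addrC -big_split; apply: eq_bigr => j _; exact: esym (scaleCD _ _ _).
Qed.

End GradedDual.

Section Separation.
Context (R : realType).
Local Notation C := R[i].

(** Coordinates in a C-basis of a weight space are C-linear forms, and their lifts
    to algebra-valued forms do not vanish where they do not. *)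
Lemma graded_dual_separates_finite (m : nat) (V : lmodType (grassmann C (Some m))) (D : vosa_data V)
    (gD : graded_module D) v :
  (forall v' : {linear V -> (grassmann C (Some m))^o}, in_graded_dual D v' -> v' v = 0) ->
  v = 0.
Proof.
move=> h; apply: (weight_comp_eq0 gD) => k.
have [n [b [span free]]] := weight_basis (weight_finite_dim gD k).
have [c hc] : {c : V -> 'I_n -> C & forall u, weight_comp D k u = \sum_i scaleC (c u i) (b i)}.
  apply: (@choice V ('I_n -> C) (fun u c => weight_comp D k u = \sum_i scaleC (c i) (b i))).
  by move=> u; apply: span; exact: has_weight_comp.
have uniq c1 c2 : \sum_i scaleC (c1 i) (b i) = \sum_i scaleC (c2 i) (b i) -> c1 =1 c2.
  move=> /eqP; rewrite -subr_eq0 => /eqP e i; apply/eqP; rewrite -subr_eq0; apply/eqP.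
  apply: (free (fun i => c1 i - c2 i)) i; rewrite -[RHS]e -sumrN -big_split.
  by apply: eq_bigr => i _; rewrite scaleCD scaleCN.
have wD := weight_decomposition gD.
have cD i u u' : c (u + u') i = c u i + c u' i.
  apply: (uniq (c (u + u')) (fun i => c u i + c u' i)); apply: (etrans (esym (hc _))).
  apply: (etrans (direct_sumD wD _ _ _)); apply: (etrans (congr2 +%R (hc _) (hc _))).
  rewrite -big_split; apply: eq_bigr => j _; exact: esym (scaleCD _ _ _).
have cZ i x u : c (x%:A *: u) i = x * c u i.
  apply: (uniq (c (x%:A *: u)) (fun i => x * c u i)); apply: (etrans (esym (hc _))).
  apply: (etrans (weight_compZ gD _ _ _)); apply: (etrans (congr1 _ (hc _))).
  by rewrite scaler_sumr; apply: eq_bigr => j _; exact: scaleCA.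
rewrite hc; apply: big1 => i _.
have [v' [dv' hv']] := graded_dual_of_form gD k
  (f := lift_form (fun u => c u i)) (fun a u u' => etrans (lift_formD (cD i) _ _)
    (congr1 (fun x => x + _) (lift_formZ (cD i) (cZ i) a u))).
have := h v' dv'; rewrite hv' => /lift_form_eq0.
have -> : c (weight_comp D k v) i = c v i.
  apply: uniq; apply: (etrans (esym (hc _))); apply: (etrans _ (hc _)).
  by rewrite (direct_sumK wD) eqxx.
by move=> ->; rewrite scaleC0.
Qed.

(** Weight spaces are free over the exterior algebra, so that coordinates are
    themselves linear forms. *)
Lemma graded_dual_separates_infinite (V : lmodType (grassmann C None)) (D : vosa_data V)
    (gD : graded_module D) v :
  (forall v' : {linear V -> (grassmann C None)^o}, in_graded_dual D v' -> v' v = 0) -> v = 0.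
Proof.
move=> h; apply: (weight_comp_eq0 gD) => k.
have [n [b [_ free]]] := weight_finite_dim gD k.
have [c hc] : {c : V -> {ffun 'I_n -> grassmann C None} &
    forall u, weight_comp D k u = \sum_i c u i *: b i}.
  apply: (@choice V {ffun 'I_n -> grassmann C None}
    (fun u (c : {ffun 'I_n -> grassmann C None}) => weight_comp D k u = \sum_i c i *: b i)).
  by move=> u; have [c [hc _]] := free _ (has_weight_comp gD k u); exists c.
have wD := weight_decomposition gD.
have uniq u (c' : 'I_n -> grassmann C None) :
    weight_comp D k u = \sum_i c' i *: b i -> c u =1 c'.
  move=> e i; have [d [_ ud]] := free _ (has_weight_comp gD k u).
  rewrite -(ud _ (hc u)) (ud [ffun i => c' i]) ?ffunE // e.
  by apply: eq_bigr => j _; rewrite ffunE.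
have cL i a u u' : c (a *: u + u') i = a * c u i + c u' i.
  apply: (uniq _ (fun i => a * c u i + c u' i)).
  rewrite (direct_sumD wD) (weight_compZ gD) !hc scaler_sumr -big_split.
  by apply: eq_bigr => j _; rewrite scalerA scalerDl.
rewrite hc; apply: big1 => i _.
have [v' [dv' hv']] := graded_dual_of_form gD k (f := fun u => c u i) (cL i).
have := h v' dv'; rewrite hv'.
have -> : c (weight_comp D k v) i = c v i.
  apply: uniq; apply: (etrans _ (hc _)).
  by rewrite (direct_sumK wD) eqxx.
by move=> ->; rewrite scale0r.
Qed.

Lemma graded_dual_separates (L : option nat) (V : lmodType (grassmann C L)) (D : vosa_data V)
    (gD : graded_module D) v :
  (forall v' : {linear V -> (grassmann C L)^o}, in_graded_dual D v' -> v' v = 0) -> v = 0.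
Proof.
by case: L V D gD v => [m|] V D gD v; [exact: graded_dual_separates_finite | exact: graded_dual_separates_infinite].
Qed.

End Separation.

(** * Pairing the Jacobi identity with linear forms *)

Section OddMap.
Context (R : nzRingType) (s : {rmorphism R -> R}) (M : lmodType R).

Definition map_phi (f : M -> R) (X : oddmod2 s M) : oddext2 s :=
  mk_phi (f (coef_phi false false X)) (f (coef_phi false true X))
         (f (coef_phi true false X)) (f (coef_phi true true X)).

Variable f : M -> R.
Hypothesis fD : forall x y, f (x + y) = f x + f y.
Hypothesis fZ : forall a x, f (a *: x) = a * f x.

Lemma map_phiD X Y : map_phi f (X + Y) = map_phi f X + map_phi f Y.
Proof.
case: X Y => -[x00 x01] [x10 x11] [[y00 y01] [y10 y11]].
by congr ((_, _), (_, _)); rewrite /= fD.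
Qed.

Lemma map_phiZ b X : map_phi f (b *: X) = b * map_phi f X.
Proof.
case: b X => -[b00 b01] [b10 b11] [[x00 x01] [x10 x11]].
by congr ((_, _), (_, _)); rewrite /= ?fD ?fZ.
Qed.

Lemma map_phi0 : map_phi f 0 = 0.
Proof. by apply: (addrI (map_phi f 0)); rewrite -map_phiD !addr0. Qed.

End OddMap.

Section JacobiPairing.
Context (R : realType) (L : option nat).
Local Notation C := R[i].
Local Notation A := (grassmann C L).
Local Notation B := (grassmann_phi C L).
Context (V : lmodType A).
Local Notation Vphi := (oddpoly V).

Lemma fsum_slice (M : zmodType) (h : int * int -> int * int * int) (G : int * int * int -> M) :
  injective h -> (forall d, ~ (exists k, d = h k) -> G d = 0) ->
  \sum_(d \in setT) G d = \sum_(k \in setT) G (h k).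
Proof.
move=> hI G0; rewrite -(@fsbig_image _ _ _ _ _ setT h G) => [|x y _ _ /hI //].
apply/esym/fsbig_widen => // d [_ nd] /=; apply: G0 => -[k dk]; apply: nd.
by exists k.
Qed.

Lemma series_mul_x1x2 (f : int * int * int -> B) (S : int * int -> Vphi) e0 e1 e2 :
  series_mul f (in_x1x2 S) (e0, e1, e2) = series_mul (fun d => f (e0, d.1, d.2)) S (e1, e2).
Proof.
rewrite /series_mul (fsum_slice (h := fun k => (e0, k.1, k.2))).
- by apply: eq_fsbigr => -[d1 d2] _; rewrite /in_x1x2 /= subrr eqxx.
- by move=> [a b] [c d] [-> ->].
- move=> [[d0 d1] d2] nd; rewrite /in_x1x2 /=; case: eqP => [/subr0_eq ed|_].
    by case: nd; exists (d1, d2); rewrite ed.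
  by rewrite scaler0.
Qed.

Lemma series_mul_x0x2 (f : int * int * int -> B) (S : int * int -> Vphi) e0 e1 e2 :
  series_mul f (in_x0x2 S) (e0, e1, e2) = series_mul (fun d => f (d.1, e1, d.2)) S (e0, e2).
Proof.
rewrite /series_mul (fsum_slice (h := fun k => (k.1, e1, k.2))).
- by apply: eq_fsbigr => -[d1 d2] _; rewrite /in_x0x2 /= subrr eqxx.
- by move=> [a b] [c d] [-> ->].
- move=> [[d0 d1] d2] nd; rewrite /in_x0x2 /=; case: eqP => [/subr0_eq ed|_].
    by case: nd; exists (d0, d2); rewrite ed.
  by rewrite scaler0.
Qed.

Definition signed (M : lmodType B) (k : bool) (S : int * int -> M) : int * int -> M :=
  fun e => (-1) ^+ k *: S e.

Lemma series_mul_signed (M : lmodType B) k (f : int * int -> B) (S : int * int -> M) e :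
  series_mul f (signed k S) e = (-1) ^+ k *: series_mul f S e.
Proof.
case: k; rewrite /series_mul.
  rewrite expr1 scaleN1r -fsumN; apply: eq_fsbigr => d _.
  by rewrite /signed expr1 scaleN1r scalerN.
rewrite expr0 scale1r; apply: eq_fsbigr => d _.
by rewrite /signed expr0 scale1r.
Qed.

Lemma jacobi_identityE (D : vosa_data V) :
  jacobi_identity D <-> forall s t u v w, has_sign D s u -> has_sign D t v ->
    jacobi3 (Yprod12 D u v w) (signed (s && t) (Yprod21 D u v w)) (Yiter D u v w).
Proof.
have E12 u v w e0 e1 e2 := series_mul_x1x2 (delta_prod12 R L) (Yprod12 D u v w) e0 e1 e2.
have E20 u v w e0 e1 e2 := series_mul_x0x2 (delta_iter R L) (Yiter D u v w) e0 e1 e2.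
have E21 k u v w e0 e1 e2 := etrans (series_mul_signed k (d21 R L e0) (Yprod21 D u v w) (e1, e2))
  (congr1 (fun x => (-1) ^+ k *: x)
    (esym (series_mul_x1x2 (delta_prod21 R L) (Yprod21 D u v w) e0 e1 e2))).
split=> J s t u v w.
  move=> su tv e0 e1 e2; have := J s t u v w (e0, e1, e2) su tv.
  exact: (sub_eq_transfer (esym (E12 _ _ _ _ _ _)) (E21 _ _ _ _ _ _ _) (esym (E20 _ _ _ _ _ _))).
move=> [[e0 e1] e2] su tv; have := J s t u v w su tv e0 e1 e2.
exact: (sub_eq_transfer (E12 _ _ _ _ _ _) (esym (E21 _ _ _ _ _ _ _)) (E20 _ _ _ _ _ _)).
Qed.

(** Truncation from below suffices for the products with delta functions to be
    finite sums, before any linear form is applied. *)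
Lemma d12_fsupp (M : lmodType B) (S : int * int -> M) N e0 e :
  (forall e, e.2 < N -> S e = 0) -> fsupp (fun d => d12 R L e0 d *: S (e - d)).
Proof.
move=> SN; pose K := (absz e0 + absz N + absz e.1 + absz e.2 + 2)%N%:Z.
apply: (@finite_box (- K) K (- K) K) => d /= h; apply: contrapT => out; apply: h.
have [lt_e|le_e] := ltP (e - d).2 N; first by rewrite SN ?scaler0.
rewrite d12_powE !pow_sub_eq0 ?mulr0 ?oppr0 ?scal20 ?scale0r //.
  by apply/negP => h; apply: out; move: le_e h; rewrite /K /=; lia.
by apply/negP => h; apply: out; move: le_e h; rewrite /K /=; lia.
Qed.

Lemma d21_fsupp (M : lmodType B) (S : int * int -> M) N e0 e :
  (forall e, e.1 < N -> S e = 0) -> fsupp (fun d => d21 R L e0 d *: S (e - d)).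
Proof.
move=> SN; pose K := (absz e0 + absz N + absz e.1 + absz e.2 + 2)%N%:Z.
apply: (@finite_box (- K) K (- K) K) => d /= h; apply: contrapT => out; apply: h.
have [lt_e|le_e] := ltP (e - d).1 N; first by rewrite SN ?scaler0.
rewrite d21_powE !pow_sub_eq0 ?mulr0 ?oppr0 ?scal20 ?scale0r //.
  by apply/negP => h; apply: out; move: le_e h; rewrite /K /=; lia.
by apply/negP => h; apply: out; move: le_e h; rewrite /K /=; lia.
Qed.

Lemma d20_fsupp (M : lmodType B) (S : int * int -> M) N e1 e :
  (forall e, e.1 < N -> S e = 0) -> fsupp (fun d => d20 R L e1 d *: S (e - d)).
Proof.
move=> SN; pose K := (absz e1 + absz N + absz e.1 + absz e.2 + 2)%N%:Z.
apply: (@finite_box (- K) K (- K) K) => d /= h; apply: contrapT => out; apply: h.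
have [lt_e|le_e] := ltP (e - d).1 N; first by rewrite SN ?scaler0.
rewrite d20_powE !pow_sub_eq0 ?mulr0 ?oppr0 ?scal20 ?scale0r //.
  by apply/negP => h; apply: out; move: le_e h; rewrite /K /=; lia.
by apply/negP => h; apply: out; move: le_e h; rewrite /K /=; lia.
Qed.

Section Pairing.
Variable (f : V -> A).
Hypothesis fD : forall x y, f (x + y) = f x + f y.
Hypothesis fZ : forall a x, f (a *: x) = a * f x.

Definition vpair (X : Vphi) : B := map_phi f X.

Lemma vpairD X Y : vpair (X + Y) = vpair X + vpair Y.
Proof. exact: map_phiD. Qed.

Lemma vpairZ (b : B) X : vpair (b *: X) = b * vpair X.
Proof. exact: map_phiZ. Qed.

Lemma vpair0 : vpair 0 = 0.
Proof. exact: map_phi0. Qed.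

Lemma vpairN X : vpair (- X) = - vpair X.
Proof. by apply/eqP; rewrite -addr_eq0 -vpairD addNr vpair0. Qed.

Lemma vpair_series_mul (g : int * int -> B) (S : int * int -> Vphi) e :
  fsupp (fun d => g d *: S (e - d)) ->
  vpair (series_mul g S e) = series_mul g ((fun e => vpair (S e)) : int * int -> B^o) e.
Proof.
move=> fs; rewrite /series_mul (fsum_additive vpair0 vpairD fs).
by apply: eq_fsbigr => d _; rewrite vpairZ.
Qed.

Definition pair_series (S : int * int -> Vphi) : int * int -> B^o := fun e => vpair (S e).

Section Truncated.
Context (S12 S21 S20 : int * int -> Vphi) (N : int).
Hypothesis tr12 : forall e, e.2 < N -> S12 e = 0.
Hypothesis tr21 : forall e, e.1 < N -> S21 e = 0.
Hypothesis tr20 : forall e, e.1 < N -> S20 e = 0.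

Definition jacobi_defect e0 e1 e2 : Vphi :=
  series_mul (d12 R L e0) S12 (e1, e2) - series_mul (d21 R L e0) S21 (e1, e2)
  - series_mul (d20 R L e1) S20 (e0, e2).

Lemma vpair_jacobi_defect e0 e1 e2 : vpair (jacobi_defect e0 e1 e2) =
  series_mul (d12 R L e0) (pair_series S12) (e1, e2)
  - series_mul (d21 R L e0) (pair_series S21) (e1, e2)
  - series_mul (d20 R L e1) (pair_series S20) (e0, e2).
Proof.
apply: (etrans (vpairD _ _)); apply: (congr2 +%R); last first.
  apply: (etrans (vpairN _)); congr (- _).
  exact: (vpair_series_mul (d20_fsupp e1 (e0, e2) tr20)).
apply: (etrans (vpairD _ _)); apply: (congr2 +%R).
  exact: (vpair_series_mul (d12_fsupp e0 (e1, e2) tr12)).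
apply: (etrans (vpairN _)); congr (- _).
exact: (vpair_series_mul (d21_fsupp e0 (e1, e2) tr21)).
Qed.

Lemma jacobi3_pairing : jacobi3 S12 S21 S20 ->
  jacobi3 (pair_series S12) (pair_series S21) (pair_series S20).
Proof.
move=> J e0 e1 e2; apply/eqP; rewrite -subr_eq0; apply/eqP.
apply: (etrans (esym (vpair_jacobi_defect e0 e1 e2))).
have -> : jacobi_defect e0 e1 e2 = 0.
  by rewrite /jacobi_defect J subrr.
exact: vpair0.
Qed.

End Truncated.
End Pairing.

(** Linear forms commute with the finite sums that make up the coefficients of the
    Jacobi identity, and together they separate points. *)
Lemma jacobi3_of_pairings (D : vosa_data V) (gD : graded_module D)
    (S12 S21 S20 : int * int -> Vphi) (N : int) :
  (forall e, e.2 < N -> S12 e = 0) -> (forall e, e.1 < N -> S21 e = 0) ->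
  (forall e, e.1 < N -> S20 e = 0) ->
  (forall v' : {linear V -> A^o}, in_graded_dual D v' ->
    jacobi3 (pair_series v' S12) (pair_series v' S21) (pair_series v' S20)) ->
  jacobi3 S12 S21 S20.
Proof.
move=> tr12 tr21 tr20 J e0 e1 e2; apply/eqP; rewrite -subr_eq0; apply/eqP.
rewrite -/(jacobi_defect S12 S21 S20 e0 e1 e2).
have pair0 (v' : {linear V -> A^o}) : in_graded_dual D v' ->
    vpair v' (jacobi_defect S12 S21 S20 e0 e1 e2) = 0.
  move=> dv'; apply: (etrans (vpair_jacobi_defect (linearD v') (linearZ_LR v') tr12 tr21 tr20 e0 e1 e2)).
  by rewrite J // subrr.
move: (jacobi_defect _ _ _ _ _ _) pair0 => -[[x00 x01] [x10 x11]] pair0.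
have sep x : (forall v' : {linear V -> A^o}, in_graded_dual D v' -> v' x = 0) -> x = 0.
  exact: (graded_dual_separates gD).
congr ((_, _), (_, _)); apply: sep => v' /pair0 [] //.
Qed.

End JacobiPairing.

(** * Additivity of the vertex operators *)

Section Operators.
Context (R : realType) (L : option nat).
Local Notation C := R[i].
Local Notation A := (grassmann C L).
Local Notation B := (grassmann_phi C L).
Context (V : lmodType A) (D : vosa_data V).
Local Notation Vphi := (oddpoly V).
Hypothesis hV : vosa_except_jacobi D.
Implicit Types (u v w x y : V) (X Y : Vphi) (psi : B).

Let gD := vosa_graded hV.
Let lD := vosa_linear hV.
Local Notation Yc := (Ycoef D).
Local Notation sc := (sign_comp D).

Lemma additive0 (W W' : zmodType) (f : W -> W') :
  (forall a b, f (a + b) = f a + f b) -> f 0 = 0.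
Proof. by move=> fD; apply: (addrI (f 0)); rewrite -fD !addr0. Qed.

Lemma sum4_split (W : zmodType) (a b c d a' b' c' d' : W) :
  a + a' + (b + b') + (c + c') + (d + d') = a + b + c + d + (a' + b' + c' + d').
Proof. by rewrite (addrACA a) (addrACA (a + b)) (addrACA (a + b + c)). Qed.

Lemma sum_bool2 (W : zmodType) (f : bool -> bool -> W) :
  f false false + f false true + (f true false + f true true) =
  \sum_(s : bool) \sum_(t : bool) f s t.
Proof.
by rewrite !big_bool /= addrC (addrC (f true false)) (addrC (f false false)).
Qed.

Lemma YcoefDl u v a i w : Yc (u + v) a i w = Yc u a i w + Yc v a i w.
Proof. exact: modeDl lD _ _ _ _. Qed.

Lemma YcoefDr u a i v w : Yc u a i (v + w) = Yc u a i v + Yc u a i w.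
Proof. exact: modeDr lD _ _ _ _. Qed.

Lemma Ycoef0l a i w : Yc 0 a i w = 0.
Proof. by apply: (additive0 (f := fun u => Yc u a i w)) => x y; exact: YcoefDl. Qed.

Lemma Ycoef0r u a i : Yc u a i 0 = 0.
Proof. by apply: (additive0 (f := Yc u a i)) => x y; exact: YcoefDr. Qed.

Lemma sign_compD s u v : sc s (u + v) = sc s u + sc s v.
Proof. exact: direct_sumD (sign_decomposition gD) _ _ _. Qed.

Lemma has_sign_comp s u : has_sign D s (sc s u).
Proof. by rewrite /has_sign (direct_sumK (sign_decomposition gD)) eqxx. Qed.

Lemma sign_comp_neq s t u : s != t -> has_sign D t u -> sc s u = 0.
Proof. by move=> st <-; rewrite (direct_sumK (sign_decomposition gD)) (negbTE st). Qed.

Lemma sign_compE u : u = sc false u + sc true u.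
Proof.
rewrite -[LHS](direct_sumE (sign_decomposition gD) u).
rewrite (@fsum_seq _ _ _ [fset false; true]%fset) => [|[] _]; last 2 first.
- by rewrite !inE.
- by rewrite !inE.
by rewrite big_fsetU1 ?inE //= big_seq_fset1.
Qed.

Lemma extend_opD p f X Y : (forall x y, f (x + y) = f x + f y) ->
  extend_op p f (X + Y) = extend_op p f X + extend_op p f Y :> Vphi.
Proof.
move=> fD; case: X Y => -[x00 x01] [x10 x11] [[y00 y01] [y10 y11]].
by congr ((_, _), (_, _)); rewrite /= fD ?scalerDr.
Qed.

Lemma extend_op_add p f g X :
  extend_op p (fun x => f x + g x) X = extend_op p f X + extend_op p g X :> Vphi.
Proof.
case: X => -[x00 x01] [x10 x11].
by congr ((_, _), (_, _)); rewrite /= ?scalerDr.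
Qed.

Lemma extend_op_eq0 p f X : (forall b c, f (coef_phi b c X) = 0) -> extend_op p f X = 0 :> Vphi.
Proof.
move=> f0; rewrite /extend_op !f0 !scaler0 //.
Qed.

Lemma YapplyDl psi u v i X :
  Yapply D psi (u + v) i X = Yapply D psi u i X + Yapply D psi v i X.
Proof.
rewrite /Yapply -big_split; apply: eq_bigr => s _.
have E p a : extend_op p (Yc (sc s (u + v)) a i) X =
    extend_op p (Yc (sc s u) a i) X + extend_op p (Yc (sc s v) a i) X.
  rewrite -extend_op_add; congr (extend_op _ _ _); apply/funext => x.
  by rewrite sign_compD YcoefDl.
by rewrite !E scalerDr addrACA.
Qed.

Lemma YapplyDr psi u i X Y :
  Yapply D psi u i (X + Y) = Yapply D psi u i X + Yapply D psi u i Y.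
Proof.
rewrite /Yapply -big_split; apply: eq_bigr => s _.
have fD t a x y : Yc (sc t u) a i (x + y) = Yc (sc t u) a i x + Yc (sc t u) a i y.
  exact: YcoefDr.
by rewrite !extend_opD // scalerDr addrACA.
Qed.

Lemma Yapply_eq0 psi u i X :
  (forall s a b c, Yc (sc s u) a i (coef_phi b c X) = 0) -> Yapply D psi u i X = 0.
Proof.
move=> h; rewrite /Yapply big1 // => s _.
by rewrite !extend_op_eq0 ?scaler0 ?addr0.
Qed.

Lemma Yapply0r psi u i : Yapply D psi u i 0 = 0.
Proof. by apply: Yapply_eq0 => s a b c; case: b; case: c; exact: Ycoef0r. Qed.

Lemma YextendDl psi X Y i w :
  Yextend D psi (X + Y) i w = Yextend D psi X i w + Yextend D psi Y i w.
Proof.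
case: X Y => -[x00 x01] [x10 x11] [[y00 y01] [y10 y11]].
by rewrite /Yextend /= !YapplyDl !scalerDr sum4_split.
Qed.

Lemma Yextend0 psi i w : Yextend D psi 0 i w = 0.
Proof. by apply: (additive0 (f := fun X => Yextend D psi X i w)) => X Y; exact: YextendDl. Qed.

Lemma Yprod12_signs u v w e : Yprod12 D u v w e =
  \sum_(s : bool) \sum_(t : bool) Yprod12 D (sc s u) (sc t v) w e.
Proof.
apply: (etrans _ (sum_bool2 (fun s t => Yprod12 D (sc s u) (sc t v) w e))).
apply: (etrans (congr1 (fun z => Yprod12 D z v w e) (sign_compE u))).
apply: (etrans (YapplyDl _ _ _ _ _)).
have E z := etrans (congr1 (fun z' => Yprod12 D z z' w e) (sign_compE v))
  (etrans (congr1 (Yapply D phi1 z e.1) (YapplyDl _ _ _ _ _)) (YapplyDr _ _ _ _ _)).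
exact: (congr2 +%R (E _) (E _)).
Qed.

Lemma const_oddpolyD x y : const_oddpoly (x + y) = const_oddpoly x + const_oddpoly y :> Vphi.
Proof. by congr ((_, _), (_, _)); rewrite /= addr0. Qed.

Lemma YiterDl u u' v w e : Yiter D (u + u') v w e = Yiter D u v w e + Yiter D u' v w e.
Proof. by rewrite /Yiter YapplyDl YextendDl. Qed.

Lemma YiterDr u v v' w e : Yiter D u (v + v') w e = Yiter D u v w e + Yiter D u v' w e.
Proof.
have E := etrans (congr1 (Yapply D (phi1 - phi2) u e.1) (const_oddpolyD v v'))
  (YapplyDr (phi1 - phi2) u e.1 (const_oddpoly v) (const_oddpoly v')).
exact: (etrans (congr1 (fun X => Yextend D phi2 X e.2 w) E) (YextendDl _ _ _ _ _)).
Qed.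

Lemma Yiter_signs u v w e : Yiter D u v w e =
  \sum_(s : bool) \sum_(t : bool) Yiter D (sc s u) (sc t v) w e.
Proof.
apply: (etrans _ (sum_bool2 (fun s t => Yiter D (sc s u) (sc t v) w e))).
apply: (etrans (congr1 (fun z => Yiter D z v w e) (sign_compE u))).
apply: (etrans (YiterDl _ _ _ _ _)).
have E z := etrans (congr1 (fun z' => Yiter D z z' w e) (sign_compE v)) (YiterDr _ _ _ _ _).
exact: (congr2 +%R (E _) (E _)).
Qed.

(** * Truncation *)

Lemma Ycoef_truncation u w : exists N : int, forall s a (i : int), i < N -> Yc (sc s u) a i w = 0.
Proof.
have [N0 h0] := truncation hV (sc false u) w; have [N1 h1] := truncation hV (sc true u) w.
exists (- (absz N0 + absz N1 + 3)%N%:Z) => s a i lt_i; rewrite /Ycoef.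
by case: s; [apply: h1 | apply: h0]; case: a; lia.
Qed.

Lemma Yapply_truncation u w : exists N : int, forall psi (i : int), i < N ->
  Yapply D psi u i (const_oddpoly w) = 0.
Proof.
have [N h] := Ycoef_truncation u w; exists N => psi i lt_i; apply: Yapply_eq0 => s a b c.
by case: b; case: c; rewrite /= ?Ycoef0r // h.
Qed.

Lemma Yprod12_truncation u v w : exists N : int,
  forall e : int * int, e.2 < N -> Yprod12 D u v w e = 0.
Proof.
have [N h] := Yapply_truncation v w; exists N => e lt_e.
by rewrite /Yprod12 h // Yapply0r.
Qed.

Lemma Yprod21_truncation u v w : exists N : int,
  forall e : int * int, e.1 < N -> Yprod21 D u v w e = 0.
Proof.
have [N h] := Yapply_truncation u w; exists N => e lt_e.
by rewrite /Yprod21 h // Yapply0r.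
Qed.

Lemma Yiter_truncation u v w : exists N : int, forall e : int * int, e.1 < N -> Yiter D u v w e = 0.
Proof.
have [N h] := Yapply_truncation u v; exists N => e lt_e.
by rewrite /Yiter h // Yextend0.
Qed.

Section Upper.
Variable (v' : {linear V -> A^o}) (N : int).
Hypothesis upper : forall u y a i, N < i -> v' (Yc u a i y) = 0.
Local Notation vp := (vpair v').
Let vpD := vpairD (linearD v').
Let vpZ := vpairZ (linearD v') (linearZ_LR v').

Lemma vpair_extend_op p f X : (forall x, v' (f x) = 0) -> vp (extend_op p f X) = 0.
Proof.
have vZ (x : V) : v' x = 0 -> v' ((-1) ^+ p *: x) = 0 by rewrite linearZ_LR => ->; rewrite scaler0.
by move=> f0; congr ((_, _), (_, _)); rewrite /= ?vZ ?f0.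
Qed.

Lemma vpair_Yapply psi u i X : N < i -> vp (Yapply D psi u i X) = 0.
Proof.
move=> lt_i; rewrite /Yapply; elim/big_ind: _ => [|x y hx hy|s _].
- exact: (vpair0 (linearD v')).
- by apply: (etrans (vpD _ _)); rewrite hx hy addr0.
apply: (etrans (vpD _ _)).
have z p a : vp (extend_op p (Yc (sc s u) a i) X) = 0.
  by apply: vpair_extend_op => x; exact: upper.
rewrite z add0r; apply: (etrans (vpZ _ _)); rewrite z; exact: mulr0.
Qed.

Lemma vpair_Yextend psi X i w : N < i -> vp (Yextend D psi X i w) = 0.
Proof.
move=> lt_i; have z x := vpair_Yapply psi x (const_oddpoly w) lt_i.
have zz b (Z : Vphi) : vp Z = 0 -> vp (b *: Z) = 0.
  by move=> hZ; apply: (etrans (vpZ _ _)); rewrite hZ; exact: mulr0.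
have zD (Z Z' : Vphi) : vp Z = 0 -> vp Z' = 0 -> vp (Z + Z') = 0.
  by move=> hZ hZ'; apply: (etrans (vpD _ _)); rewrite hZ hZ' addr0.
exact: (zD _ _ (zD _ _ (zD _ _ (z _) (zz _ _ (z _))) (zz _ _ (z _))) (zz _ _ (zz _ _ (z _)))).
Qed.

Lemma bounded_Yprod12 u v w : bounded finite_neg_y (pair_series v' (Yprod12 D u v w)).
Proof.
have [M h] := Yprod12_truncation u v w.
exists (absz N + absz M)%N%:Z => e /orP[o|o].
  by apply: vpair_Yapply; lia.
rewrite /pair_series h; last by lia.
exact: (vpair0 (linearD v')).
Qed.

Lemma bounded_Yprod21 u v w : bounded finite_neg_x (pair_series v' (Yprod21 D u v w)).
Proof.
have [M h] := Yprod21_truncation u v w.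
exists (absz N + absz M)%N%:Z => e /orP[o|o].
  rewrite /pair_series h; last by lia.
  exact: (vpair0 (linearD v')).
by apply: vpair_Yapply; lia.
Qed.

Lemma bounded_Yiter u v w : bounded finite_neg_x (pair_series v' (Yiter D u v w)).
Proof.
have [M h] := Yiter_truncation u v w.
exists (absz N + absz M)%N%:Z => e /orP[o|o].
  rewrite /pair_series h; last by lia.
  exact: (vpair0 (linearD v')).
by apply: vpair_Yextend; lia.
Qed.

End Upper.
End Operators.

(** * Weights of the modes *)

Section Components.
Context (R : nzRingType) (s : {rmorphism R -> R}) (M : lmodType R).
Implicit Types (X Y : oddmod2 s M).

Let simp := (rmorph0, rmorph1, oppr0, scale0r, scaler0, scale1r, addr0, add0r).

Lemma coef_phiD a b X Y : coef_phi a b (X + Y) = coef_phi a b X + coef_phi a b Y.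
Proof. by case: a b => [] []. Qed.

Lemma phi1_coef10 X : coef_phi true false (phi1 *: X) = coef_phi false false X.
Proof. by case: X => -[x00 x01] [x10 x11]; rewrite /= !simp. Qed.

Lemma phi2_coef00 X : coef_phi false false (phi2 *: X) = 0.
Proof. by case: X => -[x00 x01] [x10 x11]; rewrite /= !simp. Qed.

Lemma phi2_coef10 X : coef_phi true false (phi2 *: X) = 0.
Proof. by case: X => -[x00 x01] [x10 x11]; rewrite /= !simp. Qed.

Lemma dual_phi_coef10 a b X :
  coef_phi true false (dual_phi s a b *: X) = s a *: coef_phi true false X.
Proof. by case: X => -[x00 x01] [x10 x11]; rewrite /= !simp. Qed.

End Components.

Section Weights.
Context (R : realType) (L : option nat).
Local Notation C := R[i].
Local Notation A := (grassmann C L).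
Local Notation B := (grassmann_phi C L).
Context (V : lmodType A) (D : vosa_data V).
Local Notation Vphi := (oddpoly V).
Hypothesis hV : vosa_except_jacobi D.
Hypothesis jac : jacobi_identity D.
Implicit Types (u v w x y : V) (X Y : Vphi) (psi : B).

Let gD := vosa_graded hV.
Let lD := vosa_linear hV.
Local Notation Yc := (Ycoef D).
Local Notation sc := (sign_comp D).
Local Notation wc := (weight_comp D).
Local Notation tmode := (mode D (tau D)).

Lemma Yapply_homog s u psi i X : has_sign D s u ->
  Yapply D psi u i X =
  extend_op s (Yc u false i) X + psi *: extend_op (~~ s) (Yc u true i) X.
Proof.
move=> su; have su' : sc s u = u by exact: su.
rewrite /Yapply (bigD1 s) //= su' big1 ?addr0 // => t ts.
have tu : sc t u = 0 by exact: sign_comp_neq su.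
have z p a : extend_op p (Yc (sc t u) a i) X = 0.
  by apply: extend_op_eq0 => b c; rewrite tu; exact: Ycoef0l.
by rewrite !z scaler0 addr0.
Qed.

Local Notation c00 := (coef_phi false false).
Local Notation c10 := (coef_phi true false).

Lemma phi2_const_coef10 u i w : c10 (Yapply D phi2 u i (const_oddpoly w)) = 0.
Proof.
rewrite /Yapply; elim/big_ind: _ => [//|X Y hX hY|s _].
  by rewrite coef_phiD hX hY addr0.
by rewrite coef_phiD phi2_coef10 addr0 /= (Ycoef0r hV) scaler0.
Qed.

Lemma phi2_const_coef00 u i w : c00 (Yapply D phi2 u i (const_oddpoly w)) = Yc u false i w.
Proof.
rewrite [in RHS](sign_compE hV u) (YcoefDl hV) /Yapply big_bool coef_phiD addrC.
by rewrite !coef_phiD !phi2_coef00 !addr0.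
Qed.

(** The coefficient of phi1 selects the modes of integer index of v and the modes
    tau_(n - 1/2), among which are 2 L(0) and 2 L(-1). *)
Lemma Yprod12_tau i j v w :
  c10 (Yprod12 D (tau D) v w (i, j)) = Yc (tau D) true i (Yc v false j w).
Proof.
rewrite /Yprod12 (Yapply_homog _ _ _ (tau_sign hV)) coef_phiD phi1_coef10 /=.
rewrite -/(c10 _) -/(c00 _).
rewrite [X in Yc _ false _ X]phi2_const_coef10 (Ycoef0r hV) scaler0 add0r.
by congr (Yc _ _ _); exact: phi2_const_coef00.
Qed.

Lemma Yprod21_tau t i j v w : has_sign D t v ->
  c10 (Yprod21 D (tau D) v w (i, j)) = (-1) ^+ t *: Yc v false j (Yc (tau D) true i w).
Proof.
move=> tv; rewrite /Yprod21 (Yapply_homog _ _ _ tv) coef_phiD phi2_coef10 addr0 /=.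
rewrite -/(c10 _); congr (_ *: Yc _ _ _ _).
rewrite (Yapply_homog _ _ _ (tau_sign hV)) coef_phiD phi1_coef10 /=.
by rewrite (Ycoef0r hV) scaler0 add0r.
Qed.

Lemma Yiter_tau i j v w :
  c10 (Yiter D (tau D) v w (i, j)) = Yc (Yc (tau D) true i v) false j w.
Proof.
rewrite /Yiter /Yextend !coef_phiD !phi2_coef10 !phi1_coef10 !phi2_coef00 !addr0.
rewrite phi2_const_coef10 add0r phi2_const_coef00; congr (Yc _ _ _ _).
rewrite (Yapply_homog _ _ _ (tau_sign hV)) scalerBl !coef_phiD phi1_coef10.
rewrite (_ : c10 (- _) = - c10 (phi2 *: extend_op (~~ true) (Yc (tau D) true i) (const_oddpoly v))) //.
by rewrite phi2_coef10 oppr0 addr0 /= (Ycoef0r hV) scaler0 add0r.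
Qed.

Lemma gparity_alg (x : C) : gparity (x%:A : A) = x%:A.
Proof.
apply: gparity_even; apply/allP => S /(fsubsetP (msuppZ_le x (1 : A))) S1.
by have /allP := @ghom1 C L; apply.
Qed.

Lemma scal2_coef10 (x y : C) X : c10 (scal2 L x y *: X) = scaleC x (c10 X).
Proof.
apply: (etrans (dual_phi_coef10 _ _ _)); exact: (congr1 (fun a => a *: _) (gparity_alg x)).
Qed.

(** Only the terms x1^-2 x2 and x1^-2 x0 of (x1 - x0)^n x2^(-n-1) survive for
    x1^-2: the coefficient of x0^k is the binomial of k - 2 over k up to sign,
    which is 0 for k >= 2. *)
Lemma d20_m2 d : d20 R L (-2) d =
  scal2 L ((d == (0, 1)) || (d == (1, 0)))%:R (d == (0, 0))%:R.
Proof.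
rewrite d20E; case: d => d0 d2; rewrite [fst _]/= [snd _]/= !xpair_eqE.
apply: (congr2 (scal2 L)).
  case: d0 => [[|[|d0]]|d0]; rewrite ?pow_negz // powE.
  - rewrite expr0 mul1r binom0 (_ : (-2 + 0%:Z == - d2 - 1) = (d2 == 1)); last by lia.
    by case: (d2 == 1); case: (d2 == 0).
  - rewrite (_ : (-2 + 1%:Z == - d2 - 1) = (d2 == 0)); last by lia.
    case: (d2 =P 0) => [->|_]; last by rewrite !andbF.
    by rewrite (@binom_neg R 0 1) bin1 mulr1 -expr2 sqrr_sign.
  - rewrite (_ : (-2 + d0.+2%:Z == - d2 - 1) = (- d2 - 1 == d0%:Z)); last by lia.
    case: eqP => [->|_] //=; rewrite binom_nat bin_small ?mulr0 //.
rewrite (_ : -2 + 1 = -1) // mulN1r opprK.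
case: d0 => [[|d0]|d0]; rewrite ?pow_negz // powE.
- rewrite expr0 mul1r binom0 (_ : (-1 + 0%:Z == - d2 - 1) = (d2 == 0)); last by lia.
  by case: (d2 == 0).
- rewrite (_ : (-1 + d0.+1%:Z == - d2 - 1) = (- d2 - 1 == d0%:Z)); last by lia.
  case: eqP => [->|_] //=; rewrite binom_nat bin_small ?mulr0 //.
Qed.

Lemma d20_m2_coef10 (S : int * int -> Vphi) N j :
  (forall e : int * int, e.1 < N -> S e = 0) ->
  c10 (series_mul (d20 R L (-2)) S (-1, j)) = c10 (S (-1, j - 1)) + c10 (S (-2, j)).
Proof.
move=> trS; have fs := d20_fsupp (-2) (-1, j) trS.
rewrite /series_mul (fsum_additive (phi := fun X : Vphi => c10 X) _ _ fs) //.
pose G d := scaleC ((d == (0, 1)) || (d == (1, 0)))%:R (c10 (S ((-1, j) - d))).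
rewrite (@eq_fsbigr _ _ _ _ _ G) => [|d _]; last first.
  by rewrite d20_m2 scal2_coef10.
rewrite (@fsum_seq _ _ G [fset (0, 1); (1, 0)]%fset) => [|d]; last first.
  by rewrite !inE /G; case: (_ || _) => //; rewrite scaleC0.
rewrite big_fsetU1 ?inE //= big_seq_fset1 /G !scaleC1.
by congr (c10 (S _) + c10 (S _)); congr pair; rewrite /= ?subr0 //.
Qed.

(** [2 L(0), Y(v, x)] acts on the coefficient of x^j, read off from the
    coefficient of phi1 / (x0 x1^2) in the Jacobi identity for tau and v. *)
Lemma L0_commutator t v w j : has_sign D t v ->
  tmode 1 (Yc v false j w) - Yc v false j (tmode 1 w) =
  Yc (tmode (-1) v) false (j - 1) w + Yc (tmode 1 v) false j w.
Proof.
move=> tv; have /jacobi_identityE J := jac.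
have J0 := J true t (tau D) v w (tau_sign hV) tv (-1) (-2) j.
have key (X Y Z : Vphi) : X - Y = Z -> c10 X - c10 Y = c10 Z by move=> <-.
have N12 : series_mul (d12 R L (-1)) (Yprod12 D (tau D) v w) (-2, j) = Yprod12 D (tau D) v w (-2, j).
  apply: (etrans _ (series_mul1 _ _)); apply: eq_series_mul => d; exact: d12_N1.
pose S21 := signed (true && t) (Yprod21 D (tau D) v w).
have N21 : series_mul (d21 R L (-1)) S21 (-2, j) = S21 (-2, j).
  apply: (etrans _ (series_mul1 _ _)); apply: eq_series_mul => d; exact: d21_N1.
have E12 := etrans (congr1 c10 N12) (Yprod12_tau (-2) j v w).
have E21 : c10 (S21 (-2, j)) = Yc v false j (tmode 1 w).
  have h := Yprod21_tau (-2) j w tv.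
  have c10_signed (X : Vphi) : c10 ((-1) ^+ t *: X) = (-1) ^+ t *: c10 X.
    by case: (t); rewrite ?expr0 ?scale1r // !expr1 !scaleN1r.
  apply: (etrans (c10_signed _)); apply: (etrans (congr1 _ h)).
  rewrite scalerA -expr2 sqrr_sign; exact: scale1r.
have [N trN] := Yiter_truncation hV (tau D) v w.
have E20 := d20_m2_coef10 j trN.
have E20' := etrans E20 (congr2 +%R (Yiter_tau (-1) (j - 1) v w) (Yiter_tau (-2) j v w)).
have := key _ _ _ J0.
exact: (sub_eq_transfer (esym E12) (esym (etrans (congr1 c10 N21) E21)) (esym E20')).
Qed.

(** L(-1) = G(-1/2)^2 acts as d/dx. *)
Lemma Ycoef_L1 v j w :
  Yc (tmode (-1) v) false (j - 1) w = scaleC (2 * j%:~R) (Yc v false j w).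
Proof.
have [rank ns] := neveu_schwarz_relations hV; have [_ _ h] := ns (-1) 0 v.
have G2 : G_ D (-1) (G_ D (-1) v) + G_ D (-1) (G_ D (-1) v) = tmode (-1) v.
  move: h; rewrite /supercomm sub0r expr1 scaleN1r opprK => ->.
  rewrite (_ : ((-1) ^+ 2 + -1)%:~R = 0) // !mul0r scaleC0 addr0 /L_ scaleCA.
  by rewrite divff ?scaleC1 // pnatr_eq0.
have dG x i : Yc (G_ D (-1) x) false i w = Yc x true i w by rewrite -(G_derivative hV).
have dG' x i : Yc (G_ D (-1) x) true i w = scaleC (i + 1)%:~R (Yc x false (i + 1) w).
  by rewrite -(G_derivative hV).
rewrite -G2 (YcoefDl hV) dG dG' subrK -scaleCD -mulr2n mulr_natl //.
Qed.

Let two_half : 2 * 2^-1 = 1 :> C.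
Proof. by rewrite divff // pnatr_eq0. Qed.

Lemma tmode_weight k v : has_weight D k v -> tmode 1 v = scaleC k%:~R v.
Proof.
move=> kv; have E := congr1 (scaleC 2) (L0_weight hV kv); rewrite /L_ in E.
have E1 := etrans (scaleCA 2 2^-1 (tmode (0 * 2 + 1) v))
  (etrans (congr1 (fun c => scaleC c (tmode (0 * 2 + 1) v)) two_half) (scaleC1 _)).
have E2 := etrans E (scaleCA 2 (k%:~R / 2) v).
have E3 : 2 * (k%:~R / 2) = k%:~R :> C by rewrite mulrCA two_half mulr1.
exact: (etrans (esym E1) (etrans E2 (congr1 (fun c => scaleC c v) E3))).
Qed.

Lemma weight_compZC k (x : C) v : wc k (scaleC x v) = scaleC x (wc k v).
Proof. exact: weight_compZ gD _ _ _. Qed.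

Lemma weight_ind (Q : V -> Prop) : Q 0 -> (forall x y, Q x -> Q y -> Q (x + y)) ->
  (forall k x, has_weight D k x -> Q x) -> forall x, Q x.
Proof.
move=> Q0 QD Qh x; have wD := weight_decomposition gD.
have [X hX] := fsupp_fset (direct_sum_finite wD x).
rewrite -(direct_sumE wD x) (fsum_seq hX); elim/big_ind: _ => // k _.
by apply: (Qh k); exact: has_weight_comp.
Qed.

Lemma sign_weight_ind (Q : V -> Prop) : Q 0 -> (forall x y, Q x -> Q y -> Q (x + y)) ->
  (forall k s x, has_weight D k x -> has_sign D s x -> Q x) -> forall x, Q x.
Proof.
move=> Q0 QD Qh; apply: weight_ind => // k x kx.
have wsc s : has_weight D k (sc s x) by rewrite /has_weight (weight_sign_comp gD) kx.
by rewrite (sign_compE hV x); apply: QD; apply: (Qh k _ _ (wsc _)); exact: has_sign_comp.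
Qed.

(** [2 L(0)] detects the grading because its eigenvalues on the different weight
    spaces are different. *)
Lemma weight_of_tmode k v : tmode 1 v = scaleC k%:~R v -> has_weight D k v.
Proof.
move=> kv; have wD := weight_decomposition gD.
have tw j x : wc j (tmode 1 x) = scaleC j%:~R (wc j x).
  move: x; apply: weight_ind => [|x y hx hy|i x ix].
  - have t0 : tmode 1 0 = 0 by apply: (additive0 (f := tmode 1)) => a b; exact: (modeDr lD).
    by rewrite t0 (weight_comp0 gD) scaleC0r.
  - by rewrite (modeDr lD) !(direct_sumD wD) hx hy scaleCDr.
  - apply: (etrans (congr1 (wc j) (tmode_weight ix))); apply: (etrans (weight_compZC _ _ _)).
    have [->|ji] := eqVneq j i; first reflexivity.
    rewrite (weight_comp_neq gD ji ix); by rewrite !scaleC0r.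
have w0 j : j != k -> wc j v = 0.
  move=> jk; have := tw j v; rewrite kv weight_compZC => /eqP.
  rewrite -subr_eq0 -scaleCN -scaleCD => /eqP /(congr1 (scaleC (k%:~R - j%:~R)^-1)).
  rewrite scaleCA mulVf; last by rewrite subr_eq0 eqr_int eq_sym.
  by rewrite scaleC1 scaleC0r.
rewrite /has_weight -[RHS](direct_sumE wD v) (fsum1 (d0 := k)) // => j /eqP.
exact: w0.
Qed.

(** In the commutator with 2 L(0), [v] and [w] contribute their weights and
    L(-1) = d/dx contributes the exponent. *)
Lemma mode_weight_even (p q : int) t v w (j : int) :
  has_weight D p v -> has_sign D t v -> has_weight D q w ->
  has_weight D (p + q + j * 2) (Yc v false j w).
Proof.
move=> pv tv qw; apply: weight_of_tmode; have := L0_commutator w j tv.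
have gC (c : C) : ghom false (c%:A : A).
  by apply/allP => S /(fsubsetP (msuppZ_le c (1 : A))) S1; have /allP := @ghom1 C L; apply.
have Zr c : Yc v false j (scaleC c w) = scaleC c (Yc v false j w).
  by have := modeZr lD (- ((j + 1) * 2) - Posz false) w (gC c) tv; rewrite expr0 scale1r.
have Zl c : Yc (scaleC c v) false j w = scaleC c (Yc v false j w).
  by have := modeZl lD v (- ((j + 1) * 2) - Posz false) w (gC c); rewrite expr0 scale1r.
rewrite Ycoef_L1 (tmode_weight pv) (tmode_weight qw) Zr Zl.
set X := Yc v false j w => h.
have h' : tmode 1 X = scaleC (2 * j%:~R) X + scaleC p%:~R X + scaleC q%:~R X.
  by rewrite -h subrK.
apply: (etrans h'); apply: (etrans (congr1 (fun z => z + _) (esym (scaleCD _ _ _)))).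
apply: (etrans (esym (scaleCD _ _ _))); apply: (congr1 (fun c => scaleC c X)).
by rewrite !rmorphD /= rmorphM /=; ring.
Qed.

(** The modes of half-integer index of [v] are modes of integer index of
    G(-1/2) v, whose weight is larger by 1/2. *)
Lemma mode_weight (p q : int) t v w (a : bool) (j : int) :
  has_weight D p v -> has_sign D t v -> has_weight D q w ->
  has_weight D (p + q + j * 2 + Posz a) (Yc v a j w).
Proof.
case: a => pv tv qw; last by rewrite addr0; exact: mode_weight_even pv tv qw.
have dG : Yc v true j w = Yc (G_ D (-1) v) false j w by rewrite -(G_derivative hV).
have Gv : has_weight D (p + 1) (G_ D (-1) v).
  have := mode_weight_even (-1) (tau_weight hV) (tau_sign hV) pv.
  by rewrite (_ : 3 + p + -1 * 2 = p + 1) //; lia.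
have Gs : has_sign D (true (+) t (+) mode_odd 0) (G_ D (-1) v).
  exact: (mode_sign lD _ (tau_sign hV) tv).
rewrite dG (_ : p + q + j * 2 + Posz true = p + 1 + q + j * 2); last by lia.
exact: mode_weight_even Gv Gs qw.
Qed.

Lemma finite_int_bound (K : set int) : finite_set K -> exists N : int, forall k, K k -> k <= N.
Proof.
move=> /finite_fsetP[X ->]; exists (\sum_(x <- X) `|x|) => k /= kX.
rewrite (big_fsetD1 k) //=; apply: (le_trans (ler_norm k)).
by rewrite lerDl sumr_ge0.
Qed.

(** Weights are bounded below, those seen by [v'] above, and coefficients of high
    powers of x raise the weight. *)
Lemma matrix_coefficients_upper (v' : {linear V -> A^o}) : in_graded_dual D v' ->
  exists N : int, forall u y a i, N < i -> v' (Yc u a i y) = 0.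
Proof.
move=> /finite_int_bound[M hM]; have [E hE] := positive_energy gD.
exists (absz M + absz E + absz E)%N%:Z => u y a i lt_i.
move: y; apply: weight_ind => [|x y hx hy|q y qy]; first by rewrite (Ycoef0r hV) linear0.
  by rewrite (YcoefDr hV) linearD hx hy addr0.
move: u; apply: sign_weight_ind => [|x u hx hu|p s u pu su]; first by rewrite (Ycoef0l hV) linear0.
  by rewrite (YcoefDl hV) linearD hx hu addr0.
have [lt_p|le_p] := ltP p E; first by rewrite (hE _ _ lt_p pu) (Ycoef0l hV) linear0.
have [lt_q|le_q] := ltP q E; first by rewrite (hE _ _ lt_q qy) (Ycoef0r hV) linear0.
apply: contrapT => ne0; have := hM (p + q + i * 2 + Posz a).
move=> /(_ (ex_intro _ _ (conj (mode_weight a i pu su qy) ne0))); lia.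
Qed.

End Weights.

(** * The substitution of phi1 - phi2 for phi1 *)

Section ShiftPhi.
Context (R : nzRingType) (s : {rmorphism R -> R}).
Local Notation B := (oddext2 s).

Let simp := (rmorph0, rmorph1, oppr0, mulr0, mul0r, mulr1, mul1r, add0r, addr0).

Lemma mk_phiD (a b c d x y z t : R) :
  (mk_phi a b c d : B) + (mk_phi x y z t : B) = mk_phi (a + x) (b + y) (c + z) (d + t) :> B.
Proof. by []. Qed.

Lemma mk_phiN (a b c d : R) :
  - (mk_phi a b c d : B) = mk_phi (- a) (- b) (- c) (- d) :> B.
Proof. by []. Qed.

(** [shift_phi] in coordinates: (phi1 - phi2) phi2 = phi1 phi2, so only the
    coefficient of phi2 changes. *)
Definition shear_phi (b : B) : B :=
  mk_phi (coef_phi false false b) (coef_phi false true b - coef_phi true false b)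
    (coef_phi true false b) (coef_phi true true b).

Lemma shear_phiE (b : B) :
  const_phi (coef_phi false false b)
  + (phi1 - phi2) * const_phi (coef_phi true false b)
  + phi2 * const_phi (coef_phi false true b)
  + (phi1 - phi2) * phi2 * const_phi (coef_phi true true b) = shear_phi b.
Proof.
case: b => -[b00 b01] [b10 b11]; rewrite /coef_phi /= !mulrBl phi2_sq mul0r subr0 phi12_mul.
rewrite [phi1 * _](mk_phiM s 0 0 1 0 b10 0 0 0) ![phi2 * _](mk_phiM s 0 1 0 0 _ 0 0 0) !simp.
rewrite mk_phiN !mk_phiD !simp /shear_phi /=; congr ((_, _), (_, _)).
by rewrite addrC.
Qed.

Lemma shear_phi_additive : additive shear_phi.
Proof.
case=> -[a00 a01] [a10 a11] [[b00 b01] [b10 b11]]; congr ((_, _), (_, _)) => //=.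
by rewrite !opprB addrACA [RHS]addrACA (addrC (- b01)).
Qed.

Lemma shear_phi_multiplicative : monoid_morphism shear_phi.
Proof.
split; first by congr ((_, _), (_, _)); rewrite /= subr0.
case=> -[a00 a01] [a10 a11] [[b00 b01] [b10 b11]].
apply: (etrans (congr1 shear_phi (mk_phiM s a00 a01 a10 a11 b00 b01 b10 b11))).
apply: (etrans _ (esym (mk_phiM s a00 (a01 - a10) a10 a11 b00 (b01 - b10) b10 b11))).
congr ((_, _), (_, _)) => /=.
  by rewrite mulrBl mulrBr opprD addrACA.
rewrite rmorphB mulrBr opprB mulrBl !mulNr -!addrA; congr (_ + (_ + _)).
by rewrite !addrA addNr add0r.
Qed.

Definition unshear_phi (b : B) : B :=
  mk_phi (coef_phi false false b) (coef_phi false true b + coef_phi true false b)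
    (coef_phi true false b) (coef_phi true true b).

Lemma unshear_phiK : cancel unshear_phi shear_phi.
Proof.
by case=> -[a00 a01] [a10 a11]; congr ((_, _), (_, _)); rewrite /= addrK.
Qed.

Lemma shear_phiK : cancel shear_phi unshear_phi.
Proof.
by case=> -[a00 a01] [a10 a11]; congr ((_, _), (_, _)); rewrite /= subrK.
Qed.

End ShiftPhi.

Section SuperpolyShift.
Context (F : fieldType) (L : option nat).
Local Notation A := (grassmann F L).
Local Notation B := (grassmann_phi F L).
Local Notation P := (superpoly F L).
Local Notation shear := (@shear_phi A (@gparity F L)).
Local Notation unshear := (@unshear_phi A (@gparity F L)).

HB.instance Definition _ := GRing.isZmodMorphism.Build B B shear
  (@shear_phi_additive A (@gparity F L)).
HB.instance Definition _ := GRing.isMonoidMorphism.Build B B shear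
  (@shear_phi_multiplicative A (@gparity F L)).

Definition shear_poly : {rmorphism {poly {poly B}} -> {poly {poly B}}} := map_poly (map_poly shear).

Lemma superpoly_shiftE (g : P) : superpoly_shift g = shear_poly g.
Proof.
have e1 : map_poly (@shift_phi F L) =1 map_poly shear.
  by apply: eq_map_poly => b; exact: shear_phiE.
exact: (eq_map_poly e1 g).
Qed.

Lemma superpoly_shiftM (g h : P) : superpoly_shift (g * h) = superpoly_shift g * superpoly_shift h.
Proof. by rewrite !superpoly_shiftE; exact: rmorphM. Qed.

Lemma superpoly_shiftB (g h : P) : superpoly_shift (g - h) = superpoly_shift g - superpoly_shift h.
Proof. by rewrite !superpoly_shiftE; exact: rmorphB. Qed.

Lemma superpoly_shiftD (g h : P) : superpoly_shift (g + h) = superpoly_shift g + superpoly_shift h.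
Proof. by rewrite !superpoly_shiftE; exact: rmorphD. Qed.

Definition superpoly_unshift (g : P) : P := map_poly (map_poly unshear) (g : {poly {poly B}}).

Let unshear0 : unshear 0 = 0. Proof. by congr ((_, _), (_, _)); rewrite /= addr0. Qed.

Lemma superpoly_unshiftK (g : P) : superpoly_shift (superpoly_unshift g) = g.
Proof.
rewrite superpoly_shiftE /superpoly_unshift; apply/polyP => i; rewrite coef_map.
rewrite coef_map_id0; last by rewrite map_poly0.
apply/polyP => j; rewrite coef_map coef_map_id0; last exact: unshear0.
exact: unshear_phiK.
Qed.

Lemma superpoly_shift_inj (g : P) : superpoly_shift g = 0 -> g = 0.
Proof.
rewrite superpoly_shiftE => h; apply/polyP => i; apply/polyP => j.
have := congr1 (fun p : {poly {poly B}} => p`_i`_j) h; rewrite coef_map coef_map !coef0.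
by move=> /(congr1 unshear); rewrite [X in X = _]shear_phiK unshear0.
Qed.

Lemma superpoly_shift_const (b : B) : shear b = b ->
  superpoly_shift (const_poly b : P) = const_poly b.
Proof.
move=> hb; rewrite superpoly_shiftE; apply: (etrans (map_polyC _ _)); congr (_%:P).
exact: (etrans (map_polyC _ _) (congr1 polyC hb)).
Qed.

Lemma superpoly_shift_linear (d : superlinear F L) :
  superpoly_shift (superlinear_poly d) = superlinear_poly d.
Proof.
rewrite superlinear_polyE !superpoly_shiftD !superpoly_shiftM.
have hc (a : A) : superpoly_shift (const_poly (const_phi a) : P) = const_poly (const_phi a).
  by apply: superpoly_shift_const; congr ((_, _), (_, _)); rewrite /= subr0.
have hf : superpoly_shift (const_poly (phi1 * phi2) : P) = const_poly (phi1 * phi2).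
  by apply: superpoly_shift_const; rewrite phi1_phi2; congr ((_, _), (_, _)); rewrite /= subr0.
have hx : superpoly_shift (var_x F L) = var_x F L.
  by rewrite superpoly_shiftE; exact: map_polyX.
have hy : superpoly_shift (var_y F L) = var_y F L.
  rewrite superpoly_shiftE; apply: (etrans (map_polyC _ _)); congr (_%:P); exact: map_polyX.
exact: (congr2 +%R (congr2 +%R (congr2 *%R (hc _) hx) (congr2 *%R (hc _) hy)) (congr2 *%R (hc _) hf)).
Qed.

Lemma superpoly_shift_den (ds : seq (superlinear F L)) : superpoly_shift (den ds) = den ds.
Proof.
rewrite /den; elim: ds => [|d ds IH].
  by rewrite !big_nil superpoly_shiftE; exact: rmorph1.
by rewrite !big_cons superpoly_shiftM superpoly_shift_linear IH.
Qed.

Lemma sfrac_shift_inj (h h' : sfrac F L) :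
  sfrac_eq (sfrac_shift h) (sfrac_shift h') -> sfrac_eq h h'.
Proof.
move=> [es hes]; exists es; apply: superpoly_shift_inj.
by rewrite superpoly_shiftM superpoly_shiftB !superpoly_shiftM !superpoly_shift_den.
Qed.

End SuperpolyShift.

(** * Common denominators *)

Section StandardForms.
Context (R : realType) (L : option nat).
Local Notation C := R[i].
Local Notation B := (grassmann_phi C L).
Local Notation P := (superpoly C L).
Local Notation SL := (superlinear C L).
Implicit Types (g h : P) (ds : seq SL) (S : int * int -> B^o).

Lemma superlinear_poly_val (d d' : SL) : val d = val d' -> superlinear_poly d = superlinear_poly d'.
Proof. by rewrite /superlinear_poly => ->. Qed.

Lemma den_nseq n (d : SL) : den (nseq n d) = superlinear_poly d ^+ n.
Proof. by rewrite /den big_nseq -Monoid.iteropE; elim: n => //= n IH; rewrite exprS -IH. Qed.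

Lemma den12E a b c : den (den12 R L a b c) =
  superlinear_poly lin_x ^+ a * (superlinear_poly lin_y ^+ b * superlinear_poly lin_sub ^+ c).
Proof. by rewrite /den12 !den_cat !den_nseq. Qed.

Lemma den20E a b c : den (den20 R L a b c) =
  superlinear_poly lin_plus ^+ a * (superlinear_poly lin_y ^+ b * superlinear_poly lin_x ^+ c).
Proof. by rewrite /den20 !den_cat !den_nseq. Qed.

Lemma central_exprD (T : nzRingType) (x y z : T) a b c a' b' c' :
  central x -> central y ->
  x ^+ (a + a') * (y ^+ (b + b') * z ^+ (c + c')) =
  x ^+ a * (y ^+ b * z ^+ c) * (x ^+ a' * (y ^+ b' * z ^+ c')).
Proof.
move=> cx cy; have cxn n := centralX n cx; have cyn n := centralX n cy.
rewrite !exprD -!mulrA; congr (_ * _); rewrite (cxn a') -!mulrA; congr (_ * _).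
rewrite (cyn b') -!mulrA; congr (_ * _).
by rewrite [RHS]mulrA (centralM (cxn a') (cyn b')).
Qed.

Lemma den12D a b c a' b' c' :
  den (den12 R L (a + a') (b + b') (c + c')) = den (den12 R L a b c) * den (den12 R L a' b' c').
Proof. by rewrite !den12E; apply: central_exprD; exact: central_superlinear. Qed.

Lemma den20D a b c a' b' c' :
  den (den20 R L (a + a') (b + b') (c + c')) = den (den20 R L a b c) * den (den20 R L a' b' c').
Proof. by rewrite !den20E; apply: central_exprD; exact: central_superlinear. Qed.

Lemma den12_add a b c : den (map (@add_superlinear C L) (den12 R L a b c)) = den (den20 R L a b c).
Proof.
rewrite /den12 /den20 !map_cat !den_cat !map_nseq !den_nseq.
have ex : superlinear_poly (add_superlinear lin_x) = superlinear_poly lin_plus :> P.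
  by apply: superlinear_poly_val; congr (_, _, _); rewrite /= add0r.
have ey : superlinear_poly (add_superlinear lin_y) = superlinear_poly lin_y :> P.
  by apply: superlinear_poly_val; congr (_, _, _); rewrite /= addr0.
have ez : superlinear_poly (add_superlinear lin_sub) = superlinear_poly lin_x :> P.
  by apply: superlinear_poly_val; congr (_, _, _); rewrite /= addNr.
exact: (congr2 *%R (congr1 (fun x => x ^+ a) ex)
  (congr2 *%R (congr1 (fun x => x ^+ b) ey) (congr1 (fun x => x ^+ c) ez))).
Qed.

Lemma subst_x_den12 a b c :
  subst_x (x_add C L) (den (den12 R L a b c)) = den (den20 R L a b c).
Proof. by rewrite subst_x_den_add den12_add. Qed.

Lemma represents_den dir S g ds ds' : den ds = den ds' ->
  represents dir S (g, ds) -> represents dir S (g, ds').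
Proof. by move=> e [bS hS]; split=> // k; rewrite -hS /= e. Qed.

Lemma sfrac_eq_den g ds ds' : den ds = den ds' -> sfrac_eq (g, ds) (g, ds').
Proof. by move=> e; exists [::]; rewrite /= e subrr mul0r. Qed.

Lemma represents_scale dir S g ds es ds' : den ds' = den ds * den es ->
  represents dir S (g, ds) -> represents dir S (g * den es, ds').
Proof.
move=> e [bS /funext hS]; split=> // k /=; rewrite e [_ * den es]central_den actM.
rewrite [act (den ds) S]hS act_superpoly_series.
by rewrite [den es * g]central_den.
Qed.

Lemma represents_add dir S S' g g' ds : represents dir S (g, ds) -> represents dir S' (g', ds) ->
  represents dir (fun e => S e + S' e) (g + g', ds).
Proof.
move=> [bS hS] [bS' hS']; split.
  by apply: boundedU bS bS' => k -> ->; rewrite addr0.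
move=> e; apply: (etrans (actDr _ S S' e)); apply: (etrans (congr2 +%R (hS e) (hS' e))).
by rewrite superpoly_seriesD.
Qed.

Lemma act_signed k g S : act g (signed k S) = signed k (act g S).
Proof.
case: k; apply/funext => e; rewrite /signed.
  rewrite expr1 scaleN1r -actNr; congr (act g _ e); apply/funext => d.
  by rewrite scaleN1r.
rewrite expr0 scale1r; congr (act g _ e); apply/funext => d.
by rewrite scale1r.
Qed.

Lemma represents_signed dir S g ds k :
  represents dir S (g, ds) -> represents dir (signed k S) (sfrac_sign k (g, ds)).
Proof.
move=> [bS hS]; split; first by apply: boundedS bS => e h; rewrite /signed h scaler0.
move=> e; rewrite [(sfrac_sign _ _).2]/= act_signed /signed hS.
case: k; rewrite /sfrac_sign /=.
  by rewrite !expr1 scaleN1r mulN1r superpoly_seriesN.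
by rewrite !expr0 scale1r mul1r.
Qed.

Lemma signedK k S : signed k (signed k S) = S.
Proof.
case: k; apply/funext => e; rewrite /signed ?expr1 ?expr0 ?scaleN1r ?scale1r //.
by rewrite opprK.
Qed.

Lemma sfrac_signK k g ds : sfrac_sign k (sfrac_sign k (g, ds)) = (g, ds).
Proof. by rewrite /sfrac_sign /= mulrA -expr2 sqrr_sign mul1r. Qed.

End StandardForms.

(** * Rationality and the Jacobi identity *)

Section Equivalence.
Context (R : realType) (L : option nat).
Local Notation C := R[i].
Local Notation A := (grassmann C L).
Local Notation B := (grassmann_phi C L).
Local Notation P := (superpoly C L).
Context (V : lmodType A) (D : vosa_data V).
Local Notation Vphi := (oddpoly V).
Local Notation sc := (sign_comp D).
Hypothesis hV : vosa_except_jacobi D.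
Implicit Types (u v w : V).

Let gD := vosa_graded hV.

Lemma signed_eq0 (M : lmodType B) k (S : int * int -> M) e : S e = 0 -> signed k S e = 0.
Proof. by rewrite /signed => ->; rewrite scaler0. Qed.

Lemma pair_series_signed (v' : {linear V -> A^o}) k (S : int * int -> Vphi) :
  pair_series v' (signed k S) = signed k (pair_series v' S).
Proof.
by apply/funext => e; exact: (vpairZ (linearD v') (linearZ_LR v') _ _).
Qed.

Lemma common_truncation k u v w : exists N : int,
  [/\ forall e : int * int, e.2 < N -> Yprod12 D u v w e = 0,
      forall e : int * int, e.1 < N -> signed k (Yprod21 D u v w) e = 0 &
      forall e : int * int, e.1 < N -> Yiter D u v w e = 0].
Proof.
have [N1 h1] := Yprod12_truncation hV u v w.
have [N2 h2] := Yprod21_truncation hV u v w.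
have [N3 h3] := Yiter_truncation hV u v w.
exists (- (absz N1 + absz N2 + absz N3)%N%:Z); split=> e lt_e.
- by apply: h1; lia.
- by apply: signed_eq0; apply: h2; lia.
- by apply: h3; lia.
Qed.

(** Rationality supplies a numerator and exponents; supercommutativity and
    associativity say that the other two series represent the same fraction,
    which gives the Jacobi identity for each linear form. *)
Lemma rational_jacobi : rationality_products D -> supercommutativity D -> associativity D ->
  jacobi_identity D.
Proof.
move=> P1 P3 P4; apply/jacobi_identityE => s t u v w su tv.
have [N [tr12 tr21 tr20]] := common_truncation (s && t) u v w.
apply: (jacobi3_of_pairings gD tr12 tr21 tr20) => v' dv'.
have [_ _ [f0 [S12f0 [g [r1 [r2 [r3 f0g]]]] _]]] := P1 s t u v w v' su tv dv'.
have [f1 [g1 [S12f1 S21g1 f1g1]]] := P3 s t u v w v' su tv dv'.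
have [f2 [h [S12f2 S20h f2h]]] := P4 u v w v' dv'.
move: f0g; set f := sfrac_over _ _ => f0f.
have represents_eq_iota dir S (f' : sfrac C L) : S = iota_exp dir f' -> represents dir S f'.
  by move=> ->; exact: represents_iota.
have r0 := represents_eq (represents_eq_iota _ _ _ S12f0) f0f.
have r1' := represents_eq_iota _ _ _ S12f1.
have r2' := represents_eq_iota _ _ _ S12f2.
pose a := pos_part r1; pose b := pos_part r2; pose c := pos_part r3.
(* A negative exponent has moved its factor to the numerator of [f]. *)
have fden : den f.2 = den (den12 R L a b c) by rewrite /f /= cats0.
have r12 : represents finite_neg_y (pair_series v' (Yprod12 D u v w)) (f.1, den12 R L a b c).
  exact: (represents_den fden r0).
have r21 : represents finite_neg_x (pair_series v' (signed (s && t) (Yprod21 D u v w)))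
    (f.1, den12 R L a b c).
  rewrite pair_series_signed; apply: (represents_den (ds := f.2) fden).
  have e1 := sfrac_eq_trans (sfrac_eq_sym f1g1) (represents_uniq r1' r0).
  case: (g1) S21g1 e1 => n ds S21g1 e1.
  exact: (represents_eq (represents_signed (s && t) (represents_eq_iota _ _ _ S21g1)) e1).
have r20 : represents finite_neg_x (pair_series v' (Yiter D u v w))
    (subst_x (x_add C L) f.1, den20 R L a b c).
  have e2 := sfrac_subst_eq (sfrac_eq_trans (represents_uniq r0 r2') f2h).
  have := represents_eq (represents_eq_iota _ _ _ S20h) e2; apply: represents_den.
  by rewrite -subst_x_den_add fden subst_x_den12.
exact: rational_jacobi3 r12 r21 r20.
Qed.

Section FromJacobi.
Hypothesis jac : jacobi_identity D.

Lemma jacobi_represents s t u v w (v' : {linear V -> A^o}) :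
  has_sign D s u -> has_sign D t v -> in_graded_dual D v' ->
  exists g a b c,
  [/\ represents finite_neg_y (pair_series v' (Yprod12 D u v w)) (g, den12 R L a b c),
      represents finite_neg_x (signed (s && t) (pair_series v' (Yprod21 D u v w)))
        (g, den12 R L a b c) &
      represents finite_neg_x (pair_series v' (Yiter D u v w))
        (subst_x (x_add C L) g, den20 R L a b c)].
Proof.
move=> su tv dv'; have [M up] := matrix_coefficients_upper hV jac dv'.
have [N [tr12 tr21 tr20]] := common_truncation (s && t) u v w.
have /jacobi_identityE J := jac.
have J3 := jacobi3_pairing (linearD v') (linearZ_LR v') tr12 tr21 tr20 (J s t u v w su tv).
rewrite pair_series_signed in J3.
apply: jacobi3_rational J3.
- exact: bounded_Yprod12 hV _ _ up u v w.
- by apply: boundedS (bounded_Yprod21 hV up u v w) => e; exact: signed_eq0.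
- exact: bounded_Yiter hV _ _ up u v w.
Qed.

(** The relation between product and iterate that the Jacobi identity gives for
    homogeneous u and v. It is additive, unlike the comparison with the opposite
    product, whose sign depends on u and v; so it extends to all u and v. *)
Definition associated (S12 S20 : int * int -> B) : Prop :=
  exists g a b c,
    represents finite_neg_y S12 (g, den12 R L a b c) /\
    represents finite_neg_x S20 (subst_x (x_add C L) g, den20 R L a b c).

Lemma associated_add S12 S20 S12' S20' : associated S12 S20 -> associated S12' S20' ->
  associated (fun e => S12 e + S12' e) (fun e => S20 e + S20' e).
Proof.
move=> [g [a [b [c [r12 r20]]]]] [g' [a' [b' [c' [r12' r20']]]]].
pose m := g * den (den12 R L a' b' c'); pose m' := g' * den (den12 R L a b c).
exists (m + m'), (a + a')%N, (b + b')%N, (c + c')%N.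
have d12e := den12D R L a b c a' b' c'; have d20e := den20D R L a b c a' b' c'.
have d12e' : den (den12 R L (a + a') (b + b') (c + c')) =
    den (den12 R L a' b' c') * den (den12 R L a b c).
  by rewrite d12e; exact: central_den.
have d20e' : den (den20 R L (a + a') (b + b') (c + c')) =
    den (den20 R L a' b' c') * den (den20 R L a b c).
  by rewrite d20e; exact: central_den.
split; first exact: represents_add (represents_scale d12e r12) (represents_scale d12e' r12').
have em : subst_x (x_add C L) (m + m') =
    subst_x (x_add C L) g * den (den20 R L a' b' c')
    + subst_x (x_add C L) g' * den (den20 R L a b c).
  by rewrite subst_xD !(subst_xM _ _ (@central_x_add _ _)) !subst_x_den12.
rewrite em.
exact: represents_add (represents_scale d20e r20) (represents_scale d20e' r20').
Qed.

Lemma jacobi_associated u v w (v' : {linear V -> A^o}) : in_graded_dual D v' ->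
  associated (pair_series v' (Yprod12 D u v w)) (pair_series v' (Yiter D u v w)).
Proof.
move=> dv'.
have hom s t : associated (pair_series v' (Yprod12 D (sc s u) (sc t v) w))
    (pair_series v' (Yiter D (sc s u) (sc t v) w)).
  have [g [a [b [c [r12 _ r20]]]]] :=
    jacobi_represents w (has_sign_comp hV s u) (has_sign_comp hV t v) dv'.
  by exists g, a, b, c.
have := associated_add (associated_add (hom false false) (hom false true))
  (associated_add (hom true false) (hom true true)).
have vD := vpairD (linearD v').
have split_sum (T : int * int -> Vphi) (T' : bool -> bool -> int * int -> Vphi) :
    (forall e, T e = \sum_(s : bool) \sum_(t : bool) T' s t e) ->
    pair_series v' T = fun e =>
      pair_series v' (T' false false) e + pair_series v' (T' false true) e
      + (pair_series v' (T' true false) e + pair_series v' (T' true true) e).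
  move=> hT; apply/funext => e.
  have E := etrans (hT e) (esym (sum_bool2 (fun s t => T' s t e))).
  apply: (etrans (congr1 (vpair v') E)).
  exact: (etrans (vD _ _) (congr2 +%R (vD _ _) (vD _ _))).
rewrite (split_sum _ _ (Yprod12_signs hV u v w)).
by rewrite (split_sum _ _ (Yiter_signs hV u v w)).
Qed.

Lemma sfrac_over_nat g (d1 d2 d3 : superlinear C L) (n1 n2 n3 : nat) :
  sfrac_eq (g, nseq n1 d1 ++ nseq n2 d2 ++ nseq n3 d3)
    (sfrac_over g [:: (d1, n1%:Z); (d2, n2%:Z); (d3, n3%:Z)]).
Proof.
have pos0 n : pos_part (- n%:Z) = 0%N by case: n.
exists [::]; rewrite /sfrac_over /= cats0 !big_cons big_nil /= !pos0 !expr0 !mulr1.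
by rewrite subrr mul0r.
Qed.

Lemma jacobi_rationality_products : rationality_products D.
Proof.
move=> s t u v w v' su tv dv' S.
have [g [a [b [c [r12 _ _]]]]] := jacobi_represents w su tv dv'.
have [N hN] : bounded finite_neg_y S by case: r12.
split.
- by exists (- N) => e lt_e; apply: hN; rewrite /= lt_e orbT.
- by exists N => e lt_e; apply: hN; rewrite /= lt_e.
exists (g, den12 R L a b c); split.
- exact: represents_iotaE r12.
- by exists g, a%:Z, b%:Z, c%:Z; exact: sfrac_over_nat.
- move=> f' e'; apply: (represents_uniq (S := S) (dir := finite_neg_y)) r12.
  by rewrite e'; exact: represents_iota.
Qed.

(** With z = phi1 phi2, this trades the denominator x + y + phi1 phi2, in which
    the iterates arise, for x + y - phi1 phi2: the numerator of a fraction is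
    multiplied by l - 3 z for each factor l + z. *)
Lemma linear_trade (T : nzRingType) (l z : T) : central z -> z * z = 0 ->
  (l - z) * (l - z) = (l + z) * (l - z - z - z).
Proof.
move=> cz z2; rewrite !mulrBr !mulrBl !mulrDl z2 !addr0 !subr0 -!(cz l).
by rewrite addrK.
Qed.

Definition trade_poly : P :=
  var_x C L + var_y C L - const_poly (phi1 * phi2) - const_poly (phi1 * phi2)
  - const_poly (phi1 * phi2).

Lemma lin_addE : superlinear_poly (lin_add : superlinear C L) =
  var_x C L + var_y C L - const_poly (phi1 * phi2).
Proof.
apply: (etrans (superlinear_polyE _)).
have eN : const_poly (const_phi (-1)) * const_poly (phi1 * phi2) = - const_poly (phi1 * phi2) :> P.
  rewrite const_poly_phiN mulNr; congr (- _); exact: const_poly1_mul.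
exact: (congr2 +%R (congr2 +%R (const_poly1_mul _) (const_poly1_mul _)) eN).
Qed.

Lemma lin_add_sq : superlinear_poly (lin_add : superlinear C L) ^+ 2 =
  superlinear_poly lin_plus * trade_poly.
Proof.
rewrite expr2 lin_addE lin_plusE; apply: linear_trade; first exact: central_phi12_poly.
by rewrite /const_poly -!polyCM phi12_sq !polyC0.
Qed.

Lemma lin_add_exp a : superlinear_poly (lin_add : superlinear C L) ^+ (2 * a) =
  superlinear_poly lin_plus ^+ a * trade_poly ^+ a.
Proof.
apply: (etrans (exprM _ 2 a)); apply: (etrans (congr1 (fun x : P => x ^+ a) lin_add_sq)).
exact: (exprMn_comm a (central_superlinear lin_plus trade_poly)).
Qed.

Lemma central_rev (T : nzRingType) (x y p t : T) : central x -> central y -> central p ->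
  x * (y * (p * t)) = t * (p * (y * x)).
Proof. by move=> cx cy cp; rewrite (cx (y * _)) (cy (p * _)) (cp t) -!mulrA. Qed.

Lemma den20_trade (g : P) a b c :
  sfrac_eq (g, den20 R L a b c)
    (g * trade_poly ^+ a, nseq c lin_x ++ nseq b lin_y ++ nseq (2 * a) lin_add).
Proof.
have cX n d : central (superlinear_poly d ^+ n : P) by apply: centralX; exact: central_superlinear.
have e : den (nseq c lin_x ++ nseq b lin_y ++ nseq (2 * a) lin_add) =
    trade_poly ^+ a * den (den20 R L a b c) :> P.
  apply: (etrans (den_cat _ _)); apply: (etrans (congr1 _ (den_cat _ _))).
  apply: (etrans (congr2 *%R (den_nseq _ _) (congr2 *%R (den_nseq _ _)
    (etrans (den_nseq _ _) (lin_add_exp a))))).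
  apply: (etrans (central_rev _ (cX c lin_x) (cX b lin_y) (cX a lin_plus))).
  exact: (congr1 _ (esym (den20E R L a b c))).
by exists [::]; rewrite /= e mulrA subrr mul0r.
Qed.

Lemma jacobi_rationality_iterates : rationality_iterates D.
Proof.
move=> u v w v' dv' S.
have [g [a [b [c [_ r20]]]]] := jacobi_associated u v w dv'.
have [N hN] : bounded finite_neg_x S by case: r20.
split.
- by exists (- N) => e lt_e; apply: hN; rewrite /= lt_e.
- by exists N => e lt_e; apply: hN; rewrite /= lt_e orbT.
pose k := subst_x (x_add C L) g.
pose h : sfrac C L := (superpoly_unshift k, den20 R L a b c).
have hE : sfrac_shift h = (k, den20 R L a b c).
  by rewrite /sfrac_shift /h /= superpoly_unshiftK.
exists h; split.
- by rewrite hE; exact: represents_iotaE r20.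
- exists (superpoly_unshift (k * trade_poly ^+ a)), c%:Z, b%:Z, (2 * a)%N%:Z.
  rewrite hE superpoly_unshiftK; apply: sfrac_eq_trans (den20_trade k a b c) _.
  exact: sfrac_over_nat.
- move=> h' e'; apply: sfrac_shift_inj; rewrite hE.
  apply: (represents_uniq (S := S) (dir := finite_neg_x)) r20.
  by rewrite e'; exact: represents_iota.
Qed.

Lemma jacobi_supercommutativity : supercommutativity D.
Proof.
move=> s t u v w v' su tv dv'.
have [g [a [b [c [r12 r21 _]]]]] := jacobi_represents w su tv dv'.
exists (g, den12 R L a b c), (sfrac_sign (s && t) (g, den12 R L a b c)); split.
- exact: represents_iotaE r12.
- apply: represents_iotaE; rewrite -[pairing _ _]/(pair_series v' (Yprod21 D u v w)).
  by rewrite -[pair_series _ _](signedK (s && t)); exact: represents_signed r21.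
- by rewrite sfrac_signK; exact: sfrac_eq_refl.
Qed.

Lemma jacobi_associativity : associativity D.
Proof.
move=> u v w v' dv'; have [g [a [b [c [r12 r20]]]]] := jacobi_associated u v w dv'.
exists (g, den12 R L a b c), (subst_x (x_add C L) g, den20 R L a b c); split.
- exact: represents_iotaE r12.
- exact: represents_iotaE r20.
apply: sfrac_eq_trans (sfrac_subst_add g (den12 R L a b c)) _.
apply: sfrac_eq_den; rewrite -!subst_x_den_sub.
by rewrite den12_add.
Qed.

End FromJacobi.

End Equivalence.

Theorem proposition9p4 (R : realType) (L : option nat)
    (V : lmodType (grassmann R[i] L)) (D : vosa_data V) :
  (vosa_except_jacobi D ->
   rationality_products D -> rationality_iterates D ->
   supercommutativity D -> associativity D ->
   jacobi_identity D)
  /\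
  (is_vosa D <->
   vosa_except_jacobi D /\
   [/\ rationality_products D, rationality_iterates D,
       supercommutativity D & associativity D]).
Proof.
split=> [hV P1 _ P3 P4|]; first exact: rational_jacobi.
split=> [[hV jac]|[hV [P1 _ P3 P4]]]; last by split=> //; exact: rational_jacobi.
split=> //; split.
- exact: jacobi_rationality_products.
- exact: jacobi_rationality_iterates.
- exact: jacobi_supercommutativity.
- exact: jacobi_associativity.
Qed.
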